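(* Let $X=\{X(t),\,t\ge 0\}$ be a one-dimensional symmetric $1$-stable process. Suppose that $f:\mathbb{R}\to\mathbb{R}$ is a bounded Borel function with $\int_{\mathbb{R}}|x f(x)|\,dx<\infty$. Then, for any $t>0$, as $n\to\infty$, $$\frac{1}{n}\int_0^{e^{nt}} f(X(s))\,ds \;\longrightarrow\; \Big(\frac{1}{\pi}\int_{\mathbb{R}} f(x)\,dx\Big)\,Z(t)\quad\text{in law},$$ where $Z(t)$ is an exponential random variable with parameter $t$ (i.e. with mean $t$).
   Context: A symmetric $1$-stable process is a real-valued Lévy process (càdlàg paths, stationary independent increments, $X(0)=0$) with characteristic function $\mathbb{E}\,e^{i x X(t)}=e^{-t|x|}$ for all $t\ge 0$, $x\in\mathbb{R}$. ''Exponential with parameter $t$'' is in the mean parametrization: $\mathbb{E}[Z(t)^m]=m!\,t^m$ for all $m\in\mathbb{N}$. *)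

(* Defs.v *)
From HB Require Import structures.
From mathcomp Require Import all_boot all_order all_algebra.
From mathcomp Require Import all_classical all_reals all_analysis.
From mathcomp Require Import complex.
Set Implicit Arguments.
Unset Strict Implicit.
Unset Printing Implicit Defensive.
Import Order.TTheory GRing.Theory Num.Theory.
Import numFieldNormedType.Exports.
Local Open Scope classical_set_scope.
Local Open Scope ring_scope.

(* The sets [A i] range over all measurable sets, [setT] included, so the
   product rule over the whole index type yields it for every subfamily. *)
Definition mutually_independent (R : realType) (d : measure_display)
    (T : measurableType d) (P : probability T R) (I : finType)
    (Y : I -> T -> R) : Prop :=
  forall A : I -> set R, (forall i, measurable (A i)) ->
    P (\bigcap_(i in [set: I]) (Y i @^-1` A i))
    = (\prod_(i : I) P (Y i @^-1` A i))%E.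

Definition cadlag (R : realType) (x : R -> R) : Prop :=
  (forall t : R, 0 <= t -> x s @[s --> t^'+] --> x t) /\
  (forall t : R, 0 < t -> exists l : R, x s @[s --> t^'-] --> l).

(* A process with time set [0, +oo) is a family indexed by [R] of which only
   the members with nonnegative index matter. *)
Record levy_process (R : realType) (d : measure_display)
    (T : measurableType d) (P : probability T R) (X : R -> T -> R) : Prop := {
  levy_measurable : forall t : R, 0 <= t -> measurable_fun [set: T] (X t);
  levy_cadlag : forall w : T, cadlag (fun t => X t w);
  levy_start : {ae P, forall w, X 0 w = 0};
  levy_stationary : forall s h : R, 0 <= s -> 0 <= h ->
    forall A : set R, measurable A ->
      P ((X (s + h) \- X s) @^-1` A) = P ((X h \- X 0) @^-1` A);
  levy_independent : forall (n : nat) (u : nat -> R),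
    0 <= u 0%N -> (forall i, (i < n)%N -> u i <= u i.+1) ->
    mutually_independent P (fun i : 'I_n => X (u i.+1) \- X (u i))
}.

(* E e^{ixY} = E cos(xY) + i E sin(xY); both integrands are bounded by 1, so
   [fine] loses nothing when [Y] is measurable. *)
Definition char_fun (R : realType) (d : measure_display)
    (T : measurableType d) (P : probability T R) (Y : T -> R) (x : R) : R[i] :=
  Complex (fine 'E_P[fun w => cos (x * Y w)]%E)
          (fine 'E_P[fun w => sin (x * Y w)]%E).

Definition symmetric_1stable (R : realType) (d : measure_display)
    (T : measurableType d) (P : probability T R) (X : R -> T -> R) : Prop :=
  levy_process P X /\
  forall t x : R, 0 <= t ->
    char_fun P (X t) x = real_complex R (expR (- (t * `|x|))).

(* [exponential_prob] takes the rate, the inverse of the mean. *)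
Definition exponential_with_mean (R : realType) (d : measure_display)
    (T : measurableType d) (P : probability T R) (Z : {RV P >-> R}) (m : R)
    : Prop :=
  forall A : set R, measurable A ->
    distribution P Z A = exponential_prob m^-1 A.

(* Measurability is part of the definition: the integral of a non-measurable
   function carries no meaning. *)
Definition cvg_in_law (R : realType)
    (d : measure_display) (T : measurableType d) (P : probability T R)
    (Y : nat -> T -> R)
    (d' : measure_display) (T' : measurableType d') (P' : probability T' R)
    (Y' : T' -> R) : Prop :=
  [/\ forall n, measurable_fun [set: T] (Y n),
      measurable_fun [set: T'] Y' &
      forall g : R -> R, continuous g -> bounded_fun g ->
        'E_P[g \o Y n]%E @[n --> \oo] --> 'E_P'[g \o Y']%E].

(* Main.v *)
Require Import Defs.
From HB Require Import structures.
From mathcomp Require Import all_boot all_order all_algebra.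
From mathcomp Require Import all_classical all_reals all_analysis.
From mathcomp Require Import measurable_realfun complex ring lra zify.
Import Order.TTheory GRing.Theory Num.Theory.
Import numFieldNormedType.Exports.

(** Write I for the indicator of [0, 1], c for the integral of f, and S_N for
    the number of j in 1..N with X_j in [0, 1]. The process is null recurrent
    at the borderline of transience: X_t has the Cauchy density, which is
    1/(pi t) + O(1/t^2) near the origin, so the expected time spent in a
    bounded set up to time T grows like log T. This is why the natural time
    scale is e^(nt) and the normalization 1/n.

    The law. The hypothesis is about characteristic functions. Convolving with
    a Cauchy kernel of scale e turns it into a statement on densities, because
    the kernel is the Laplace transform of the cosine:
    E q_e(X_t - z) = q_(e+t)(z) (expect_cauchy_pdf). Letting e tend to 0 gives
    the law of X_t (cauchy_law_itv). After that only the density enters.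

    Reduction to visits at integer times. For u < v the Markov property and
    the expansion of the density give E a(X_u) b(X_v) = (int b) E a(X_u) /
    (pi (v - u)) up to O(1/(u (v - u)^2)) (correlation_approx). The main term
    sees b only through its integral, so it cancels in the products of
    eta_j = int_j^(j+1) f(X_s) ds - c I(X_(j+1)), whose correlations E eta_i
    eta_j are thus O(1/(i (j - i)^2)) off the diagonal. Hence the second
    moment of the sum of the first N of them is O(log N), which is O(n) for N
    = e^(nt), and after division by n^2 it vanishes
    (occupation_difference_cvg). It remains to find the limit law of S_N / n.

    The number of visits. Let w_N(x) be the expectation of the product over j
    in 1..N of 1 - beta I(x + X_j), and Phi_N its integral over x in [0, 1].
    Decomposing at the first factor and iterating, w_N(x) is 1 - beta times
    the sum over j < N of the expectation of I w_(N-1-j) at x + X_(j+1); the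
    expansion of the density turns this into Phi_N = 1 - (beta/pi) (sum over j
    < N of Phi_(N-1-j)/(j+1)) + O(beta). Since the factors lie in [0, 1], Phi
    is nonincreasing: bounding all the terms below by Phi_N, and those with
    j < N/2 above by Phi_(N/2), while the others carry at most one unit of
    harmonic weight, one finds Phi_N = 1/(1 + (beta/pi) log N) + o(1) as beta
    log N stays bounded and beta tends to 0 (renewal_upper, renewal_lower).
    With 1 - beta = e^(-k/n) and log N = nt the product is exp(-k S_N/n), and
    its expectation tends to 1/(1 + k t/pi), the Laplace transform at k of
    Z(t)/pi (laplace_occupation_cvg).

    Conclusion. Convergence of the Laplace transforms at the integers k is
    convergence of the moments of exp(-S_N/n), a variable in [0, 1], hence
    convergence in law by Weierstrass approximation; a perturbation small in
    mean square does not change the limit (law_limit). *)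

Set Implicit Arguments.
Unset Strict Implicit.
Unset Printing Implicit Defensive.
Local Open Scope classical_set_scope.
Local Open Scope ring_scope.

(** * Bounded measurable functions, Fubini, densities *)

(** These are the functions to which expectations, Fubini and independence
    are applied: under a probability they are integrable, and the class is
    stable under all the operations used below. *)
Definition bdd_measurable d (T : measurableType d) (R : realType)
    (h : T -> R) : Prop :=
  measurable_fun setT h /\ exists M : R, forall x, `|h x| <= M.

Section bdd_measurable_theory.
Context d (T : measurableType d) (R : realType).
Implicit Types (g h : T -> R).

Lemma bdd_measurable_bound h : bdd_measurable h ->
  exists2 M : R, 0 <= M & forall x, `|h x| <= M.
Proof.
move=> [_ [M hM]]; exists `|M| => // x.
by rewrite (le_trans (hM x))// ler_norm.
Qed.

Lemma bdd_measurable_cst (c : R) : bdd_measurable (fun _ : T => c).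
Proof. by split; [exact: measurable_cst|exists `|c|]. Qed.

Lemma bdd_measurableD g h : bdd_measurable g -> bdd_measurable h ->
  bdd_measurable (fun x => g x + h x).
Proof.
move=> [mg [M gM]] [mh [N hN]]; split; first exact: measurable_funD.
by exists (M + N) => x; rewrite (le_trans (ler_normD _ _))// lerD.
Qed.

Lemma bdd_measurableN h : bdd_measurable h -> bdd_measurable (fun x => - h x).
Proof.
move=> [mh [N hN]]; split; first exact: measurable_funN.
by exists N => x; rewrite normrN.
Qed.

Lemma bdd_measurableB g h : bdd_measurable g -> bdd_measurable h ->
  bdd_measurable (fun x => g x - h x).
Proof. by move=> bg bh; apply: bdd_measurableD => //; exact: bdd_measurableN. Qed.

Lemma bdd_measurableM g h : bdd_measurable g -> bdd_measurable h ->
  bdd_measurable (fun x => g x * h x).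
Proof.
move=> bg bh.
have [M M0 gM] := bdd_measurable_bound bg.
have [N N0 hN] := bdd_measurable_bound bh.
split; first by apply: measurable_funM; [case: bg|case: bh].
by exists (M * N) => x; rewrite normrM ler_pM.
Qed.

Lemma bdd_measurableZ (c : R) h : bdd_measurable h ->
  bdd_measurable (fun x => c * h x).
Proof. by apply: bdd_measurableM; exact: bdd_measurable_cst. Qed.

Lemma bdd_measurable_norm h : bdd_measurable h ->
  bdd_measurable (fun x => `|h x|).
Proof.
move=> [mh [N hN]]; split; first exact: measurableT_comp.
by exists N => x; rewrite normr_id.
Qed.

Lemma bdd_measurable_indic (A : set T) : measurable A ->
  bdd_measurable (\1_A : T -> R).
Proof.
move=> mA; split; first exact: measurable_indic.
by exists 1 => x; rewrite indicE; case: (x \in A); rewrite ?normr1 ?normr0.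
Qed.

Lemma bdd_measurable_sum (I : Type) (r : seq I) (h : I -> T -> R) :
  (forall i, bdd_measurable (h i)) ->
  bdd_measurable (fun x => \sum_(i <- r) h i x).
Proof.
move=> bh; elim: r => [|i r IH].
  under [X in bdd_measurable X]eq_fun do rewrite big_nil.
  exact: bdd_measurable_cst.
under [X in bdd_measurable X]eq_fun do rewrite big_cons.
exact: bdd_measurableD.
Qed.

Lemma bdd_measurable_prod (I : Type) (r : seq I) (h : I -> T -> R) :
  (forall i, bdd_measurable (h i)) ->
  bdd_measurable (fun x => \prod_(i <- r) h i x).
Proof.
move=> bh; elim: r => [|i r IH].
  under [X in bdd_measurable X]eq_fun do rewrite big_nil.
  exact: bdd_measurable_cst.
under [X in bdd_measurable X]eq_fun do rewrite big_cons.
exact: bdd_measurableM.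
Qed.

End bdd_measurable_theory.

Lemma bdd_measurable_comp d d' (T : measurableType d) (S : measurableType d')
    (R : realType) (h : S -> R) (Y : T -> S) :
  bdd_measurable h -> measurable_fun setT Y -> bdd_measurable (h \o Y).
Proof.
move=> [mh [M hM]] mY; split; first exact: measurableT_comp.
by exists M => x; exact: hM.
Qed.

Section expectation.
Context d (T : measurableType d) (R : realType) (P : probability T R).
Implicit Types (g h : T -> R).

Lemma bdd_measurable_integrable h : bdd_measurable h ->
  P.-integrable setT (EFin \o h).
Proof.
move=> bh; have [M M0 hM] := bdd_measurable_bound bh.
apply: (@le_integrable _ _ _ P setT measurableT _ (EFin \o cst M)).
- by apply/measurable_EFinP; case: bh.
- by move=> x _ /=; rewrite lee_fin (le_trans (hM x))// ler_norm.
- exact: finite_measure_integrable_cst.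
Qed.

Lemma expect_cst (c : R) : \int[P]_w c = c.
Proof.
by rewrite Rintegral_cst// [X in fine X](probability_setT P) mulr1.
Qed.

Lemma expectD g h : bdd_measurable g -> bdd_measurable h ->
  \int[P]_w (g w + h w) = \int[P]_w g w + \int[P]_w h w.
Proof. by move=> bg bh; rewrite RintegralD//; exact: bdd_measurable_integrable. Qed.

Lemma expectB g h : bdd_measurable g -> bdd_measurable h ->
  \int[P]_w (g w - h w) = \int[P]_w g w - \int[P]_w h w.
Proof. by move=> bg bh; rewrite RintegralB//; exact: bdd_measurable_integrable. Qed.

Lemma expectZ (c : R) h : bdd_measurable h ->
  \int[P]_w (c * h w) = c * \int[P]_w h w.
Proof. by move=> bh; rewrite RintegralZl//; exact: bdd_measurable_integrable. Qed.

Lemma expect_sum (I : Type) (r : seq I) (h : I -> T -> R) :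
  (forall i, bdd_measurable (h i)) ->
  \int[P]_w (\sum_(i <- r) h i w) = \sum_(i <- r) \int[P]_w h i w.
Proof.
move=> bh; elim: r => [|i r IH].
  under eq_Rintegral do rewrite big_nil.
  by rewrite big_nil expect_cst.
under eq_Rintegral do rewrite big_cons.
by rewrite big_cons expectD ?IH//; exact: bdd_measurable_sum.
Qed.

Lemma le_expect g h : bdd_measurable g -> bdd_measurable h ->
  (forall w, g w <= h w) -> \int[P]_w g w <= \int[P]_w h w.
Proof.
by move=> bg bh gh; apply: le_Rintegral => //; exact: bdd_measurable_integrable.
Qed.

Lemma le_norm_expect h : bdd_measurable h ->
  `|\int[P]_w h w| <= \int[P]_w `|h w|.
Proof.
by move=> bh; apply: le_normr_Rintegral => //; exact: bdd_measurable_integrable.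
Qed.

Lemma norm_expect_le h (M : R) : bdd_measurable h -> (forall w, `|h w| <= M) ->
  `|\int[P]_w h w| <= M.
Proof.
move=> bh hM; rewrite (le_trans (le_norm_expect bh))// -[leRHS]expect_cst.
apply: le_expect => //; first exact: bdd_measurable_norm.
exact: bdd_measurable_cst.
Qed.

Lemma expectationE h : bdd_measurable h ->
  'E_P[h]%E = (\int[P]_w h w)%:E.
Proof.
move=> bh; rewrite unlock /Rintegral fineK//; apply: integrable_fin_num => //.
exact: bdd_measurable_integrable.
Qed.

End expectation.

Section fubini.
Context d1 d2 (T1 : measurableType d1) (T2 : measurableType d2) (R : realType).

Lemma measurable_Rintegral_snd (mu : {sigma_finite_measure set T2 -> \bar R})
    (F : T1 * T2 -> R) : measurable_fun setT F ->
  measurable_fun setT (fun x => \int[mu]_y F (x, y)).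
Proof.
move=> mF; rewrite /Rintegral.
apply: (measurableT_comp (@fine_measurable _ _ measurableT)).
have mFE : measurable_fun setT (EFin \o F) by exact/measurable_EFinP.
pose G := EFin \o F.
rewrite (_ : (fun x => _) = ((fun x => \int[mu]_y G^\+ (x, y)) \-
    (fun x => \int[mu]_y G^\- (x, y)))%E); last first.
  apply/funext => x; rewrite [LHS]integralE.
  under eq_integral do rewrite (funepos_comp G (pair x))/=.
  by under [X in (_ - X = _)%E]eq_integral do
    rewrite (funeneg_comp G (pair x))/=.
by apply: emeasurable_funB; apply: measurable_fun_fubini_tonelli_F => //;
  [exact: measurable_funepos|exact: measurable_funeneg].
Qed.

Lemma bdd_measurable_Rintegral_snd (P : probability T2 R) (F : T1 * T2 -> R) :
  bdd_measurable F -> bdd_measurable (fun x => \int[P]_y F (x, y)).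
Proof.
move=> bF; have [M M0 hM] := bdd_measurable_bound bF.
split; first by apply: measurable_Rintegral_snd; case: bF.
exists M => x; apply: norm_expect_le => //.
exact: (bdd_measurable_comp bF (pair1_measurable x)).
Qed.

(** Domination by a function of the second variable is the form in which
    integrability of F is available below: the first measure is a
    probability, the second is Lebesgue measure. *)
Lemma Rfubini_dominated (P : probability T1 R)
    (mu : {sigma_finite_measure set T2 -> \bar R}) (F : T1 * T2 -> R)
    (g : T2 -> R) :
  measurable_fun setT F -> mu.-integrable setT (EFin \o g) ->
  (forall x y, `|F (x, y)| <= g y) ->
  \int[P]_x \int[mu]_y F (x, y) = \int[mu]_y \int[P]_x F (x, y).
Proof.
move=> mF ig Fg.
have mFE : measurable_fun setT (EFin \o F) by exact/measurable_EFinP.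
have iy x : mu.-integrable setT (EFin \o (fun y => F (x, y))).
  apply: (@le_integrable _ _ _ mu setT measurableT _ (EFin \o g)) => //.
  - apply/measurable_EFinP; exact: (measurableT_comp mF (pair1_measurable x)).
  - by move=> y _ /=; rewrite lee_fin (le_trans (Fg x y))// ler_norm.
have ix y : P.-integrable setT (EFin \o (fun x => F (x, y))).
  apply: bdd_measurable_integrable; split.
    exact: (measurableT_comp mF (pair2_measurable y)).
  by exists (g y) => x; exact: Fg.
have iF : (P \x mu)%E.-integrable setT (EFin \o F).
  apply/integrable12ltyP => //.
  apply: (@le_lt_trans _ _ (\int[P]_x (\int[mu]_y `|(g y)%:E|))%E).
    apply: ge0_le_integral => //.
    - by move=> x _; exact: integral_ge0.
    - apply: (measurable_fun_fubini_tonelli_F (abse \o (EFin \o F))) => //.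
        exact: measurableT_comp.
      by move=> z; exact: abse_ge0.
    - move=> x _; apply: ge0_le_integral => //.
      + apply: measurableT_comp => //; exact: (measurable_int mu (iy x)).
      + by apply: measurableT_comp => //; exact: (measurable_int mu ig).
      + by move=> y _ /=; rewrite lee_fin (le_trans (Fg x y))// ler_norm.
  rewrite integral_cst//= probability_setT mule1.
  by case/integrableP : ig.
rewrite /Rintegral; congr fine.
transitivity (\int[P]_x \int[mu]_y (F (x, y))%:E)%E.
  apply: eq_integral => x _; rewrite fineK//.
  exact: integrable_fin_num (iy x).
rewrite (Fubini iF).
apply: eq_integral => y _; rewrite fineK//.
exact: integrable_fin_num (ix y).
Qed.

End fubini.

Section density.
Context d (T : measurableType d) (R : realType) (P : probability T R).
Notation mu := (@lebesgue_measure R).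

Lemma ge0_integral_indic_layer (h : R) : 0 <= h ->
  (\int[mu]_r (\1_[set r : R | 0 <= r < h] r)%:E = h%:E)%E.
Proof.
move=> h0.
have -> : [set r : R | 0 <= r < h] = [set` `[0, h[].
  by apply/seteqP; split => x /=; rewrite in_itv.
rewrite integral_indic//= setIT lebesgue_measure_itv/= lte_fin.
move: h0; rewrite le_eqVlt => /predU1P[<-|->]; last by rewrite oppr0 addr0.
by rewrite ltxx.
Qed.

(** The density gives the law on sets, and the step to functions is the
    layer-cake formula: h(y) is the Lebesgue measure of the r >= 0 with r <
    h(y), so both sides become, by Tonelli, the integral over r of the
    probability that h(Y) > r. *)
Lemma ge0_integral_density (Y : T -> R) (p : R -> R) (h : R -> R) :
  measurable_fun setT Y -> measurable_fun setT p -> (forall x, 0 <= p x) ->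
  (forall A, measurable A -> P (Y @^-1` A) = \int[mu]_(x in A) (p x)%:E)%E ->
  measurable_fun setT h -> (forall x, 0 <= h x) ->
  (\int[P]_w (h (Y w))%:E = \int[mu]_x (h x * p x)%:E)%E.
Proof.
move=> mY mp p0 Yp mh h0.
(* A y is the segment whose length is h y. *)
pose A (y : R) := [set r : R | 0 <= r < h y].
have mA2 : measurable [set z : R * R | 0 <= z.2 < h z.1].
  have mm : measurable_fun setT (fun z : R * R => (0 <= z.2) && (z.2 < h z.1)).
    apply: (@measurable_and _ _ _ (fun z : R * R => 0 <= z.2)
      (fun z : R * R => z.2 < h z.1)).
    - exact: measurable_fun_ler.
    - by apply: measurable_fun_ltr => //; exact: measurableT_comp.
  by rewrite -[X in measurable X]setTI; exact: (mm measurableT [set true]).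
have mind : measurable_fun setT (fun z : R * R => \1_(A z.1) z.2 : R).
  have -> : (fun z : R * R => \1_(A z.1) z.2) =
    (\1_[set z : R * R | 0 <= z.2 < h z.1] : _ -> R).
    by apply/funext => z; rewrite !indicE; congr ((nat_of_bool _)%:R); apply: asbool_equiv_eq.
  exact: measurable_indic.
transitivity (\int[P]_w \int[mu]_r (\1_(A (Y w)) r)%:E)%E.
  by apply: eq_integral => w _; rewrite ge0_integral_indic_layer.
transitivity (\int[mu]_r \int[P]_w (\1_(A (Y w)) r)%:E)%E.
  apply: (fubini_tonelli (m1 := P) (m2 := mu)
    (fun z : T * R => (\1_(A (Y z.1)) z.2)%:E)).
  - apply/measurable_EFinP.
    apply: (measurableT_comp mind (g := fun z : T * R => (Y z.1, z.2))).
    by apply: measurable_fun_pair => //; exact: measurableT_comp.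
  - by move=> z; rewrite lee_fin.
transitivity (\int[mu]_r \int[mu]_x ((\1_(A x) r) * p x)%:E)%E.
  apply: eq_integral => r _.
  pose B := [set x : R | 0 <= r < h x].
  have mB : measurable B.
    have mm : measurable_fun setT (fun x : R => (0 <= r) && (r < h x)).
      apply: (@measurable_and _ _ _ (fun _ => 0 <= r) (fun x => r < h x)) => //.
      exact: measurable_fun_ltr.
    by rewrite -[X in measurable X]setTI; exact: (mm measurableT [set true]).
  have e x : \1_(A x) r = \1_B x :> R.
    by rewrite !indicE; congr ((nat_of_bool _)%:R); apply: asbool_equiv_eq.
  transitivity (P (Y @^-1` B)).
    have mYB : measurable (Y @^-1` B).
      by rewrite -[X in measurable X]setTI; exact: mY.
    under eq_integral do rewrite e.
    by rewrite (integral_indic P measurableT mYB) setIT.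
  rewrite Yp// integral_mkcond; apply: eq_integral => x _.
  by rewrite e restrict_EFin /= patchE indicE; case: ifPn; rewrite ?mul1r ?mul0r.
transitivity (\int[mu]_x \int[mu]_r ((\1_(A x) r) * p x)%:E)%E.
  symmetry; apply: (fubini_tonelli (m1 := mu) (m2 := mu)
    (fun z : R * R => (\1_(A z.1) z.2 * p z.1)%:E)).
  - by apply/measurable_EFinP/measurable_funM => //; exact: measurableT_comp.
  - by move=> z; rewrite lee_fin mulr_ge0.
apply: eq_integral => x _.
under eq_integral do rewrite EFinM.
rewrite ge0_integralZr//; last 2 first.
  - apply/measurable_EFinP.
    exact: (measurableT_comp mind (pair1_measurable x)).
  - by rewrite lee_fin.
by rewrite ge0_integral_indic_layer// EFinM.
Qed.

End density.

(** * The Cauchy density and the Laplace transform of the cosine *)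

Section FTC_everywhere.
Context (R : realType).
Notation mu := (@lebesgue_measure R).

Lemma is_derive_continuous (F : R -> R) (f : R -> R) :
  (forall x : R, is_derive x (1:R) F (f x)) -> continuous F.
Proof.
move=> dF x; apply: differentiable_continuous; apply/derivable1_diffP.
by case: (dF x).
Qed.

Lemma integral_itv_is_derive (F f : R -> R) (a b : R) : a < b ->
  (forall x : R, is_derive x (1:R) F (f x)) -> continuous f ->
  (\int[mu]_(x in `[a, b]) (f x)%:E = (F b - F a)%:E)%E.
Proof.
move=> ab dF cf.
rewrite (continuous_FTC2 (F := F) ab)//.
- by apply: continuous_subspaceT.
- split.
  + by move=> x _; case: (dF x).
  + by apply: cvg_at_right_filter; exact: is_derive_continuous dF a.
  + by apply: cvg_at_left_filter; exact: is_derive_continuous dF b.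
- by move=> x _; rewrite derive1E; exact: (@derive_val _ _ _ _ _ _ _ (dF x)).
Qed.

Lemma ge0_integral_itvy_is_derive (F f : R -> R) (a l : R) :
  (forall x : R, is_derive x (1:R) F (f x)) -> continuous f ->
  (forall x, a <= x -> 0 <= f x) -> F x @[x --> +oo] --> l ->
  (\int[mu]_(x in `[a, +oo[) (f x)%:E = (l - F a)%:E)%E.
Proof.
move=> dF cf f0 Fl.
rewrite (ge0_continuous_FTC2y f0 _ Fl) ?EFinB//.
- by apply: continuous_subspaceT.
- by apply: cvg_at_right_filter; exact: is_derive_continuous dF a.
- by move=> x _; rewrite derive1E; case: (dF x).
Qed.
End FTC_everywhere.

Section cauchy_density.
Context (R : realType).
Notation mu := (@lebesgue_measure R).

Definition cauchy_pdf (s x : R) : R := pi^-1 * (s / (s ^+ 2 + x ^+ 2)).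

Lemma cauchy_den_gt0 (s x : R) : 0 < s -> 0 < s ^+ 2 + x ^+ 2.
Proof. by move=> s0; rewrite ltr_wpDr ?sqr_ge0// exprn_gt0. Qed.

Lemma cauchy_pdf_ge0 (s x : R) : 0 < s -> 0 <= cauchy_pdf s x.
Proof.
move=> s0; rewrite mulr_ge0 ?invr_ge0 ?pi_ge0// divr_ge0 ?(ltW s0)//.
exact/ltW/cauchy_den_gt0.
Qed.

Lemma cauchy_pdf_le (s x : R) : 0 < s -> cauchy_pdf s x <= (pi * s)^-1.
Proof.
move=> s0; rewrite invfM ler_wpM2l ?invr_ge0 ?pi_ge0//.
rewrite ler_pdivrMr ?cauchy_den_gt0// mulrDr expr2 mulrA mulVf ?gt_eqF// mul1r.
by rewrite lerDl mulr_ge0 ?invr_ge0 ?sqr_ge0// ltW.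
Qed.

(** The density is nearly flat on bounded sets once s is large: the
    difference of 1/(pi s) and the density is x^2/(pi s (s^2 + x^2)), and 2
    s |x| <= s^2 + x^2. An error of order 1/s^2 is summable along the
    integers, whereas the main term 1/(pi s) is not. *)
Lemma le_cauchy_pdf (s x : R) : 0 < s ->
  (pi * s)^-1 - `|x| / (2 * pi * s ^+ 2) <= cauchy_pdf s x.
Proof.
move=> s0; have d0 := cauchy_den_gt0 x s0; rewrite lerBlDr -lerBlDl /cauchy_pdf.
move: (pi : R) (pi_gt0 R) => p p0.
have -> : (p * s)^-1 - p^-1 * (s / (s ^+ 2 + x ^+ 2)) =
  x ^+ 2 / (p * s * (s ^+ 2 + x ^+ 2)).
  by field; rewrite !gt_eqF.
rewrite ler_pdivrMr ?mulr_gt0//.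
have -> : `|x| / (2 * p * s ^+ 2) * (p * s * (s ^+ 2 + x ^+ 2)) =
   `|x| * (s ^+ 2 + x ^+ 2) / (2 * s) by field; rewrite !gt_eqF.
rewrite ler_pdivlMr ?mulr_gt0// -!(real_normK (num_real x)).
have := normr_ge0 x; move: (`|x|) => y y0.
rewrite -subr_ge0 (_ : _ - _ = y * (s - y) ^+ 2); last by ring.
by rewrite mulr_ge0// sqr_ge0.
Qed.

Lemma is_derive_cauchy_cdf (s y x : R) : 0 < s ->
  is_derive x (1:R) (fun x => pi^-1 * atan ((x - y) / s)) (cauchy_pdf s (x - y)).
Proof.
move=> s0.
have h : is_derive x (1:R) (fun x => (x - y) / s) s^-1.
  by apply: is_derive_eq; rewrite scaler0 add0r subr0 -[LHS]/(s^-1 * 1) mulr1.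
have k := @is_derive1_comp R atan (fun x => (x - y) / s) x _ _
  (is_derive1_atan ((x - y) / s)) h.
apply: (is_derive_eq (is_deriveZ pi^-1 k)).
rewrite /cauchy_pdf -[LHS]/(pi^-1 * _); congr (_ * _).
have := cauchy_den_gt0 (x - y) s0; set D := s ^+ 2 + _ => D0.
have -> : 1 + ((x - y) / s) ^+ 2 = D / s ^+ 2.
  by rewrite /D; field; rewrite gt_eqF.
by field; rewrite !gt_eqF.
Qed.

Lemma continuous_cauchy_pdf (s : R) : 0 < s -> continuous (cauchy_pdf s).
Proof.
move=> s0 x; apply: cvgM; first exact: cvg_cst.
apply: cvgM; first exact: cvg_cst.
apply: cvgV; first by rewrite gt_eqF// cauchy_den_gt0.
by apply: cvgD; [exact: cvg_cst|exact: exprn_continuous].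
Qed.

Lemma continuous_cauchy_pdfB (s y : R) : 0 < s ->
  continuous (fun x => cauchy_pdf s (x - y)).
Proof.
move=> s0 x; apply: (@continuous_comp _ _ _ (fun x => x - y) (cauchy_pdf s)).
  by apply: cvgB; [exact: cvg_id|exact: cvg_cst].
exact: continuous_cauchy_pdf.
Qed.

Lemma measurable_cauchy_pdf (s : R) : 0 < s -> measurable_fun setT (cauchy_pdf s).
Proof. by move=> s0; apply: continuous_measurable_fun; exact: continuous_cauchy_pdf. Qed.

Lemma cauchy_pdfN (s x : R) : cauchy_pdf s (- x) = cauchy_pdf s x.
Proof. by rewrite /cauchy_pdf sqrrN. Qed.

(** The distribution function lowered by 1/2; only its increments occur. *)
Definition cauchy_cdf (s x : R) : R := pi^-1 * atan (x / s).

Lemma integral_cauchy_pdf (s y a b : R) : 0 < s -> a < b ->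
  (\int[mu]_(x in `[a, b]) (cauchy_pdf s (x - y))%:E =
   (cauchy_cdf s (b - y) - cauchy_cdf s (a - y))%:E)%E.
Proof.
move=> s0 ab.
apply: (@integral_itv_is_derive _ (fun x => cauchy_cdf s (x - y))) => //.
  by move=> x; exact: is_derive_cauchy_cdf.
exact: continuous_cauchy_pdfB.
Qed.

End cauchy_density.

(** The kernel s/(s^2 + z^2) is the Laplace transform of cos(z x). The
    integrand is handled together with the one at z = 0, as exp(-e x)(1 +
    cos(x z)), which is nonnegative: its improper integral is then the limit
    of its primitive F. *)
Section laplace_cos.
Context (R : realType).
Notation mu := (@lebesgue_measure R).
Variables (e : R).
Hypothesis e0 : 0 < e.

(* A primitive of exp(-e x)(1 + cos(x z)) that vanishes at infinity. *)
Let F (z x : R) : R := expR (- e * x) *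
  (- e^-1 + (e ^+ 2 + z ^+ 2)^-1 * (z * sin (x * z) - e * cos (x * z))).

Let dF (z x : R) :
  is_derive x (1:R) (F z) (expR (- e * x) * (1 + cos (x * z))).
Proof.
have d0 := cauchy_den_gt0 z e0.
have h1 : is_derive x (1:R) (fun x => - e * x) (- e).
  by apply: is_derive_eq; rewrite /GRing.scale/=; ring.
have h2 : is_derive x (1:R) (fun x => x * z) z.
  by apply: is_derive_eq; rewrite /GRing.scale/=; ring.
have h3 := @is_derive1_comp R expR (fun x => - e * x) x _ _
  (is_derive_expR _) h1.
have h4 := @is_derive1_comp R sin (fun x => x * z) x _ _ (is_derive_sin _) h2.
have h5 := @is_derive1_comp R cos (fun x => x * z) x _ _ (is_derive_cos _) h2.
have h6 := is_deriveZ (e ^+ 2 + z ^+ 2)^-1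
  (is_deriveB (is_deriveZ z h4) (is_deriveZ e h5)).
have h7 := is_deriveD (is_derive_cst (- e^-1) x (1:R)) h6.
apply: (is_derive_eq (is_deriveM h3 h7)).
have d1 : e * e + z * z != 0 by rewrite gt_eqF// -!expr2.
rewrite !fctE/= /GRing.scale/=.
move: (expR _) (sin _) (cos _) => E S C.
by field; rewrite d1 gt_eqF.
Qed.

Let F_cvg (z : R) : F z x @[x --> +oo] --> 0.
Proof.
have exp0 : expR (- e * x) @[x --> +oo] --> (0 : R).
  rewrite (_ : (fun x => expR (- e * x)) =
      (fun z => expR (- z)) \o (fun z => e * z)); last first.
    by apply: eq_fun => x; rewrite mulNr.
  apply: (@cvg_comp _ _ _ _ _ _ (pinfty_nbhs R)); last exact: cvgr_expR.
  exact: gt0_cvgMry.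
pose K := e^-1 + (e ^+ 2 + z ^+ 2)^-1 * (`|z| + e).
have F_le x : `|F z x| <= expR (- e * x) * K.
  rewrite normrM ger0_norm ?expR_ge0// ler_wpM2l ?expR_ge0//.
  rewrite (le_trans (ler_normD _ _))// normrN gtr0_norm ?invr_gt0// lerD2l.
  have d0 := cauchy_den_gt0 z e0.
  rewrite normrM gtr0_norm ?invr_gt0// ler_wpM2l ?invr_ge0 ?(ltW d0)//.
  rewrite (le_trans (ler_normB _ _))// !normrM (gtr0_norm e0) lerD//.
    by rewrite ler_piMr// sin_max.
  by rewrite ler_piMr ?(ltW e0)// cos_max.
apply: (@squeeze_cvgr _ _ _ _ (fun x => - (expR (- e * x) * K))
    (fun x => expR (- e * x) * K)).
- by apply: nearW => x; rewrite -ler_norml.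
- by rewrite -oppr0; apply: cvgN; rewrite -(mul0r K); apply: cvgMr_tmp.
- by rewrite -(mul0r K); apply: cvgMr_tmp.
Qed.

Let integral_expR_onePcos (z : R) :
  (\int[mu]_(x in `[0%R, +oo[) (expR (- e * x) * (1 + cos (x * z)))%:E =
   (e^-1 + e / (e ^+ 2 + z ^+ 2))%:E)%E.
Proof.
rewrite (ge0_integral_itvy_is_derive (dF z) _ _ (@F_cvg z))//.
- congr (_%:E); rewrite /F !mulr0 expR0 !mul0r sin0 cos0 mulr0 mulr1 sub0r mul1r.
  by rewrite sub0r opprD opprK mulrN opprK mulrC.
- have cl (c : R) : continuous (fun x : R => c * x) by exact: mulrl_continuous.
  have cr (c : R) : continuous (fun x : R => x * c) by exact: mulrr_continuous.
  have cc : continuous (fun x : R => cos (x * z)).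
    by move=> y; apply: continuous_comp; [exact: cr|exact: continuous_cos].
  have ce : continuous (fun x : R => expR (- e * x)).
    by move=> y; apply: continuous_comp; [exact: cl|exact: continuous_expR].
  move=> x; apply: cvgM; first exact: ce.
  exact: (cvgD (cvg_cst _) (cc x)).
Qed.

Lemma integrable_expR_itvy :
  mu.-integrable `[0, +oo[ (EFin \o (fun x => expR (- e * x))).
Proof.
have m : measurable_fun [set: R] (fun x : R => expR (- e * x)).
  by apply: measurableT_comp => //; exact: measurable_expR.
apply/integrableP; split.
  by apply/measurable_EFinP; exact: measurable_funTS.
have := integral_expR_onePcos 0.
under eq_integral do rewrite mulr0 cos0 (_ : 1 + 1 = 2)//.
move=> h.
apply: (@le_lt_trans _ _
  (\int[mu]_(x in `[0%R, +oo[) (expR (- e * x) * 2)%:E)%E).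
  apply: ge0_le_integral => //.
  - by apply/measurable_EFinP/measurableT_comp => //; exact: measurable_funTS.
  - by apply/measurable_EFinP/measurable_funM => //; exact: measurable_funTS.
  - move=> x _ /=; rewrite lee_fin ger0_norm ?expR_ge0// ler_peMr ?expR_ge0//.
    by rewrite ler1n.
by rewrite h ltry.
Qed.

Lemma Rintegral_expR_itvy : \int[mu]_(x in `[0, +oo[) expR (- e * x) = e^-1.
Proof.
have := integral_expR_onePcos 0.
under eq_integral do rewrite mulr0 cos0 (_ : 1 + 1 = 2)//.
move=> /(congr1 fine); rewrite -/(Rintegral _ _ _) RintegralZr//; last first.
  exact: integrable_expR_itvy.
rewrite /= expr0n/= addr0 expr2 => h.
apply: (@mulIf _ (2:R)) => //; rewrite h.
by field; rewrite gt_eqF.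
Qed.

Lemma Rintegral_expR_cos (z : R) :
  \int[mu]_(x in `[0, +oo[) (expR (- e * x) * cos (x * z)) =
  e / (e ^+ 2 + z ^+ 2).
Proof.
have me : measurable_fun [set: R] (fun x : R => expR (- e * x)).
  by apply: measurableT_comp => //; exact: measurable_expR.
have mc : measurable_fun [set: R] (fun x : R => cos (x * z)).
  apply: continuous_measurable_fun => x.
  by apply: continuous_comp; [exact: mulrr_continuous|exact: continuous_cos].
have ic : mu.-integrable `[0, +oo[ (EFin \o (fun x => expR (- e * x) * cos (x * z))).
  apply: le_integrable integrable_expR_itvy => //.
  - by apply/measurable_EFinP/measurable_funTS/measurable_funM.
  - move=> x _ /=; rewrite lee_fin normrM ler_piMr//.
    by rewrite cos_max.
have := congr1 fine (integral_expR_onePcos z).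
rewrite -/(Rintegral _ _ _) /=.
under eq_Rintegral do rewrite mulrDr mulr1.
rewrite RintegralD//; last exact: integrable_expR_itvy.
by rewrite Rintegral_expR_itvy => /addrI.
Qed.

End laplace_cos.

(** * The law with characteristic function exp(-t|x|) *)

(** Bounded convergence. *)
Lemma expect_cvg d (T : measurableType d) (R : realType) (P : probability T R)
    (h_ : nat -> T -> R) (h : T -> R) (M : R) :
  (forall n, measurable_fun setT (h_ n)) -> (forall n w, `|h_ n w| <= M) ->
  (forall w, h_ n w @[n --> \oo] --> h w) ->
  \int[P]_w h_ n w @[n --> \oo] --> \int[P]_w h w.
Proof.
move=> mh hM hh.
have bh n : bdd_measurable (h_ n) by split => //; exists M.
have mlim : measurable_fun setT h.
  by apply: (measurable_fun_cvg (h := h_)) => // w _; exact: hh.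
have bl : bdd_measurable h.
  split => //; exists M => w.
  have /cvg_lim <- // : `|h_ n w| @[n --> \oo] --> `|h w| by exact: cvg_norm.
  apply: limr_le; last exact: nearW.
  by apply: (cvgP `|h w|); apply: cvg_norm; exact: hh.
have key := @dominated_cvg _ _ _ P setT measurableT (fun n w => (h_ n w)%:E)
  (EFin \o h) (EFin \o cst M).
have : (\int[P]_w (h_ n w)%:E @[n --> \oo] --> \int[P]_w (h w)%:E)%E.
  apply: key => //.
  - by move=> n; exact/measurable_EFinP.
  - by move=> w _; apply: cvg_EFin; [exact: nearW|exact: hh].
  - exact: finite_measure_integrable_cst.
  - by move=> n w _; rewrite /= lee_fin.
rewrite -[X in _ --> X -> _]fineK; last first.
  by apply: (integrable_fin_num measurableT); exact: bdd_measurable_integrable.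
exact: fine_cvg.
Qed.

Lemma Rintegral_indic_mul (R : realType) (D : set R) (h : R -> R) :
  \int[@lebesgue_measure R]_x (\1_D x * h x) =
  \int[@lebesgue_measure R]_(x in D) h x.
Proof.
rewrite [RHS]Rintegral_mkcond; apply: eq_Rintegral => x _.
by rewrite patchE indicE; case: ifPn; rewrite ?mul1r ?mul0r.
Qed.

Lemma integrable_indic_mul (R : realType) (D : set R) (h : R -> R) :
  measurable D -> (@lebesgue_measure R).-integrable D (EFin \o h) ->
  (@lebesgue_measure R).-integrable setT (EFin \o (fun x => \1_D x * h x)).
Proof.
move=> mD ih; have mD' : @measurable _ (measurableTypeR R) D := mD.
have {}ih := (integrable_mkcond _ mD').1 ih.
have e : EFin \o (fun x => \1_D x * h x) = (EFin \o h) \_ D.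
  apply/funext => x /=.
  by rewrite patchE indicE; case: ifPn; rewrite /= ?mul1r ?mul0r.
by rewrite e.
Qed.

Lemma Rfubini_lebesgue d (T : measurableType d) (R : realType)
    (P : probability T R) (F : T * R -> R) (g : R -> R) :
  measurable_fun setT F -> (@lebesgue_measure R).-integrable setT (EFin \o g) ->
  (forall w x, `|F (w, x)| <= g x) ->
  \int[P]_w \int[@lebesgue_measure R]_x F (w, x) =
  \int[@lebesgue_measure R]_x \int[P]_w F (w, x).
Proof.
exact: (@Rfubini_dominated _ _ T (measurableTypeR R) R P (@lebesgue_measure R)).
Qed.

Section cauchy_law.
Context d (T : measurableType d) (R : realType) (P : probability T R).
Notation mu := (@lebesgue_measure R).
Variables (Y : T -> R) (t : R).
Hypothesis t0 : 0 < t.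
Hypothesis mY : measurable_fun setT Y.
Hypothesis Ycos : forall x, 0 <= x ->
  \int[P]_w cos (x * Y w) = expR (- (t * x)).
Hypothesis Ysin : forall x, 0 <= x -> \int[P]_w sin (x * Y w) = 0.

Let expect_cos_shift (x z : R) : 0 <= x ->
  \int[P]_w cos (x * (Y w - z)) = expR (- (t * x)) * cos (x * z).
Proof.
move=> x0.
have mx : measurable_fun setT (fun w => x * Y w) by exact: measurableT_comp.
have bc : bdd_measurable (fun w => cos (x * Y w)).
  split; first by apply: (measurableT_comp _ mx);
    apply: continuous_measurable_fun; exact: continuous_cos.
  by exists 1 => w; exact: cos_max.
have bs : bdd_measurable (fun w => sin (x * Y w)).
  split; first by apply: (measurableT_comp _ mx);
    apply: continuous_measurable_fun; exact: continuous_sin.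
  by exists 1 => w; exact: sin_max.
under eq_Rintegral do rewrite mulrBr cosB [_ * cos (x * z)]mulrC
  [_ * sin (x * z)]mulrC.
rewrite expectD; [|exact: bdd_measurableZ..].
by rewrite !expectZ// Ycos// Ysin// mulr0 addr0 mulrC.
Qed.

(** Writing the kernel q_e as a Laplace transform of cosines and exchanging
    integrals, the characteristic function exp(-t x) multiplies exp(-e x),
    which replaces the scale e by e + t. The law of Y convolved with q_e is
    therefore known exactly. *)
Lemma expect_cauchy_pdf (e z : R) : 0 < e ->
  \int[P]_w cauchy_pdf e (Y w - z) = cauchy_pdf (e + t) z.
Proof.
move=> e0; have et0 : 0 < e + t by exact: addr_gt0.
pose D := `[(0:R), +oo[%classic.
pose G := fun v : T * R => \1_D v.2 * (expR (- e * v.2) * cos (v.2 * (Y v.1 - z))).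
have mG : measurable_fun setT G.
  have mI : measurable_fun [set: R] (\1_D : R -> R).
    by apply: measurable_indic; exact: measurable_itv.
  apply: measurable_funM; first exact: (measurableT_comp mI measurable_snd).
  apply: measurable_funM.
    apply: (measurableT_comp (@measurable_expR R)).
    by apply: (measurableT_comp _ measurable_snd).
  apply: (measurableT_comp (continuous_measurable_fun (@continuous_cos R))).
  apply: measurable_funM => //; apply: measurable_funB => //.
  exact: measurableT_comp.
transitivity (\int[P]_w (pi^-1 * \int[mu]_x G (w, x))).
  apply: eq_Rintegral => w _; rewrite /cauchy_pdf; congr (_ * _).
  by rewrite /G /= Rintegral_indic_mul Rintegral_expR_cos.
have domG w x : `|G (w, x)| <= \1_D x * expR (- e * x).
  rewrite /G /= !normrM ger0_norm// ler_wpM2l// ger0_norm ?expR_ge0//.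
  by rewrite ler_piMr ?expR_ge0// cos_max.
have idom := integrable_indic_mul (measurable_itv _) (integrable_expR_itvy e0).
have bG : bdd_measurable (fun w => \int[mu]_x G (w, x)).
  split; first exact: measurable_Rintegral_snd.
  exists (e^-1) => w.
  rewrite /G /= Rintegral_indic_mul Rintegral_expR_cos// ger0_norm; last first.
    by rewrite divr_ge0// ltW// cauchy_den_gt0.
  rewrite ler_pdivrMr ?cauchy_den_gt0// mulrDr expr2 mulrA mulVf ?gt_eqF// mul1r.
  by rewrite lerDl mulr_ge0 ?invr_ge0 ?sqr_ge0// ltW.
rewrite expectZ// /cauchy_pdf; congr (_ * _).
rewrite (Rfubini_lebesgue P mG idom)// -(Rintegral_expR_cos et0).
rewrite -[RHS]Rintegral_indic_mul; apply: eq_Rintegral => x _; rewrite /G /=.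
have [x0|x0] := leP 0 x; last first.
  rewrite indicE memNset ?mul0r; last by rewrite /D /= in_itv/= leNgt x0.
  by under eq_Rintegral do rewrite mul0r; rewrite expect_cst.
under eq_Rintegral do rewrite mulrA.
rewrite expectZ; last first.
  split; last by exists 1 => w; exact: cos_max.
  apply: (measurableT_comp (continuous_measurable_fun (@continuous_cos R))).
  by apply: measurableT_comp => //; exact: measurable_funB.
rewrite expect_cos_shift// -!mulrA; congr (_ * _); rewrite mulrA -expRD; congr (expR _ * _).
by ring.
Qed.

Lemma expect_cauchy_cdf (e a b : R) : 0 < e -> a < b ->
  \int[P]_w (cauchy_cdf e (b - Y w) - cauchy_cdf e (a - Y w)) =
  cauchy_cdf (e + t) b - cauchy_cdf (e + t) a.
Proof.
move=> e0 ab; have et0 : 0 < e + t by exact: addr_gt0.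
pose D := `[a, b]%classic.
pose G := fun v : T * R => \1_D v.2 * cauchy_pdf e (v.2 - Y v.1).
have mG : measurable_fun setT G.
  have mI : measurable_fun [set: R] (\1_D : R -> R).
    by apply: measurable_indic; exact: measurable_itv.
  apply: measurable_funM; first exact: (measurableT_comp mI measurable_snd).
  apply: (measurableT_comp (measurable_cauchy_pdf e0)).
  by apply: measurable_funB => //; exact: measurableT_comp.
have domG w x : `|G (w, x)| <= \1_D x * (pi * e)^-1.
  rewrite /G /= normrM ger0_norm// ler_wpM2l// ger0_norm ?cauchy_pdf_ge0//.
  exact: cauchy_pdf_le.
have idom : mu.-integrable setT (EFin \o (fun x => \1_D x * (pi * e)^-1)).
  apply: integrable_indic_mul; first exact: measurable_itv.
  apply/integrableP; split; first exact/measurable_EFinP.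
  rewrite integral_cst/=; last exact: measurable_itv.
  rewrite lebesgue_measure_itv/= lte_fin ab -EFinB -EFinM.
  exact: ltry.
transitivity (\int[P]_w \int[mu]_x G (w, x)).
  apply: eq_Rintegral => w _; rewrite /G /= Rintegral_indic_mul /Rintegral.
  by rewrite integral_cauchy_pdf.
rewrite (Rfubini_lebesgue P mG idom)//.
transitivity (\int[mu]_(x in D) cauchy_pdf (e + t) x).
  rewrite -[RHS]Rintegral_indic_mul; apply: eq_Rintegral => x _; rewrite /G /=.
  rewrite expectZ; last first.
    split.
      apply: (measurableT_comp (measurable_cauchy_pdf e0)).
      exact: measurable_funB.
    exists (pi * e)^-1 => w; rewrite ger0_norm ?cauchy_pdf_ge0//.
    exact: cauchy_pdf_le.
  congr (_ * _); rewrite -expect_cauchy_pdf//.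
  by apply: eq_Rintegral => w _; rewrite -cauchy_pdfN opprB.
transitivity (\int[mu]_(x in D) cauchy_pdf (e + t) (x - 0)).
  by apply: eq_Rintegral => x _; rewrite subr0.
by rewrite /Rintegral integral_cauchy_pdf// !subr0.
Qed.

Let atan_limit (u : R) :
  cauchy_cdf (n.+1%:R ^- 2) (u + n.+1%:R^-1) @[n --> \oo]
  --> (if 0 <= u then 2^-1 else - 2^-1 : R).
Proof.
have half : pi^-1 * (pi / 2) = 2^-1 :> R.
  by rewrite mulrA mulVf ?mul1r// gt_eqF// pi_gt0.
have nS_cvg : n.+1%:R @[n --> \oo] --> (+oo : set_system R).
  by have := @cvgr_idn R; rewrite -cvg_shiftS.
have arg n : (u + n.+1%:R^-1) / n.+1%:R ^- 2 = n.+1%:R * (u * n.+1%:R + 1) :> R.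
  have : n.+1%:R != 0 :> R by rewrite pnatr_eq0.
  by move: (n.+1%:R : R) => N N0; field.
rewrite /cauchy_cdf; under eq_fun do rewrite arg.
have [u0|u0] := leP 0 u.
  rewrite -half; apply: cvgMl_tmp.
  apply: (cvg_comp _ _ _ (@cvgy_atan R)).
  apply: ger_cvgy nS_cvg; apply: nearW => n.
  by rewrite ler_peMr// lerDr mulr_ge0.
rewrite -half -mulrN; apply: cvgMl_tmp.
rewrite (_ : (fun n : nat => _) =
    (fun n => - atan (n.+1%:R * (- u * n.+1%:R - 1)))); last first.
  by apply/funext => n; rewrite -atanN; congr atan; ring.
apply: cvgN; apply: (cvg_comp _ _ _ (@cvgy_atan R)).
apply: ger_cvgy (nS_cvg).
have /cvgryPge /(_ (2 / (- u))) := nS_cvg.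
apply: filterS => n; rewrite ler_pdivrMr ?oppr_gt0// => h.
by rewrite ler_peMr// lerBrDr mulrC (_ : 1 + 1 = 2).
Qed.

Let cauchy_cdf_cvg (c : R) :
  cauchy_cdf (n.+1%:R ^- 2 + t) (c + n.+1%:R^-1) @[n --> \oo] --> cauchy_cdf t c.
Proof.
have inv0 : n.+1%:R^-1 @[n --> \oo] --> (0 : R) by exact: cvg_harmonic.
rewrite /cauchy_cdf; apply: cvgMl_tmp.
have num : c + n.+1%:R^-1 @[n --> \oo] --> c.
  by rewrite -[X in _ --> X]addr0; apply: cvgD => //; exact: cvg_cst.
have inv20 : n.+1%:R^-1 * n.+1%:R^-1 + t @[n --> \oo] --> t.
  rewrite -[X in _ --> X]add0r -[X in _ --> X + _](mulr0 0).
  by apply: cvgD; [exact: cvgM|exact: cvg_cst].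
have den : n.+1%:R ^- 2 + t @[n --> \oo] --> t.
  apply: cvg_trans inv20.
  by under [X in X @ _ `=>` _]eq_fun do rewrite -exprVn expr2.
have quot : (c + n.+1%:R^-1) / (n.+1%:R ^- 2 + t) @[n --> \oo] --> c / t.
  by apply: cvgM => //; apply: cvgV => //; rewrite gt_eqF.
exact: (cvg_comp _ _ quot (@continuous_atan R (c / t))).
Qed.

Let measurable_cauchy_cdf (s c : R) : 0 < s ->
  measurable_fun setT (fun w => cauchy_cdf s (c - Y w)).
Proof.
move=> s0; apply: (measurableT_comp (f := cauchy_cdf s)).
  apply: continuous_measurable_fun => x; apply: cvgMl_tmp.
  have k : x0 / s @[x0 --> x] --> x / s by exact: mulrr_continuous.
  exact: (cvg_comp _ _ k (@continuous_atan R (x / s))).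
exact: measurable_funB.
Qed.

Let indic_itvE (a b u : R) : a < b ->
  (if 0 <= b - u then 2^-1 else - 2^-1) - (if 0 <= a - u then 2^-1 else - 2^-1)
  = \1_(`]a, b]%classic) u :> R.
Proof.
move=> ab; rewrite !subr_ge0 indicE.
have -> : (u \in `]a, b]%classic) = (a < u <= b).
  by apply/idP/idP; rewrite inE /= in_itv.
rewrite ltNge; case: (leP u a) => [ua|au] /=.
  by rewrite (le_trans ua (ltW ab)) subrr.
by case: leP => _ /=; lra.
Qed.

(** The two sides of expect_cauchy_cdf converge as the scale e tends to 0.
    The left one would tend to half the mass of the end points, which are
    not yet known to be null. Shifting both of them to the right by 1/(n+1),
    an amount large against the scale 1/(n+1)^2, yields the indicator of the
    half-open interval at every point instead. *)
Lemma cauchy_law_itv (a b : R) : a < b ->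
  P (Y @^-1` `]a, b]) = (cauchy_cdf t b - cauchy_cdf t a)%:E.
Proof.
move=> ab.
have mA : measurable (Y @^-1` `]a, b]).
  by rewrite -[X in measurable X]setTI; apply: mY => //; exact: measurable_itv.
suff : \int[P]_w \1_(Y @^-1` `]a, b]) w = cauchy_cdf t b - cauchy_cdf t a.
  rewrite /Rintegral integral_indic// setIT => <-.
  by rewrite fineK// fin_num_measure.
pose e n : R := n.+1%:R ^- 2.
have e0 n : 0 < e n by rewrite invr_gt0 exprn_gt0.
have cdf_le s x : `|cauchy_cdf s x| <= 1.
  rewrite normrM gtr0_norm ?invr_gt0 ?pi_gt0// ler_pdivrMl ?pi_gt0// mulr1.
  have := pi_gt0 R; have := atan_ltpi2 (x / s); have := atan_gtNpi2 (x / s).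
  by rewrite ler_norml; move: (atan _) (pi : R) => A p; lra.
(* The same sequence has two limits, on the side of Y and on that of the
   Cauchy law. *)
have lim1 : \int[P]_w (cauchy_cdf (e n) (b + n.+1%:R^-1 - Y w) -
      cauchy_cdf (e n) (a + n.+1%:R^-1 - Y w)) @[n --> \oo] -->
    \int[P]_w \1_(Y @^-1` `]a, b]) w.
  apply: (@expect_cvg _ _ _ _ _ _ 2).
  - by move=> n; apply: measurable_funB; exact: measurable_cauchy_cdf.
  - move=> n w; rewrite (le_trans (ler_normB _ _))//.
    by rewrite (_ : 2 = 1 + 1)// lerD//; exact: cdf_le.
  - move=> w; rewrite [X in _ --> X](_ : _ = \1_(`]a, b]%classic) (Y w))//.
    rewrite -(indic_itvE _ ab); apply: cvgB.
    + by under eq_fun do rewrite addrAC; exact: atan_limit.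
    + by under eq_fun do rewrite addrAC; exact: atan_limit.
have lim2 : cauchy_cdf (e n + t) (b + n.+1%:R^-1) -
    cauchy_cdf (e n + t) (a + n.+1%:R^-1) @[n --> \oo] -->
    cauchy_cdf t b - cauchy_cdf t a.
  by apply: cvgB; exact: cauchy_cdf_cvg.
have lim3 : \int[P]_w (cauchy_cdf (e n) (b + n.+1%:R^-1 - Y w) -
      cauchy_cdf (e n) (a + n.+1%:R^-1 - Y w)) @[n --> \oo] -->
    cauchy_cdf t b - cauchy_cdf t a.
  apply: cvg_trans lim2; apply: near_eq_cvg; apply: nearW => n.
  by rewrite expect_cauchy_cdf// ltrD2r.
exact: (norm_cvg_unique lim1 lim3).
Qed.

End cauchy_law.

(** * Expectations under a Cauchy law *)

(** Half-open intervals form a semiring generating the Borel sets, so this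
    fixes the law. *)
Definition cauchy_distributed d (T : measurableType d) (R : realType)
    (P : probability T R) (Y : T -> R) (t : R) : Prop :=
  measurable_fun setT Y /\
  forall a b : R, a < b ->
    P (Y @^-1` `]a, b]) = (cauchy_cdf t b - cauchy_cdf t a)%:E.

Section cauchy_shift.
Context (R : realType).
Notation mu := (@lebesgue_measure R).
Variables (s x : R).
Hypothesis s0 : 0 < s.

(** The law of x + Y for Y Cauchy of scale s. *)
Definition cauchy_shift (A : set R) : \bar R :=
  (\int[mu]_(y in A) (cauchy_pdf s (y - x))%:E)%E.

Lemma measurable_cauchy_pdfB : measurable_fun [set: R] (fun y => cauchy_pdf s (y - x)).
Proof. by apply: continuous_measurable_fun; exact: continuous_cauchy_pdfB. Qed.

Let cauchy_shift0 : cauchy_shift set0 = 0%E.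
Proof. by rewrite /cauchy_shift integral_set0. Qed.

Let cauchy_shift_ge0 A : (0 <= cauchy_shift A)%E.
Proof. by apply: integral_ge0 => y _; rewrite lee_fin cauchy_pdf_ge0. Qed.

Let cauchy_shift_sigma_additive : semi_sigma_additive cauchy_shift.
Proof.
move=> /= F mF tF mUF; rewrite /cauchy_shift; apply: cvg_toP.
  apply: ereal_nondecreasing_is_cvgn => m n mn.
  apply: lee_sum_nneg_natr => // k _ _; apply: integral_ge0 => /= y Fky.
  by rewrite lee_fin cauchy_pdf_ge0.
rewrite ge0_integral_bigcup//=.
- by apply/measurable_funTS/measurable_EFinP; exact: measurable_cauchy_pdfB.
- by move=> y _; rewrite lee_fin cauchy_pdf_ge0.
Qed.

HB.instance Definition _ := isMeasure.Build _ _ _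
  cauchy_shift cauchy_shift0 cauchy_shift_ge0 cauchy_shift_sigma_additive.

Lemma cauchy_shift_itv (a b : R) : a < b ->
  cauchy_shift `]a, b] = (cauchy_cdf s (b - x) - cauchy_cdf s (a - x))%:E.
Proof.
move=> ab; rewrite /cauchy_shift -integral_cauchy_pdf//.
rewrite integral_itv_obnd_cbnd//.
by apply/measurable_funTS/measurable_EFinP; exact: measurable_cauchy_pdfB.
Qed.

Lemma cauchy_shift_unique (m : {measure set R -> \bar R}) :
  (forall a b : R, a < b ->
    m `]a, b]%classic = (cauchy_cdf s (b - x) - cauchy_cdf s (a - x))%:E) ->
  forall A, measurable A -> m A = cauchy_shift A.
Proof.
move=> mE; pose g k : set R := `]- (k.+1%:R), k.+1%:R]%classic.
apply: (measure_unique (@ocitv R) g).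
- by [].
- exact: ocitvI.
- by move=> k; exact: is_ocitv.
- apply/seteqP; split => // y _; have [n yn] : exists n, `|y| < n.+1%:R.
    exists (Num.bound `|y|); rewrite (lt_trans (archi_boundP (normr_ge0 y)))//.
    by rewrite ltr_nat.
  exists n => //; rewrite /g /= in_itv/=; move: yn; rewrite ltr_norml => /andP[-> /ltW].
  by [].
- move=> _ [[a b] /= _ <-].
  have [ab|ba] := ltP a b; first by rewrite mE// cauchy_shift_itv.
  by rewrite set_itv_ge ?measure0// -leNgt bnd_simp.
- by move=> k; rewrite mE ?ltry// gtrN// ltr0n.
Qed.

End cauchy_shift.

Section real_integrable.
Context d (T : measurableType d) (R : realType) (mu : {measure set T -> \bar R}).
Implicit Types g h : T -> R.

Lemma integrable_normr h : mu.-integrable setT (EFin \o h) ->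
  mu.-integrable setT (EFin \o (fun x => `|h x|)).
Proof. by move=> ih; have := integrable_abse ih; apply: eq_integrable. Qed.

Lemma integrable_mulr (c : R) h : mu.-integrable setT (EFin \o h) ->
  mu.-integrable setT (EFin \o (fun x => c * h x)).
Proof. by move=> ih; have := integrableZl measurableT c ih; apply: eq_integrable. Qed.

Lemma integrable_addr g h : mu.-integrable setT (EFin \o g) ->
  mu.-integrable setT (EFin \o h) ->
  mu.-integrable setT (EFin \o (fun x => g x + h x)).
Proof.
by move=> ig ih; have := integrableD measurableT ig ih; apply: eq_integrable.
Qed.

End real_integrable.

Section bounded_density.
Context d (T : measurableType d) (R : realType) (P : probability T R).
Notation mu := (@lebesgue_measure R).
Variables (Y : T -> R) (p : R -> R).
Hypothesis mY : measurable_fun setT Y.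
Hypothesis mp : measurable_fun setT p.
Hypothesis p0 : forall x, 0 <= p x.
Hypothesis Yp : forall A, measurable A ->
  P (Y @^-1` A) = (\int[mu]_(x in A) (p x)%:E)%E.

Lemma integrable_density : mu.-integrable setT (EFin \o p).
Proof.
apply/integrableP; split; first exact/measurable_EFinP.
under eq_integral do rewrite /= ger0_norm//.
by rewrite -Yp// preimage_setT probability_setT ltry.
Qed.

Lemma integrable_mul_density (h : R -> R) : bdd_measurable h ->
  mu.-integrable setT (EFin \o (fun x => h x * p x)).
Proof.
move=> bh; have [M M0 hM] := bdd_measurable_bound bh; have [mh _] := bh.
have iMp : mu.-integrable setT (EFin \o (fun x => M * p x)).
  have := integrableZl measurableT M integrable_density.
  by apply: eq_integrable.
apply: le_integrable iMp => //.
- by apply/measurable_EFinP; exact: measurable_funM.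
- move=> x _ /=; rewrite lee_fin normrM [leRHS]normrM ler_pM//.
  by rewrite (le_trans (hM x))// ler_norm.
Qed.

(** The formula for nonnegative functions is applied to h shifted by a bound
    of |h|. *)
Lemma expect_density (h : R -> R) : bdd_measurable h ->
  \int[P]_w h (Y w) = \int[mu]_x (h x * p x).
Proof.
move=> bh; have [M M0 hM] := bdd_measurable_bound bh; have [mh _] := bh.
have hM0 x : 0 <= h x + M.
  by have := hM x; rewrite ler_norml => /andP[+ _]; rewrite -subr_ge0 opprK addrC.
have bhM : bdd_measurable (fun x => h x + M).
  by apply: bdd_measurableD => //; exact: bdd_measurable_cst.
have bhY : bdd_measurable (fun w => h (Y w)) by exact: bdd_measurable_comp bh mY.
have pT : \int[mu]_x p x = 1.
  by rewrite /Rintegral -Yp// preimage_setT probability_setT.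
have /(congr1 fine) := ge0_integral_density mY mp p0 Yp
  (proj1 bhM) hM0.
rewrite -!/(Rintegral _ _ _) expectD//; last exact: bdd_measurable_cst.
rewrite expect_cst.
under [RHS]eq_Rintegral do rewrite mulrDl.
rewrite RintegralD//; last 2 first.
- exact: integrable_mul_density.
- by apply: integrable_mul_density; exact: bdd_measurable_cst.
rewrite RintegralZl//; last exact: integrable_density.
by rewrite pT mulr1 => /addIr.
Qed.

End bounded_density.

Section cauchy_expect.
Context d (T : measurableType d) (R : realType) (P : probability T R).
Notation mu := (@lebesgue_measure R).
Variables (Y : T -> R) (t : R).
Hypothesis t0 : 0 < t.
Hypothesis Yt : cauchy_distributed P Y t.

Let mYx x : measurable_fun setT (fun w => x + Y w).
Proof. by apply: measurable_funD => //; case: Yt. Qed.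

Lemma cauchy_distributed_shift (x : R) (A : set R) : measurable A ->
  P ((fun w => x + Y w) @^-1` A) = cauchy_shift t x A.
Proof.
move=> mA; pose Z : {RV P >-> R} := mfun_Sub (mem_set (mYx x)).
apply: (@cauchy_shift_unique R t x t0 (distribution P Z)) => // a b ab.
rewrite /distribution /pushforward /=.
have [_ <-] := Yt; last by rewrite ltrD2r.
by congr (P _); apply/seteqP; split => w /=; rewrite !in_itv/= ltrBlDl lerBrDl.
Qed.

Let integrable_mul_cauchy (x : R) (h : R -> R) : bdd_measurable h ->
  mu.-integrable setT (EFin \o (fun y => h y * cauchy_pdf t (y - x))).
Proof.
move=> bh; apply: (integrable_mul_density (P := P) (Y := fun w => x + Y w)) => //.
- exact: measurable_cauchy_pdfB.
- by move=> y; exact: cauchy_pdf_ge0.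
- by move=> A mA; rewrite cauchy_distributed_shift.
Qed.

Lemma expect_cauchy (x : R) (h : R -> R) : bdd_measurable h ->
  \int[P]_w h (x + Y w) = \int[mu]_y (h y * cauchy_pdf t (y - x)).
Proof.
move=> bh; apply: (expect_density (mYx x)) => //.
- exact: measurable_cauchy_pdfB.
- by move=> y; exact: cauchy_pdf_ge0.
- by move=> A mA; rewrite cauchy_distributed_shift.
Qed.

(** The density is at most 1/(pi t). *)
Lemma integrable_cauchy (x : R) (h : R -> R) :
  mu.-integrable setT (EFin \o h) ->
  P.-integrable setT (EFin \o (fun w => h (x + Y w))) /\
  \int[P]_w `|h (x + Y w)| <= (pi * t)^-1 * \int[mu]_y `|h y|.
Proof.
move=> ih; have inh := integrable_normr ih.
have mh : measurable_fun [set: R] h by apply/measurable_EFinP; have := measurable_int mu ih.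
have mnh : measurable_fun [set: R] (fun y => `|h y|) by exact: measurableT_comp.
have e := ge0_integral_density (mYx x) (measurable_cauchy_pdfB x t0)
  (fun y => cauchy_pdf_ge0 (y - x) t0) (cauchy_distributed_shift x) mnh
  (fun y => normr_ge0 (h y)).
have le : (\int[P]_w (`|h (x + Y w)|)%:E <=
    ((pi * t)^-1 * \int[mu]_y `|h y|)%:E)%E.
  rewrite e -RintegralZl// /Rintegral fineK; last first.
    by apply: (integrable_fin_num measurableT); exact: integrable_mulr.
  apply: ge0_le_integral => //.
  - by move=> y _; rewrite lee_fin mulr_ge0// cauchy_pdf_ge0.
  - apply/measurable_EFinP.
    exact: (measurable_funM mnh (measurable_cauchy_pdfB x t0)).
  - by apply/measurable_EFinP/measurable_funM.
  - by move=> y _; rewrite lee_fin mulrC ler_wpM2r// cauchy_pdf_le.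
have iP : P.-integrable setT (EFin \o (fun w => h (x + Y w))).
  apply/integrableP; split; first by apply/measurable_EFinP/measurableT_comp.
  by apply: (le_lt_trans le); rewrite ltry.
split => //; rewrite -lee_fin (le_trans _ le)// /Rintegral fineK//.
by apply: (integrable_fin_num measurableT); exact: integrable_normr iP.
Qed.

(** By le_cauchy_pdf the density of x + Y at y is 1/(pi t) up to (|x| +
    |y|)/(2 pi t^2); integrate this against |h|. The starting point x and
    the first moment of h enter linearly, which is where the integrability
    of x f(x) is used. *)
Lemma expect_cauchy_approx (x : R) (h : R -> R) : bdd_measurable h ->
  mu.-integrable setT (EFin \o h) ->
  mu.-integrable setT (EFin \o (fun y => y * h y)) ->
  `|\int[P]_w h (x + Y w) - (pi * t)^-1 * \int[mu]_y h y| <=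
  (2 * pi * t ^+ 2)^-1 * (`|x| * \int[mu]_y `|h y| + \int[mu]_y `|y * h y|).
Proof.
move=> bh ih iyh; rewrite (expect_cauchy x bh).
have ip := integrable_mul_cauchy x bh.
have ich := integrable_mulr (pi * t)^-1 ih.
have inh := integrable_normr ih; have inyh := integrable_normr iyh.
have ixh := integrable_mulr `|x| inh.
have isum := integrable_addr ixh inyh.
rewrite -(RintegralZl (pi * t)^-1 measurableT ih) -RintegralB//.
rewrite -(RintegralZl `|x| measurableT inh) -RintegralD// -RintegralZl//.
have idiff : mu.-integrable setT
    (EFin \o (fun y => h y * cauchy_pdf t (y - x) - (pi * t)^-1 * h y)).
  by have := integrableB measurableT ip ich; apply: eq_integrable.
rewrite (le_trans (le_normr_Rintegral _ _))//.
apply: le_Rintegral => //; [exact: integrable_normr|exact: integrable_mulr|].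
move=> y _.
have -> : h y * cauchy_pdf t (y - x) - (pi * t)^-1 * h y =
   h y * (cauchy_pdf t (y - x) - (pi * t)^-1) by rewrite mulrBr [_^-1 * _]mulrC.
rewrite normrM [`|y * h y|]normrM mulrC.
set A := `|h y|; set K := (2 * pi * _)^-1.
rewrite (_ : K * _ = (`|x| + `|y|) * K * A); last by ring.
rewrite ler_wpM2r ?/A// distrC ger0_norm ?subr_ge0 ?cauchy_pdf_le//.
have := le_cauchy_pdf (y - x) t0; rewrite lerBlDr -lerBlDl => /le_trans; apply.
rewrite ler_wpM2r ?invr_ge0 ?mulr_ge0 ?pi_ge0 ?exprn_ge0 ?(ltW t0)//.
by rewrite [leRHS]addrC; exact: ler_normB.
Qed.
End cauchy_expect.

(** The class in which correlations at two times can be estimated by means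
    of expect_cauchy_approx. *)
Definition moment_bounded (R : realType) (a : R -> R) : Prop :=
  [/\ bdd_measurable a,
      (@lebesgue_measure R).-integrable setT (EFin \o a) &
      (@lebesgue_measure R).-integrable setT (EFin \o (fun y => y * a y))].

Section unit_interval.
Context (R : realType).
Notation mu := (@lebesgue_measure R).

Definition unit_indic : R -> R := \1_(`[0, 1]%classic : set R).

Lemma unit_indicE (y : R) : unit_indic y = (0 <= y <= 1)%R%:R.
Proof.
rewrite /unit_indic indicE; congr ((nat_of_bool _)%:R).
by apply/idP/idP; rewrite inE /= in_itv.
Qed.

Lemma unit_indic_ge0 y : 0 <= unit_indic y.
Proof. by rewrite unit_indicE. Qed.

Lemma unit_indic_le1 y : unit_indic y <= 1.
Proof. by rewrite unit_indicE; case: (0 <= y <= 1). Qed.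

Lemma bdd_measurable_unit_indic : bdd_measurable unit_indic.
Proof. by apply: bdd_measurable_indic; exact: measurable_itv. Qed.

Lemma integrable_unit_indic : mu.-integrable setT (EFin \o unit_indic).
Proof.
have := @integrable_indic_mul R (`[0, 1]%classic : set R) (cst 1) (measurable_itv _).
rewrite (_ : (fun x => _ x * cst 1 x) = unit_indic); last first.
  by apply/funext => y; rewrite mulr1.
apply; apply/integrableP; split; first exact/measurable_EFinP.
under eq_integral do rewrite /= normr1.
rewrite integral_cst/=; last exact: measurable_itv.
by rewrite lebesgue_measure_itv/= lte_fin ltr01 -EFinB -EFinM ltry.
Qed.

Lemma Rintegral_unit_indic : \int[mu]_y unit_indic y = 1.
Proof.
rewrite /Rintegral integral_indic//= setIT lebesgue_measure_itv/= lte_fin ltr01.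
by rewrite oppr0 addr0.
Qed.

Lemma moment_bounded_unit_indic_mul (w : R -> R) : bdd_measurable w ->
  moment_bounded (fun y => unit_indic y * w y).
Proof.
move=> bw; have [M M0 wM] := bdd_measurable_bound bw.
have bg : bdd_measurable (fun y => unit_indic y * w y).
  by apply: bdd_measurableM => //; exact: bdd_measurable_unit_indic.
have ig : mu.-integrable setT (EFin \o (fun y => unit_indic y * w y)).
  apply: le_integrable (integrable_mulr M integrable_unit_indic) => //.
  - by apply/measurable_EFinP; case: bg.
  - move=> y _ /=; rewrite lee_fin normrM [leRHS]normrM mulrC ler_wpM2r//.
    by rewrite (le_trans (wM y))// ler_norm.
split => //; apply: le_integrable ig => //.
- by apply/measurable_EFinP; apply: measurable_funM => //; case: bg.
- move=> y _ /=; rewrite lee_fin normrM unit_indicE.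
  case: (boolP (0 <= y <= 1)) => [/andP[y0 y1]|_] /=; last first.
    by rewrite !mul0r normr0 mulr0.
  by rewrite ler_piMl// ger0_norm.
Qed.

End unit_interval.
Arguments unit_indic {R}.

(** * Independence of an increment from the past *)

Lemma expect_independent d d' (T : measurableType d) (S : measurableType d')
    (R : realType) (P : probability T R) (U : T -> S) (Y : T -> R)
    (F : S * R -> R) :
  measurable_fun setT U -> measurable_fun setT Y ->
  (forall A B, measurable A -> measurable B ->
    P (U @^-1` A `&` Y @^-1` B) = (P (U @^-1` A) * P (Y @^-1` B))%E) ->
  bdd_measurable F ->
  \int[P]_w F (U w, Y w) = \int[P]_w \int[P]_v F (U w, Y v).
Proof.
move=> mU mY indep bF; have [mF _] := bF.
have mZ : measurable_fun setT (fun w => (U w, Y w)) by exact: measurable_fun_pair.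
pose Z : {RV P >-> (S * R)%type} := mfun_Sub (mem_set mZ).
pose U' : {RV P >-> S} := mfun_Sub (mem_set mU).
pose Y' : {RV P >-> R} := mfun_Sub (mem_set mY).
have mFE : measurable_fun setT (EFin \o F) by exact/measurable_EFinP.
have iF (m : probability (S * R)%type R) : m.-integrable setT (EFin \o F).
  exact: bdd_measurable_integrable.
have step1 : (\int[P]_w (F (U w, Y w))%:E = \int[distribution P Z]_z (F z)%:E)%E.
  rewrite (integral_distribution (X := Z) mFE)//.
  by apply: bdd_measurable_integrable; exact: bdd_measurable_comp bF mZ.
have step2 : (\int[distribution P Z]_z (F z)%:E =
    \int[distribution P U' \x distribution P Y']_z (F z)%:E)%E.
  apply: eq_measure_integral => A mA _; symmetry.
  by apply: product_measure_unique => // B C mB mC; exact: (indep B C mB mC).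
have iP : (distribution P U' \x distribution P Y')%E.-integrable setT (EFin \o F).
  exact: (iF (distribution P U' \x distribution P Y')%E).
have step3 := integral12_prod_meas1 iP.
rewrite {1}/Rintegral step1 step2 -step3 /fubini_F.
have inner s : (\int[distribution P Y']_y (EFin \o F) (s, y) =
    (\int[P]_v F (s, Y v))%:E)%E.
  have bFs : bdd_measurable (fun v => F (s, v)).
    exact: (bdd_measurable_comp bF (pair1_measurable s)).
  rewrite (integral_distribution (X := Y') (f := fun y => (EFin \o F) (s, y))).
  - rewrite /Rintegral fineK//; apply: (integrable_fin_num measurableT).
    by apply: bdd_measurable_integrable; exact: bdd_measurable_comp bFs mY.
  - by apply/measurable_EFinP; case: bFs.
  - by apply: bdd_measurable_integrable; exact: bdd_measurable_comp bFs mY.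
under eq_integral do rewrite inner.
have bG : bdd_measurable (fun s => \int[P]_v F (s, Y v)).
  have mg : measurable_fun setT (fun z : S * T => (z.1, Y z.2)).
    by apply: measurable_fun_pair => //; exact: measurableT_comp.
  exact: (bdd_measurable_Rintegral_snd P (bdd_measurable_comp bF mg)).
rewrite (integral_distribution (X := U')
  (f := fun s => (\int[P]_v F (s, Y v))%:E))//.
- by apply/measurable_EFinP; case: bG.
- by apply: bdd_measurable_integrable; exact: bdd_measurable_comp bG mU.
Qed.

Section past.
Context d (T : measurableType d) (R : realType) (P : probability T R).
Variables (Y : nat -> T -> R).
Hypothesis mY : forall i, measurable_fun setT (Y i).
Hypothesis Yindep : forall n, mutually_independent P (fun i : 'I_n => Y i).

(** The rectangles depending on the first k variables. They are stable under
    intersection and generate the sigma-algebra past k, which is the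
    information available before the k-th variable. *)
Definition past_rectangle (k : nat) (A : nat -> set R) : set T :=
  [set w | forall i, (i < k)%N -> A i (Y i w)].

Definition past_rectangles (k : nat) : set (set T) :=
  [set E | exists2 A : nat -> set R, (forall i, measurable (A i)) &
             E = past_rectangle k A].

Definition past (k : nat) := g_sigma_algebraType (past_rectangles k).

Lemma measurable_past_rectangle k A : (forall i, measurable (A i)) ->
  measurable (past_rectangle k A).
Proof.
move=> mA.
rewrite (_ : past_rectangle k A = \bigcap_(i in `I_k) (Y i @^-1` A i)).
  apply: bigcap_measurableType.
  by move=> i _; rewrite -[X in measurable X]setTI; exact: mY.
by [].
Qed.

Lemma probability_past_rectangle k A : (forall i, measurable (A i)) ->
  P (past_rectangle k A) = (\prod_(i < k) P (Y i @^-1` A i))%E.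
Proof.
move=> mA; rewrite -(Yindep (fun i : 'I_k => mA i)); congr (P _).
apply/seteqP; split => [w h i _|w h i ik].
  exact: (h i (ltn_ord i)).
exact: (h (Ordinal ik) I).
Qed.

(** Both sides are finite measures in E that agree, by the product rule, on
    the rectangles. *)
Lemma past_independent (k : nat) (E : set T) (B : set R) :
  measurable (E : set (past k)) -> measurable B ->
  P (E `&` Y k @^-1` B) = (P E * P (Y k @^-1` B))%E.
Proof.
move=> mE mB.
have mYB : measurable (Y k @^-1` B).
  by rewrite -[X in measurable X]setTI; exact: mY.
pose r : {nonneg R} := NngNum (fine_ge0 (measure_ge0 P (Y k @^-1` B))).
have rE : (r%:num)%:E = P (Y k @^-1` B) by rewrite /= fineK// fin_num_measure.
pose m1 : {measure set T -> \bar R} := mrestr P mYB.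
pose m2 : {measure set T -> \bar R} := mscale r P.
have mrE X : m1 X = P (X `&` Y k @^-1` B) by [].
have msE X : m2 X = (P (Y k @^-1` B) * P X)%E by rewrite -rE.
have setTE : past_rectangle k (fun _ => setT) = setT.
  by apply/seteqP; split.
have key := @g_sigma_algebra_measure_unique _ R T (past_rectangles k) _
  (fun _ => setT) _ _ m1 m2 _ _ _ E mE.
have : m1 E = m2 E.
  apply: key.
  - by move=> _ [A mA ->]; exact: measurable_past_rectangle.
  - by move=> _; exists (fun _ => setT).
  - by apply/seteqP; split => // x _; exists 0%N.
  - move=> _ _ [A mA ->] [C mC ->]; exists (fun i => A i `&` C i).
      by move=> i; exact: measurableI.
    apply/seteqP; split => w.
      by move=> [h1 h2] i ik; split; [exact: h1|exact: h2].
    by move=> h; split => i ik; have [] := h i ik.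
  - move=> _ [A mA ->]; rewrite mrE msE.
    (* Adding the k-th condition to a rectangle of the past gives a
       rectangle of the past one step later. *)
    pose A' i := if i == k then B else A i.
    have mA' i : measurable (A' i) by rewrite /A'; case: ifP.
    have -> : past_rectangle k A `&` Y k @^-1` B = past_rectangle k.+1 A'.
      apply/seteqP; split => w.
        move=> [h1 h2] i; rewrite ltnS leq_eqVlt /A'; case: eqP => [->//|_ /= ik].
        exact: h1.
      move=> h; split => [i ik|].
        by have := h i (ltnW ik); rewrite /A' ltn_eqF.
      by have := h k (ltnSn k); rewrite /A' eqxx.
    rewrite !probability_past_rectangle// big_ord_recr/= /A' eqxx muleC.
    by congr (_ * _)%E; apply: eq_bigr => i _; rewrite ltn_eqF.
  - move=> _; rewrite mrE.
    by apply: (le_lt_trans (probability_le1 P _)); rewrite ?ltry// setTI.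
by rewrite mrE msE muleC.
Qed.

Lemma measurable_past_increment (k i : nat) : (i < k)%N ->
  measurable_fun setT (Y i : past k -> R).
Proof.
move=> ik _ B mB; rewrite setTI; apply: sub_sigma_algebra.
exists (fun j => if j == i then B else setT); first by move=> j; case: ifP.
apply/seteqP; split => w.
  by move=> h j jk; case: eqP => [->|].
by move=> /(_ i ik); rewrite eqxx.
Qed.

(** The variable U may be any function of the past, even the identity of T
    seen as a map into past k: this is how whole products of earlier
    positions are treated as a single variable independent of the next
    increment. *)
Lemma expect_past d' (S : measurableType d') (k : nat) (U : T -> S)
    (F : S * R -> R) :
  measurable_fun setT (U : past k -> S) -> bdd_measurable F ->
  \int[P]_w F (U w, Y k w) = \int[P]_w \int[P]_v F (U w, Y k v).
Proof.
move=> mU bF.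
have pm (A : set S) : measurable A -> measurable (U @^-1` A : set (past k)).
  by move=> mA; rewrite -[X in measurable X]setTI; exact: mU.
apply: expect_independent => //.
- move=> _ A mA; rewrite setTI.
  have := pm A mA; apply: smallest_sub; first exact: sigma_algebra_measurable.
  by move=> _ [C mC ->]; exact: measurable_past_rectangle.
- by move=> A B mA mB; rewrite past_independent//; exact: pm.
Qed.

End past.

(** * Cauchy processes and their semigroup *)

(** What the proof uses of a symmetric 1-stable process once its
    one-dimensional laws are known. It starts from 0 at every sample point
    and not only almost surely, so that positions are sums of increments
    everywhere. *)
Record cauchy_process d (T : measurableType d) (R : realType)
    (P : probability T R) (X : R -> T -> R) : Prop := {
  cauchy_process_measurable : forall t, 0 <= t -> measurable_fun setT (X t);
  cauchy_process_right_continuous : forall w t, 0 <= t ->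
    X s w @[s --> t^'+] --> X t w;
  cauchy_process_start : forall w, X 0 w = 0;
  cauchy_process_increment : forall s h, 0 <= s -> 0 < h ->
    cauchy_distributed P (fun w => X (s + h) w - X s w) h;
  cauchy_process_independent : forall (n : nat) (u : nat -> R),
    0 <= u 0%N -> (forall i, u i <= u i.+1) ->
    mutually_independent P (fun (i : 'I_n) w => X (u i.+1) w - X (u i) w)
}.

Section cauchy_semigroup.
Context d (T : measurableType d) (R : realType) (P : probability T R).
Notation mu := (@lebesgue_measure R).
Variable X : R -> T -> R.
Hypothesis cX : cauchy_process P X.

Let mX t : 0 <= t -> measurable_fun setT (X t).
Proof. by move=> t0; exact: cauchy_process_measurable cX _ t0. Qed.

Lemma cauchy_process_distributed t : 0 < t -> cauchy_distributed P (X t) t.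
Proof.
move=> t0; have := cauchy_process_increment cX (lexx 0) t0.
rewrite (_ : (fun w => X (0 + t) w - X 0 w) = X t)//.
by apply/funext => w; rewrite add0r (cauchy_process_start cX) subr0.
Qed.

(** The semigroup of the process: the expectation of h started from x. *)
Definition transition (t : R) (h : R -> R) (x : R) : R :=
  \int[P]_w h (x + X t w).

Lemma expect_increment (s t : R) (h : R -> R) (x : R) : 0 <= s -> 0 < t ->
  bdd_measurable h ->
  \int[P]_v h (x + (X (s + t) v - X s v)) = transition t h x.
Proof.
move=> s0 t0 bh; rewrite /transition.
rewrite (expect_cauchy t0 (cauchy_process_distributed t0))//.
by rewrite (expect_cauchy t0 (cauchy_process_increment cX s0 t0)).
Qed.

Lemma bdd_measurable_transition (t : R) (h : R -> R) : 0 <= t ->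
  bdd_measurable h -> bdd_measurable (transition t h).
Proof.
move=> t0 bh.
have mz : measurable_fun setT (fun z : R * T => z.1 + X t z.2).
  by apply: measurable_funD => //; apply: measurableT_comp => //; exact: mX.
exact: (bdd_measurable_Rintegral_snd P (bdd_measurable_comp bh mz)).
Qed.

Lemma bdd_measurable_shift (t x : R) (h : R -> R) : 0 <= t ->
  bdd_measurable h -> bdd_measurable (fun w => h (x + X t w)).
Proof.
move=> t0 bh; apply: (bdd_measurable_comp bh).
by apply: measurable_funD => //; exact: mX.
Qed.

Lemma expect_two_times (s t : R) (F : R * R -> R) : 0 <= s -> 0 < t ->
  bdd_measurable F ->
  \int[P]_w F (X s w, X (s + t) w) =
  \int[P]_w \int[P]_v F (X s w, X s w + (X (s + t) v - X s v)).
Proof.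
move=> s0 t0 bF.
(* The times 0, s, s + t, s + t, ...: the first two increments are the ones
   needed. *)
pose u (n : nat) : R := nth (s + t) [:: 0; s] n.
have u0 : 0 <= u 0%N by [].
have uS i : u i <= u i.+1.
  by case: i => [|[|[|i]]]//; rewrite /u /= lerDl ltW.
have u_ge0 i : 0 <= u i.
  by elim: i => // i IH; exact: le_trans IH (uS i).
pose Y (i : nat) w := X (u i.+1) w - X (u i) w.
have mY i : measurable_fun setT (Y i) by apply: measurable_funB; exact: mX.
have Yi n : mutually_independent P (fun i : 'I_n => Y i).
  exact: cauchy_process_independent cX n u u0 uS.
have Y0 w : Y 0%N w = X s w by rewrite /Y /u /= (cauchy_process_start cX) subr0.
have mXs : measurable_fun setT (X s : past Y 1 -> R).
  rewrite (_ : X s = Y 0%N); first exact: measurable_past_increment.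
  by apply/funext => w; rewrite Y0.
have mg : measurable_fun setT (fun z : R * R => (z.1, z.1 + z.2)).
  by apply: measurable_fun_pair => //; exact: measurable_funD.
have := expect_past mY Yi mXs (bdd_measurable_comp bF mg).
rewrite /Y /u /=; apply: etrans; apply: eq_Rintegral => w _.
by congr (F (_, _)); ring.
Qed.

(** The Chapman-Kolmogorov equation. *)
Lemma transitionD (s t : R) (h : R -> R) (x : R) : 0 <= s -> 0 < t ->
  bdd_measurable h ->
  transition (s + t) h x = transition s (transition t h) x.
Proof.
move=> s0 t0 bh.
have mg : measurable_fun setT (fun z : R * R => x + z.2) by exact: measurable_funD.
have := expect_two_times s0 t0 (bdd_measurable_comp bh mg).
rewrite /comp/= => e; rewrite {1}/transition e; apply: eq_Rintegral => w _.
under eq_Rintegral do rewrite addrA.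
exact: expect_increment.
Qed.

Variables (a : R -> R).
Hypothesis ba : bdd_measurable a.
Hypothesis a01 : forall x, 0 <= a x <= 1.

(** The expectation of the product of a over the first m integer times of
    the process started from x (expect_prod_path_weight for x = 0), defined
    by its Markov recursion at the first step. *)
Fixpoint path_weight (m : nat) : R -> R :=
  if m is m'.+1 then transition 1 (fun y => a y * path_weight m' y)
  else fun _ => 1.

Lemma bdd_measurable_path_weight m : bdd_measurable (path_weight m).
Proof.
elim: m => [|m IH] /=; first exact: bdd_measurable_cst.
by apply: bdd_measurable_transition => //; exact: bdd_measurableM.
Qed.

Let bw m : bdd_measurable (fun y => a y * path_weight m y).
Proof. by apply: bdd_measurableM => //; exact: bdd_measurable_path_weight. Qed.

Lemma path_weight_ge0 m x : 0 <= path_weight m x.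
Proof.
elim: m x => [|m IH] x //=; apply: Rintegral_ge0 => w _.
by rewrite mulr_ge0//; have /andP[] := a01 (x + X 1 w).
Qed.

Lemma path_weightS_le m x : path_weight m.+1 x <= path_weight m x.
Proof.
elim: m x => [|m IH] x.
  rewrite /= -[leRHS](expect_cst P); apply: le_expect.
  - exact: (bdd_measurable_shift _ _ (bw 0)).
  - exact: bdd_measurable_cst.
  - by move=> w; rewrite mulr1; have /andP[] := a01 (x + X 1 w).
apply: le_expect => [||w].
- exact: (bdd_measurable_shift _ _ (bw m.+1)).
- exact: (bdd_measurable_shift _ _ (bw m)).
- by apply: ler_wpM2l; [have /andP[] := a01 (x + X 1 w)|exact: IH].
Qed.

Lemma path_weight_le1 m x : path_weight m x <= 1.
Proof.
by elim: m x => [|m IH] x //; exact: le_trans (path_weightS_le _ _) (IH x).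
Qed.

(** By the Markov property the product can be integrated out one factor at a
    time from the last one: the last N - k factors contribute path_weight (N
    - k) at the position at time k. *)
Lemma expect_prod_path_weight N :
  \int[P]_w (\prod_(i < N) a (X i.+1%:R w)) = path_weight N 0.
Proof.
pose u (n : nat) : R := n%:R.
pose Y (i : nat) w := X (u i.+1) w - X (u i) w.
have mY i : measurable_fun setT (Y i).
  by apply: measurable_funB; apply: mX; exact: ler0n.
have Yi n : mutually_independent P (fun i : 'I_n => Y i).
  by apply: (cauchy_process_independent cX) => // i; rewrite ler_nat.
have mXp k i : (i <= k)%N -> measurable_fun setT (X i%:R : past Y k -> R).
  elim: i => [_|i IH ik].
    by rewrite (_ : X 0%:R = cst 0)//; apply/funext => w; exact: cauchy_process_start cX w.
  rewrite (_ : X _ = (fun w => X i%:R w + Y i w)); last first.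
    by apply/funext => w; rewrite /Y /u addrC subrK.
  apply: measurable_funD; first exact: IH (ltnW ik).
  exact: measurable_past_increment.
suff step k : (k <= N)%N -> \int[P]_w (\prod_(i < k) a (X i.+1%:R w) *
    path_weight (N - k) (X k%:R w)) = path_weight N 0.
  rewrite -(step N)// subnn; apply: eq_Rintegral => w _ /=; by rewrite mulr1.
elim: k => [_|k IH kN].
  under eq_Rintegral do rewrite big_ord0 mul1r (cauchy_process_start cX).
  by rewrite expect_cst subn0.
rewrite -(IH (ltnW kN)) -(subnSK kN).
set m := (N - k.+1)%N => /=.
pose M (w : past Y k) := \prod_(i < k) a (X i.+1%:R w).
pose g y := a y * path_weight m y.
pose F (z : past Y k * R) := M z.1 * g (X k%:R z.1 + z.2).
have bF : bdd_measurable F.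
  apply: bdd_measurableM.
    apply: (bdd_measurable_comp _ measurable_fst).
    apply: bdd_measurable_prod => i.
    by apply: (bdd_measurable_comp ba); apply: mXp; exact: ltn_ord.
  apply: (bdd_measurable_comp (bw m)).
  apply: measurable_funD => //.
  by apply: (measurableT_comp _ measurable_fst); exact: mXp.
have := expect_past mY Yi (@measurable_id _ (past Y k) setT) bF.
rewrite /F /M /g /Y /u /=.
under eq_Rintegral do rewrite addrC subrK.
under eq_Rintegral do rewrite mulrA -(big_ord_recr _ (fun i => a (X i.+1%:R _))).
move=> ->; apply: eq_Rintegral => w _.
have b1 : bdd_measurable (fun v => g (X k%:R w + (X k.+1%:R v - X k%:R v))).
  by apply: (bdd_measurable_comp (bw m)); apply: measurable_funD => //; exact: mY.
rewrite expectZ//; congr (_ * _).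
by rewrite -natr1; exact: expect_increment.
Qed.

End cauchy_semigroup.

(** * Harmonic sums and a perturbed renewal equation *)

Section renewal.
Context (R : realType).

Definition harmonic_sum (N : nat) : R := \sum_(j < N) j.+1%:R^-1.

Lemma harmonic_sum_ge0 N : 0 <= harmonic_sum N.
Proof. by apply: sumr_ge0 => j _; rewrite invr_ge0. Qed.

Lemma harmonic_sumS N : harmonic_sum N.+1 = harmonic_sum N + N.+1%:R^-1.
Proof. by rewrite /harmonic_sum big_ord_recr. Qed.

Lemma le_harmonic_sum M N : (M <= N)%N -> harmonic_sum M <= harmonic_sum N.
Proof.
by apply: (@homo_leq _ _ <=%R) => //; [exact: le_trans|
  move=> n; rewrite harmonic_sumS lerDl invr_ge0].
Qed.

(** The terms of index above M are fewer than M + 2 and at most 1/(M + 1)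
    each. *)
Lemma harmonic_sum_half M N : (M <= N)%N -> (N <= M.*2.+1)%N ->
  harmonic_sum N <= harmonic_sum M + 1.
Proof.
move=> MN N2.
have key k : harmonic_sum (M + k)%N <= harmonic_sum M + k%:R / M.+1%:R.
  elim: k => [|k IH]; first by rewrite addn0 mul0r addr0.
  rewrite addnS harmonic_sumS (_ : k.+1%:R = k%:R + 1 :> R); last by rewrite natr1.
  rewrite mulrDl mul1r addrA lerD//.
  by rewrite lef_pV2 ?posrE// ler_nat ltnS leq_addr.
have := key (N - M)%N; rewrite subnKC// => /le_trans; apply.
rewrite lerD2l ler_pdivrMr// mul1r ler_nat leq_subLR.
by rewrite -addnn -addnS in N2.
Qed.

(** Telescoping: 1/(j+1)^2 <= 1/j - 1/(j+1). *)
Lemma sum_inv_sqr_le N : \sum_(j < N) (j.+1%:R ^- 2 : R) <= 2.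
Proof.
suff h n : \sum_(j < n.+1) (j.+1%:R ^- 2 : R) <= 2 - n.+1%:R^-1.
  case: N => [|n]; first by rewrite big_ord0.
  by rewrite (le_trans (h n))// gerBl invr_ge0.
elim: n => [|n IH]; first by rewrite big_ord_recr big_ord0 /= add0r expr1n invr1; lra.
rewrite big_ord_recr /= (le_trans (lerD IH (lexx _)))//.
rewrite -addrA lerD2l -lerBrDl opprK.
have n0 : 0 < n.+1%:R :> R by rewrite ltr0n.
have -> : n.+2%:R = n.+1%:R + 1 :> R by rewrite natr1.
move: (n.+1%:R : R) n0 => x x0; have x10 : 0 < x + 1 by rewrite addr_gt0.
rewrite -subr_ge0 (_ : _ - _ = (x * (x + 1) ^+ 2)^-1).
  by rewrite invr_ge0 mulr_ge0 ?exprn_ge0// ltW.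
by field; rewrite !gt_eqF.
Qed.

Variables (phi : nat -> R) (b C : R).
Hypothesis b0 : 0 <= b.
Hypothesis phi_ge0 : forall m, 0 <= phi m.
Hypothesis phi_le1 : forall m, phi m <= 1.
Hypothesis phi_ni : forall m n, (m <= n)%N -> phi n <= phi m.
Hypothesis phiE : forall N,
  `|phi N - (1 - b * \sum_(j < N) phi (N - j.+1)%N / j.+1%:R)| <= C.

(** Since phi is nonincreasing, every term of the convolution is at least
    phi N, so that phi N (1 + b H_N) <= 1 + C. *)
Lemma renewal_upper N : phi N <= (1 + C) / (1 + b * harmonic_sum N).
Proof.
rewrite ler_pdivlMr; last by rewrite ltr_pwDl// mulr_ge0// harmonic_sum_ge0.
rewrite mulrDr mulr1 mulrCA.
have le : phi N * harmonic_sum N <= \sum_(j < N) phi (N - j.+1)%N / j.+1%:R.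
  rewrite /harmonic_sum mulr_sumr; apply: ler_sum => j _.
  by rewrite ler_wpM2r ?invr_ge0// phi_ni// leq_subr.
have := phiE N; rewrite ler_norml => /andP[_].
have := ler_wpM2l b0 le.
by move: (b * _) (b * _) => u v; lra.
Qed.

Let renewal_sum_le K N : (K <= N)%N ->
  \sum_(j < N) phi (N - j.+1)%N / j.+1%:R <=
  phi (N - K)%N * harmonic_sum K + (harmonic_sum N - harmonic_sum K).
Proof.
move=> KN; pose S n : R := \sum_(j < n) phi (N - j.+1)%N / j.+1%:R.
have SK : S K <= phi (N - K)%N * harmonic_sum K.
  rewrite /harmonic_sum mulr_sumr; apply: ler_sum => j _.
  by rewrite ler_wpM2r ?invr_ge0// phi_ni// leq_sub2l.
have Sd n : S (K + n)%N <= S K + (harmonic_sum (K + n)%N - harmonic_sum K).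
  elim: n => [|n IH]; first by rewrite addn0 subrr addr0.
  rewrite addnS harmonic_sumS /S big_ord_recr /= -/(S _).
  rewrite (addrAC (harmonic_sum _)) addrA lerD// ler_piMl ?invr_ge0//.
by have := Sd (N - K)%N; rewrite subnKC// => /le_trans; apply; rewrite lerD2r.
Qed.

(** Cut the convolution at half of N. In its first half phi is at most its
    value at N/2, which renewal_upper bounds by nearly the same amount as
    phi N since H_(N/2) >= H_N - 1; in its second half phi <= 1, and the
    harmonic weights add up to at most 1. As b tends to 0 with b H_N and C
    under control, the lower bound and the upper one merge. *)
Lemma renewal_lower N : b < 1 ->
  1 - C - b - b * harmonic_sum N * ((1 + C) / (1 + b * (harmonic_sum N - 1)))
  <= phi N.
Proof.
(* With K = N - M the cut leaves phi at M = N/2, and both M and N - M are at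
   least (N - 1)/2. *)
move=> b1; pose M := N./2.
have MN : (M <= N)%N by rewrite /M; lia.
have C0 : 0 <= C by rewrite (le_trans (normr_ge0 _) (phiE 0)).
have H0 := harmonic_sum_ge0 N.
have HM : harmonic_sum N - 1 <= harmonic_sum M.
  by rewrite lerBlDr harmonic_sum_half//; rewrite /M; lia.
have HK : harmonic_sum N - harmonic_sum (N - M)%N <= 1.
  by rewrite lerBlDl harmonic_sum_half//; rewrite /M; lia.
have Slt := renewal_sum_le (leq_subr M N); rewrite subKn// in Slt.
have phiM : phi M <= (1 + C) / (1 + b * (harmonic_sum N - 1)).
  rewrite (le_trans (renewal_upper M))// ler_wpM2l ?addr_ge0//.
  have d0 : 0 < 1 + b * (harmonic_sum N - 1).
    by rewrite mulrBr mulr1 addrCA ltr_wpDl ?mulr_ge0// subr_gt0.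
  rewrite lef_pV2 ?posrE//; last first.
    by rewrite ltr_pwDl// mulr_ge0// harmonic_sum_ge0.
  by rewrite lerD2l ler_wpM2l.
have HNM : harmonic_sum (N - M)%N <= harmonic_sum N.
  by rewrite le_harmonic_sum// leq_subr.
have le1 : \sum_(j < N) phi (N - j.+1)%N / j.+1%:R <=
    ((1 + C) / (1 + b * (harmonic_sum N - 1))) * harmonic_sum N + 1.
  by rewrite (le_trans Slt)// lerD// ler_pM// harmonic_sum_ge0.
have := phiE N; rewrite ler_norml => /andP[+ _].
have := ler_wpM2l b0 le1.
set q := _ / _; set S := \sum_(j < N) _; set H := harmonic_sum N.
by rewrite -mulrA (mulrC H q) mulrDr mulr1; move: (b * _) (b * _) => u v; lra.
Qed.

End renewal.

(** * Laplace transform of the number of visits at integer times *)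

Section harmonic_log.
Context (R : realType).

Lemma ln_le_harmonic_sum N : ln (N.+1%:R) <= harmonic_sum R N.
Proof.
elim: N => [|N IH]; first by rewrite ln1 harmonic_sum_ge0.
rewrite harmonic_sumS.
have N0 : 0 < N.+1%:R :> R by rewrite ltr0n.
have -> : N.+2%:R = N.+1%:R * (1 + N.+1%:R^-1) :> R.
  by rewrite mulrDr mulr1 divff ?gt_eqF// natr1.
have i0 : 0 < N.+1%:R^-1 :> R by rewrite invr_gt0.
rewrite lnM ?posrE ?addr_gt0// lerD// le_ln1Dx//.
by rewrite (lt_trans _ i0).
Qed.

Lemma harmonic_sum_le_ln N : harmonic_sum R N.+1 <= 1 + ln (N.+1%:R).
Proof.
elim: N => [|N IH].
  by rewrite /harmonic_sum big_ord_recr big_ord0 /= add0r invr1 ln1 addr0.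
rewrite harmonic_sumS.
have N0 : 0 < N.+1%:R :> R by rewrite ltr0n.
have M0 : 0 < N.+2%:R :> R by rewrite ltr0n.
rewrite (le_trans (lerD IH (lexx _)))// -addrA lerD2l -lerBrDl -ln_div ?posrE//.
rewrite -[leLHS]opprK lerNl -lnV ?posrE ?divr_gt0// invf_div.
have -> : N.+1%:R / N.+2%:R = 1 + - N.+2%:R^-1 :> R.
  have -> : N.+2%:R = N.+1%:R + 1 :> R by rewrite natr1.
  move: (N.+1%:R : R) N0 => x x0; field.
  by rewrite gt_eqF// addr_gt0.
by rewrite le_ln1Dx// ltrN2 invf_lt1// ltr1n.
Qed.

(** The time horizon is exp(n t), for which the harmonic sum is n t up to 1. *)
Lemma harmonic_sum_truncn (y : R) : 0 <= y ->
  y <= harmonic_sum R (Num.truncn (expR y)) <= 1 + y.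
Proof.
move=> y0; have /andP[lo hi] := truncn_itv (expR_ge0 y).
have e1 : 1 <= expR y by rewrite -expR0 ler_expR.
apply/andP; split.
  apply: le_trans (ln_le_harmonic_sum _).
  by rewrite -[leLHS]expRK ler_ln ?posrE ?expR_gt0 ?ltr0n// ltW.
have : (0 < Num.truncn (expR y))%N by rewrite truncn_gt0.
case: (Num.truncn _) lo => // N lo _.
rewrite (le_trans (harmonic_sum_le_ln N))// lerD2l.
by rewrite -[leRHS]expRK ler_ln ?posrE ?expR_gt0 ?ltr0n.
Qed.

End harmonic_log.

Section occupation_laplace.
Context d (T : measurableType d) (R : realType) (P : probability T R).
Notation mu := (@lebesgue_measure R).
Variable X : R -> T -> R.
Hypothesis cX : cauchy_process P X.

Section fixed_beta.
Variable beta : R.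
Hypothesis beta01 : 0 <= beta <= 1.

Let a (y : R) : R := 1 - beta * unit_indic y.
Let w (m : nat) := path_weight P X a m.

Let ba : bdd_measurable a.
Proof.
apply: bdd_measurableB; first exact: bdd_measurable_cst.
by apply: bdd_measurableZ; exact: bdd_measurable_unit_indic.
Qed.

Let a01 y : 0 <= a y <= 1.
Proof.
have /andP[b0 b1] := beta01; rewrite /a unit_indicE; case: (0 <= y <= 1) => /=.
  by rewrite mulr1 subr_ge0 b1 lerBlDl lerDr b0.
by rewrite mulr0 subr0 ler01 lexx.
Qed.

Let bw m : bdd_measurable (w m).
Proof. exact: bdd_measurable_path_weight. Qed.

Let w_ge0 m x : 0 <= w m x.
Proof. exact: path_weight_ge0. Qed.

Let w_le1 m x : w m x <= 1.
Proof. exact: path_weight_le1. Qed.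

Let g m y := unit_indic y * w m y.

Let bg m : bdd_measurable (g m).
Proof. by apply: bdd_measurableM => //; exact: bdd_measurable_unit_indic. Qed.

Let g_ge0 m y : 0 <= g m y.
Proof. by rewrite mulr_ge0// unit_indic_ge0. Qed.

(** Here g m is the weight on [0, 1] of a visit with m steps to go. One step
    of the recursion reads w_(N+1) = T(w_N) - beta T(g_N), with T the
    transition over time 1, and it is iterated inside T(w_N) by means of
    Chapman-Kolmogorov. *)
Let path_weight_renewal N x : w N x =
  1 - beta * \sum_(j < N) transition P X j.+1%:R (g (N - j.+1)%N) x.
Proof.
elim: N x => [|N IH] x; first by rewrite big_ord0 mulr0 subr0.
have -> : w N.+1 x = transition P X 1 (w N) x - beta * transition P X 1 (g N) x.
  rewrite /w /= -/(w N) /transition -expectZ; last first.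
    exact: (bdd_measurable_shift cX _ _ (bg N)).
  rewrite -expectB; last 2 first.
  - exact: (bdd_measurable_shift cX _ _ (bw N)).
  - by apply: bdd_measurableZ; exact: (bdd_measurable_shift cX _ _ (bg N)).
  by apply: eq_Rintegral => v _; rewrite /a /g mulrBl mul1r mulrA.
have bt j m : bdd_measurable (fun v => transition P X j.+1%:R (g m) (x + X 1 v)).
  apply: (bdd_measurable_shift cX _ _ (bdd_measurable_transition cX _ (bg m))) => //.
have -> : transition P X 1 (w N) x =
    1 - beta * \sum_(j < N) transition P X j.+2%:R (g (N - j.+1)%N) x.
  rewrite {1}/transition; under eq_Rintegral do rewrite IH.
  rewrite expectB; last 2 first.
  - exact: bdd_measurable_cst.
  - by apply: bdd_measurableZ; exact: bdd_measurable_sum.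
  rewrite expect_cst expectZ; last exact: bdd_measurable_sum.
  rewrite expect_sum//; congr (_ - _ * _); apply: eq_bigr => j _.
  rewrite (_ : j.+2%:R = 1 + j.+1%:R :> R); last by rewrite -nat1r.
  by rewrite (transitionD cX).
rewrite big_ord_recl /= subn1 /= mulrDr opprD addrA addrAC; congr (_ - _ - _).
Qed.

Let phi m := \int[mu]_y g m y.

Let g_dom m y : `|g m y| <= unit_indic y.
Proof. by rewrite ger0_norm// ler_piMr// unit_indic_ge0. Qed.

Let mg m : moment_bounded (g m).
Proof. exact: moment_bounded_unit_indic_mul. Qed.

Let ig m : mu.-integrable setT (EFin \o g m).
Proof. by case: (mg m). Qed.

Let i1 : mu.-integrable setT (EFin \o (unit_indic : R -> R)).
Proof. exact: integrable_unit_indic. Qed.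

Let int1 : \int[mu]_y (unit_indic y : R) = 1.
Proof. exact: Rintegral_unit_indic. Qed.

Let phi_ge0 m : 0 <= phi m.
Proof. by apply: Rintegral_ge0. Qed.

Let phi_le1 m : phi m <= 1.
Proof.
rewrite -int1; apply: le_Rintegral => // y _.
by rewrite (le_trans (ler_norm _)).
Qed.

(** The factors 1 - beta I lie in [0, 1], so more of them make the product
    smaller. *)
Let phi_ni m n : (m <= n)%N -> phi n <= phi m.
Proof.
apply: (@homo_leq _ _ (fun x y => y <= x)) => [//|y x z xy yz|i].
  exact: le_trans yz xy.
apply: le_Rintegral => // y _.
by rewrite ler_wpM2l ?unit_indic_ge0//; exact: path_weightS_le.
Qed.

(** The constants are at most 1 because both the support of g m and the
    starting point lie in [0, 1]. *)
Let transition_approx m j x : 0 <= x <= 1 ->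
  `|transition P X j.+1%:R (g m) x - (pi * j.+1%:R)^-1 * phi m| <= j.+1%:R ^- 2.
Proof.
have [_ _ iyg] := mg m; move=> /andP[x0 x1]; have j0 : 0 < j.+1%:R :> R by [].
apply: (le_trans (expect_cauchy_approx j0 (cauchy_process_distributed cX j0) x
  (bg m) (ig m) iyg)).
have A1 : \int[mu]_y `|g m y| <= 1.
  by rewrite -int1; apply: le_Rintegral => //; exact: integrable_normr.
have A2 : \int[mu]_y `|y * g m y| <= 1.
  rewrite -int1; apply: le_Rintegral => //; first exact: integrable_normr.
  move=> y _; rewrite normrM /g unit_indicE.
  case: (boolP (0 <= y <= 1)) => [/andP[y0 y1]|_] /=.
    by rewrite mul1r !ger0_norm// mulr_ile1.
  by rewrite mul0r normr0 mulr0.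
have xA : `|x| * \int[mu]_y `|g m y| <= 1.
  by rewrite ger0_norm// mulr_ile1// Rintegral_ge0.
rewrite invfM mulrAC ler_piMl ?invr_ge0 ?exprn_ge0//.
rewrite ler_pdivrMl ?mulr_gt0 ?pi_gt0// mulr1.
rewrite (le_trans (lerD xA A2))//; have := pi_ge2 R; move: (pi : R) => p; lra.
Qed.

Let C : R := 2 * beta.

Let path_weight_approx N x : 0 <= x <= 1 ->
  `|w N x - (1 - beta / pi * \sum_(j < N) phi (N - j.+1)%N / j.+1%:R)| <= C.
Proof.
have /andP[b0 b1] := beta01.
move=> x01; rewrite path_weight_renewal opprB addrCA -addrA (addrCA 1) subrr addr0.
rewrite -mulrA mulr_sumr -mulrBr -sumrB normrM ger0_norm//.
rewrite /C [leRHS]mulrC ler_wpM2l//.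
rewrite (le_trans (ler_norm_sum _ _ _))// (le_trans _ (sum_inv_sqr_le R N))//.
apply: ler_sum => j _; rewrite distrC.
rewrite (le_trans _ (transition_approx (N - j.+1)%N j x01))//.
by rewrite invfM mulrAC mulrA.
Qed.

(** The approximation of w N is uniform over starting points in [0, 1];
    averaging it over them closes the equation in phi. *)
Let phi_approx N :
  `|phi N - (1 - beta / pi * \sum_(j < N) phi (N - j.+1)%N / j.+1%:R)| <= C.
Proof.
set r := 1 - _.
have ir : mu.-integrable setT (EFin \o (fun y => r * unit_indic y)).
  exact: integrable_mulr.
have -> : phi N - r = \int[mu]_y (g N y - r * unit_indic y).
  by rewrite RintegralB// RintegralZl// int1 mulr1.
have idiff : mu.-integrable setT (EFin \o (fun y => g N y - r * unit_indic y)).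
  by have := integrableB measurableT (ig N) ir; apply: eq_integrable.
rewrite (le_trans (le_normr_Rintegral _ _))//.
rewrite -[leRHS]mulr1 -int1 -RintegralZl//.
apply: le_Rintegral => //; [exact: integrable_normr|exact: integrable_mulr|].
move=> y _; rewrite /g unit_indicE.
case: (boolP (0 <= y <= 1)) => [y01|_] /=.
  by rewrite mul1r !mulr1 path_weight_approx.
by rewrite mul0r !mulr0 subrr normr0.
Qed.

(** Both w N 0 and phi N are within C of the same quantity, so the bound for
    phi carries over with an error 2 C. *)
Lemma path_weight_upper N :
  w N 0 <= (1 + C) / (1 + beta / pi * harmonic_sum R N) + 2 * C.
Proof.
have /andP[b0 b1] := beta01.
have bp0 : 0 <= beta / pi by rewrite divr_ge0// pi_ge0.
have := renewal_upper bp0 phi_ni phi_approx N.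
have := path_weight_approx N (x := 0); rewrite lexx ler01 => /(_ isT).
have := phi_approx N.
rewrite !ler_norml => /andP[+ _] /andP[_ +].
set u := 1 - beta / pi * \sum_(j < N) _; set v := _ / (1 + _).
move: u v => u v; lra.
Qed.

Lemma path_weight_lower N :
  1 - C - beta / pi - beta / pi * harmonic_sum R N *
    ((1 + C) / (1 + beta / pi * (harmonic_sum R N - 1))) - 2 * C <= w N 0.
Proof.
have /andP[b0 b1] := beta01.
have bp0 : 0 <= beta / pi by rewrite divr_ge0// pi_ge0.
have bp1 : beta / pi < 1.
  by rewrite ltr_pdivrMr ?pi_gt0// mul1r (le_lt_trans b1)//; have := pi_ge2 R; lra.
have := renewal_lower bp0 phi_ge0 phi_le1 phi_ni phi_approx N bp1.
have := path_weight_approx N (x := 0); rewrite lexx ler01 => /(_ isT).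
have := phi_approx N.
rewrite !ler_norml => /andP[_ +] /andP[+ _].
set u := 1 - beta / pi * \sum_(j < N) _; set v := _ * (_ / (1 + _)).
move: (beta / pi) u v => p u v; lra.
Qed.

End fixed_beta.
End occupation_laplace.

(** * Limit of the Laplace transform of the number of visits *)

Section occupation_limit.
Context d (T : measurableType d) (R : realType) (P : probability T R).
Variable X : R -> T -> R.
Hypothesis cX : cauchy_process P X.

(** The number of visits to [0, 1] at the times 1, ..., N. *)
Definition occupation (N : nat) (w : T) : R :=
  \sum_(i < N) unit_indic (X i.+1%:R w).

Lemma occupation_ge0 N w : 0 <= occupation N w.
Proof. by apply: sumr_ge0 => i _; exact: unit_indic_ge0. Qed.

Lemma bdd_measurable_occupation N : bdd_measurable (occupation N).
Proof.
apply: bdd_measurable_sum => i.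
apply: (bdd_measurable_comp (@bdd_measurable_unit_indic R)).
by apply: (cauchy_process_measurable cX).
Qed.

Variables (k : R) (t : R).
Hypothesis k0 : 0 <= k.
Hypothesis t0 : 0 < t.

Let x_ (n : nat) : R := k * n%:R^-1.
Let beta (n : nat) : R := 1 - expR (- x_ n).
Let N_ (n : nat) : nat := Num.truncn (expR (n%:R * t)).
Let H_ (n : nat) : R := harmonic_sum R (N_ n).

Let x_ge0 n : 0 <= x_ n. Proof. by rewrite mulr_ge0// invr_ge0. Qed.

Let beta01 n : 0 <= beta n <= 1.
Proof.
rewrite subr_ge0 gerBl expR_ge0 andbT -expR0 ler_expR.
by rewrite oppr_le0.
Qed.

Let invn_cvg : n%:R^-1 @[n --> \oo] --> (0 : R).
Proof.
have := @cvg_harmonic R; rewrite -(@cvg_shiftS _ (fun n => n%:R^-1 : R)).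
exact.
Qed.

Let x_cvg : x_ n @[n --> \oo] --> (0 : R).
Proof. by rewrite -(mulr0 k); exact: cvgMl_tmp. Qed.

Let beta_le n : beta n <= x_ n.
Proof. by rewrite lerBlDl -lerBlDr; exact: expR_ge1Dx. Qed.

Let beta_cvg : beta n @[n --> \oo] --> (0 : R).
Proof.
apply: (@squeeze_cvgr _ _ _ _ (fun=> 0) x_) => //; last exact: cvg_cst.
by apply: nearW => n; have /andP[-> _] := beta01 n; exact: beta_le.
Qed.

Let beta_ge n : x_ n / (1 + x_ n) <= beta n.
Proof.
have d0 : 0 < 1 + x_ n by rewrite ltr_pwDl.
rewrite /beta expRN lerBrDl -lerBrDr.
have -> : 1 - x_ n / (1 + x_ n) = (1 + x_ n)^-1 by field; rewrite gt_eqF.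
by rewrite lef_pV2 ?posrE ?expR_gt0// expR_ge1Dx.
Qed.

Let nbeta_cvg : n%:R * beta n @[n --> \oo] --> k.
Proof.
have lim : k / (1 + x_ n) @[n --> \oo] --> k.
  have h : 1 + x_ n @[n --> \oo] --> (1 : R).
    by rewrite -[X in _ --> X]addr0; apply: cvgD => //; exact: cvg_cst.
  rewrite -[X in _ --> X]divr1; apply: cvgMl_tmp.
  exact: (cvgV (oner_neq0 _) h).
apply: (@squeeze_cvgr _ _ _ _ (fun n => k / (1 + x_ n)) (fun=> k)) => //; last exact: cvg_cst.
near=> n.
have n0 : 0 < n%:R :> R by rewrite ltr0n; near: n; exact: nbhs_infty_gt.
have nx : n%:R * x_ n = k by rewrite /x_ mulrCA divff ?mulr1// gt_eqF.
(* beta n lies between x/(1 + x) and x for x = k/n. *)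
have := ler_wpM2l (ltW n0) (beta_ge n); rewrite mulrA nx => ->.
by have := ler_wpM2l (ltW n0) (beta_le n); rewrite nx.
Unshelve. all: by end_near. Qed.

Let betaH_cvg : beta n * H_ n @[n --> \oo] --> k * t.
Proof.
apply: (@squeeze_cvgr _ _ _ _ (fun n => n%:R * beta n * t)
  (fun n => beta n + n%:R * beta n * t)).
- apply: nearW => n; have /andP[b0 _] := beta01 n.
  have := harmonic_sum_truncn (mulr_ge0 (ler0n R n) (ltW t0)).
  rewrite -/(H_ n) => /andP[h1 h2]; apply/andP; split.
    by rewrite mulrAC mulrC ler_wpM2l.
  have := ler_wpM2l b0 h2; rewrite mulrDr mulr1 => /le_trans; apply.
  by rewrite lerD2l mulrCA mulrA.
- exact: cvgMr_tmp.
- rewrite -[X in _ --> X]add0r; apply: cvgD => //; exact: cvgMr_tmp.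
Qed.

Let kappa := k * t / pi.

Let path_weight_cvg :
  path_weight P X (fun y => 1 - beta n * unit_indic y) (N_ n) 0
    @[n --> \oo] --> (1 + kappa)^-1.
Proof.
have pi0 := pi_gt0 R.
have kap0 : 0 <= kappa by rewrite /kappa divr_ge0 ?mulr_ge0// ltW.
have kap1 : 1 + kappa != 0 by rewrite gt_eqF// ltr_pwDl.
pose C n := 2 * beta n.
have C_cvg : C n @[n --> \oo] --> (0:R) by rewrite -(mulr0 2); exact: cvgMl_tmp.
have CC_cvg : 2 * C n @[n --> \oo] --> (0:R).
  by rewrite -(mulr0 2); exact: cvgMl_tmp.
have b_cvg : beta n / pi @[n --> \oo] --> (0:R).
  by rewrite -(mul0r pi^-1); exact: cvgMr_tmp.
have h_cvg : beta n / pi * H_ n @[n --> \oo] --> kappa.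
  under eq_fun do rewrite mulrAC.
  exact: cvgMr_tmp.
have C1_cvg : 1 + C n @[n --> \oo] --> (1:R).
  by rewrite -[X in _ --> X]addr0; apply: cvgD => //; exact: cvg_cst.
have up_cvg : (1 + C n) / (1 + beta n / pi * H_ n) + 2 * C n @[n --> \oo] -->
    (1 + kappa)^-1.
  rewrite -[X in _ --> X]addr0 -[X in _ --> X + _]mul1r; apply: cvgD => //.
  apply: cvgM => //; apply: cvgV => //.
  by apply: cvgD => //; exact: cvg_cst.
have den_cvg : (1 + beta n / pi * (H_ n - 1))^-1 @[n --> \oo] --> (1 + kappa)^-1.
  have hm : beta n / pi * (H_ n - 1) @[n --> \oo] --> kappa.
    have : beta n / pi * H_ n - beta n / pi @[n --> \oo] --> kappa - 0.
      exact: cvgB.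
    rewrite subr0; apply: cvg_trans; apply: near_eq_cvg; apply: nearW => n.
    by rewrite mulrBr mulr1.
  by apply: cvgV => //; apply: cvgD => //; exact: cvg_cst.
have lo_cvg : 1 - C n - beta n / pi - beta n / pi * H_ n *
    ((1 + C n) / (1 + beta n / pi * (H_ n - 1))) - 2 * C n @[n --> \oo] -->
    (1 + kappa)^-1.
  rewrite (_ : (1 + kappa)^-1 = 1 - 0 - 0 - kappa * (1 * (1 + kappa)^-1) - 0); last first.
    by field.
  apply: cvgB => //; apply: cvgB.
    apply: cvgB => //; apply: cvgB => //; exact: cvg_cst.
  by apply: cvgM => //; exact: cvgM.
apply: squeeze_cvgr lo_cvg up_cvg; apply: nearW => n.
by rewrite (path_weight_lower cX (beta01 n)) (path_weight_upper cX (beta01 n)).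
Qed.

(** With 1 - beta = exp(-k/n) the product of the factors 1 - beta I is the
    exponential of -k/n times the number of visits, and beta times the
    harmonic sum tends to k t. *)
Lemma laplace_occupation_cvg :
  \int[P]_w expR (- (k * (n%:R^-1 * occupation (N_ n) w))) @[n --> \oo]
  --> (1 + k * (t / pi))^-1.
Proof.
rewrite mulrA -/kappa; apply: cvg_trans path_weight_cvg.
apply: near_eq_cvg; apply: nearW => n.
rewrite -(expect_prod_path_weight cX).
- apply: eq_Rintegral => w _.
  rewrite mulrA -/(x_ n) /occupation mulr_sumr -sumrN.
  apply: (big_ind2 (fun p s => p = expR s)) => [|p s q r -> ->|i _].
  + by rewrite expR0.
  + by rewrite expRD.
  + rewrite unit_indicE; case: (0 <= _ <= 1) => /=.
      by rewrite !mulr1 /beta subKr.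
    by rewrite !mulr0 subr0 oppr0 expR0.
- apply: bdd_measurableB; first exact: bdd_measurable_cst.
  by apply: bdd_measurableZ; exact: bdd_measurable_unit_indic.
Qed.

End occupation_limit.

(** * Time integrals along right-continuous paths *)

Lemma integrable_itv_cst (R : realType) (p q M : R) :
  (@lebesgue_measure R).-integrable `[p, q] (EFin \o (fun _ : R => M)).
Proof.
apply/integrableP; split; first exact/measurable_EFinP.
rewrite /= integral_cst/=; last exact: measurable_itv.
rewrite lebesgue_measure_itv/= lte_fin; case: ifP => _; last by rewrite mule0 ltry.
by rewrite -EFinB -EFinM ltry.
Qed.

Section joint_measurability.
Context d (T : measurableType d) (R : realType).
Variable X : R -> T -> R.
Hypothesis mX : forall t, 0 <= t -> measurable_fun setT (X t).
Hypothesis rcX : forall w t, 0 <= t -> X s w @[s --> t^'+] --> X t w.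

(** A grid point strictly to the right of the time, as right continuity
    requires; times are clipped at 0 because the process is only given on
    nonnegative times. *)
Let time (n : nat) (s : R) : R :=
  (Num.truncn (Num.max s 0 * n.+1%:R)).+1%:R / n.+1%:R.

Let time_gt n s : Num.max s 0 < time n s.
Proof.
have y0 : 0 <= Num.max s 0 * n.+1%:R by rewrite mulr_ge0// le_max lexx orbT.
by have /andP[_] := truncn_itv y0; rewrite /time ltr_pdivlMr.
Qed.

Let time_le n s : time n s <= Num.max s 0 + n.+1%:R^-1.
Proof.
have y0 : 0 <= Num.max s 0 * n.+1%:R by rewrite mulr_ge0// le_max lexx orbT.
have /andP[+ _] := truncn_itv y0.
rewrite /time -[X in X / _]natr1 mulrDl mul1r lerD2r => h.
by rewrite ler_pdivrMr.
Qed.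

Let time_cvg s : time n s @[n --> \oo] --> Num.max s 0.
Proof.
apply: (@squeeze_cvgr _ _ _ _ (fun=> Num.max s 0)
  (fun n => Num.max s 0 + n.+1%:R^-1)).
- by apply: nearW => n; rewrite (ltW (time_gt n s)) time_le.
- exact: cvg_cst.
- rewrite -[X in _ --> X]addr0; apply: cvgD; first exact: cvg_cst.
  exact: cvg_harmonic.
Qed.

Let measurable_time_X n : measurable_fun setT (fun z : T * R => X (time n z.2) z.1).
Proof.
move=> _ B mB; rewrite setTI.
pose A m : set R := [set s : R | Num.truncn (Num.max s 0 * n.+1%:R) = m].
have mA m : measurable (A m).
  have mf : measurable_fun [set: R] (fun s : R => Num.max s 0 * n.+1%:R).
    by apply: measurable_funM => //; exact: measurable_maxr.
  rewrite (_ : A m = (fun s : R => Num.max s 0 * n.+1%:R) @^-1` `[m%:R, m.+1%:R[).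
    by rewrite -[X in measurable X]setTI; apply: mf => //; exact: measurable_itv.
  apply/seteqP; split => s; rewrite /A /= in_itv/=.
    by move=> <-; apply: truncn_itv; rewrite mulr_ge0// le_max lexx orbT.
  by move/truncn_def.
rewrite (_ : _ @^-1` B =
    \bigcup_m ((X (m.+1%:R / n.+1%:R) @^-1` B) `*` A m)).
  apply: bigcup_measurable => m _; apply: measurableX => //.
  by rewrite -[X in measurable X]setTI; apply: mX => //; rewrite divr_ge0.
apply/seteqP; split => [[w s]/= h|[w s] [m _ [/= h1 h2]]].
  by exists (Num.truncn (Num.max s 0 * n.+1%:R)).
by rewrite /= /time h2.
Qed.

(** Right-continuous paths make the process a pointwise limit of processes
    that are constant in time on the cells of a grid. *)
Lemma measurable_joint : measurable_fun setT (fun z : T * R => X (Num.max z.2 0) z.1).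
Proof.
apply: (@measurable_fun_cvg _ _ _ _ (fun n z => X (time n z.2) z.1)) => //.
move=> [w s] _ /=.
have s0 : 0 <= Num.max s 0 by rewrite le_max lexx orbT.
have [+ _] := @cvg_at_rightP R (fun r => X r w) (Num.max s 0) (X (Num.max s 0) w).
by apply; [exact: rcX|split; [move=> n; exact: time_gt|exact: time_cvg]].
Qed.

Section time_integral.
Variables (f : R -> R) (p q : R).
Hypothesis bf : bdd_measurable f.
Hypothesis p0 : 0 <= p.

Notation mu := (@lebesgue_measure R).

Let D : set R := `[p, q]%classic.

Definition time_kernel (z : T * R) : R := \1_D z.2 * f (X (Num.max z.2 0) z.1).

Lemma measurable_time_kernel : measurable_fun setT time_kernel.
Proof.
have mI : measurable_fun [set: R] (\1_D : R -> R).
  by apply: measurable_indic; exact: measurable_itv.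
apply: measurable_funM; first exact: (measurableT_comp mI measurable_snd).
by apply: (measurableT_comp (proj1 bf)); exact: measurable_joint.
Qed.

Lemma time_kernelE w :
  \int[mu]_s time_kernel (w, s) = \int[mu]_(s in `[p, q]) f (X s w).
Proof.
rewrite Rintegral_indic_mul; apply: eq_Rintegral => s.
rewrite inE /D /= in_itv/= => /andP[ps _].
by rewrite max_l// (le_trans p0).
Qed.

Lemma integrable_indic_cst (M : R) : mu.-integrable setT (EFin \o (fun s => \1_D s * M)).
Proof.
apply: integrable_indic_mul; first exact: measurable_itv.
exact: integrable_itv_cst.
Qed.

Lemma integrable_time w : mu.-integrable `[p, q] (EFin \o (fun s => f (X s w))).
Proof.
have [M M0 fM] := bdd_measurable_bound bf.
have i : mu.-integrable `[p, q] (EFin \o (fun s => f (X (Num.max s 0) w))).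
  apply: (le_integrable _ _ _ (integrable_itv_cst p q M)) => //.
  - apply/measurable_EFinP/measurable_funTS; apply: (measurableT_comp (proj1 bf)).
    exact: (measurableT_comp measurable_joint (pair1_measurable w)).
  - by move=> s _ /=; rewrite lee_fin (le_trans (fM _))// ler_norm.
move: i; apply: eq_integrable; first exact: measurable_itv.
move=> s; rewrite inE /= in_itv/= => /andP[ps _] /=.
by rewrite max_l// (le_trans p0).
Qed.

Lemma bdd_measurable_time_integral :
  bdd_measurable (fun w => \int[mu]_(s in `[p, q]) f (X s w)).
Proof.
have [M M0 fM] := bdd_measurable_bound bf.
split.
  under eq_fun do rewrite -time_kernelE.
  by apply: measurable_Rintegral_snd; exact: measurable_time_kernel.
exists (\int[mu]_s (\1_D s * M)) => w; rewrite Rintegral_indic_mul.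
have mD : measurable (`[p, q]%classic : set (measurableTypeR R)).
  exact: measurable_itv.
apply: (le_trans (le_normr_Rintegral mD (integrable_time w))).
apply: (le_Rintegral mD) => //; last exact: integrable_itv_cst.
have := integrable_abse (integrable_time w); apply: eq_integrable => //.
Qed.

Lemma expect_time_integral (P : probability T R) (U : T -> R) : bdd_measurable U ->
  \int[P]_w (U w * \int[mu]_(s in `[p, q]) f (X s w)) =
  \int[mu]_(s in `[p, q]) \int[P]_w (U w * f (X s w)).
Proof.
move=> bU; have [M M0 fM] := bdd_measurable_bound bf.
have [B B0 UB] := bdd_measurable_bound bU.
pose F (z : T * R) := U z.1 * time_kernel z.
have mF : measurable_fun setT F.
  apply: measurable_funM; last exact: measurable_time_kernel.
  exact: (measurableT_comp (proj1 bU) measurable_fst).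
have FM w s : `|F (w, s)| <= \1_D s * (B * M).
  rewrite /F /time_kernel /= !normrM (ger0_norm (x := \1_D s))// mulrCA.
  by rewrite ler_wpM2l// ler_pM.
have := Rfubini_lebesgue P mF (integrable_indic_cst (B * M)) FM.
rewrite /F /= => e.
transitivity (\int[P]_w \int[mu]_s (U w * time_kernel (w, s))).
  apply: eq_Rintegral => w _; rewrite -time_kernelE RintegralZl//.
  apply: le_integrable (integrable_indic_cst M) => //.
  - apply/measurable_EFinP.
    exact: (measurableT_comp measurable_time_kernel (pair1_measurable w)).
  - move=> s _ /=; rewrite lee_fin /time_kernel /= !normrM.
    by rewrite ler_wpM2l// (le_trans (fM _))// ler_norm.
rewrite e -[RHS]Rintegral_indic_mul; apply: eq_Rintegral => s _.
rewrite /time_kernel /= indicE; case: (boolP (s \in D)) => [|_] /=.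
  rewrite inE /D /= in_itv/= => /andP[ps _]; rewrite mul1r.
  by under eq_Rintegral do rewrite mul1r max_l ?(le_trans p0 ps)//.
by rewrite mul0r; under eq_Rintegral do rewrite mul0r mulr0; rewrite expect_cst.
Qed.

End time_integral.
End joint_measurability.

(** * Correlations at two times *)

Lemma Rintegral_itv1_dist (R : realType) (p C c : R) (h : R -> R) :
  (@lebesgue_measure R).-integrable `[p, p + 1] (EFin \o h) ->
  (forall s, p <= s <= p + 1 -> `|h s - c| <= C) ->
  `|\int[@lebesgue_measure R]_(s in `[p, p + 1]) h s - c| <= C.
Proof.
move=> ih hC.
have mD : measurable (`[p, p + 1]%classic : set (measurableTypeR R)).
  exact: measurable_itv.
have cstE M : \int[@lebesgue_measure R]_(s in `[p, p + 1]) (M : R) = M.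
  rewrite Rintegral_cst//= lebesgue_measure_itv/= lte_fin ltrDl ltr01 /=.
  by rewrite addrAC subrr add0r mulr1.
rewrite -{1}(cstE c) -RintegralB//; last exact: integrable_itv_cst.
have i : (@lebesgue_measure R).-integrable `[p, p + 1] (EFin \o (fun s => h s - c)).
  by have := integrableB mD ih (integrable_itv_cst p (p + 1) c); apply: eq_integrable.
apply: (le_trans (le_normr_Rintegral mD i)); rewrite -[leRHS]cstE.
apply: (le_Rintegral mD); last by move=> s /=; rewrite in_itv/=; exact: hC.
  by have := integrable_abse i; apply: eq_integrable.
exact: integrable_itv_cst.
Qed.

Definition l1_norm (R : realType) (a : R -> R) : R :=
  \int[@lebesgue_measure R]_y `|a y|.

Definition l1_moment (R : realType) (a : R -> R) : R :=
  \int[@lebesgue_measure R]_y `|y * a y|.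

Definition correlation_cst (R : realType) (a b : R -> R) : R :=
  l1_norm b * l1_moment a + l1_moment b * l1_norm a +
  `|\int[@lebesgue_measure R]_y b y| * l1_norm a.

Section correlations.
Context d (T : measurableType d) (R : realType) (P : probability T R).
Notation mu := (@lebesgue_measure R).
Variable X : R -> T -> R.
Hypothesis cX : cauchy_process P X.

Let l1_norm_ge0 (a : R -> R) : 0 <= l1_norm a. Proof. exact: Rintegral_ge0. Qed.
Let l1_moment_ge0 (a : R -> R) : 0 <= l1_moment a. Proof. exact: Rintegral_ge0. Qed.

Let pi_ge1 : 1 <= (pi : R).
Proof. by rewrite (le_trans _ (pi_ge2 R))// ler1n. Qed.

Let bX (a : R -> R) u : 0 <= u -> bdd_measurable a -> bdd_measurable (fun w => a (X u w)).
Proof.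
move=> u0 ba; apply: (bdd_measurable_comp ba).
exact: (cauchy_process_measurable cX).
Qed.

Lemma expect_norm_le (a : R -> R) (u : R) : 0 < u -> moment_bounded a ->
  \int[P]_w `|a (X u w)| <= l1_norm a / u.
Proof.
move=> u0 [ba ia _].
have [_] := integrable_cauchy u0 (cauchy_process_distributed cX u0) 0 ia.
under eq_Rintegral do rewrite add0r.
move=> /le_trans; apply; rewrite -/(l1_norm a) invfM -mulrA (mulrC u^-1) ler_piMl//.
  by rewrite mulr_ge0// invr_ge0 ltW.
by rewrite invf_le1// pi_gt0.
Qed.

Lemma expect_moment_le (a : R -> R) (u : R) : 0 < u -> moment_bounded a ->
  P.-integrable setT (EFin \o (fun w => `|X u w * a (X u w)|)) /\
  \int[P]_w `|X u w * a (X u w)| <= l1_moment a / u.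
Proof.
move=> u0 [ba _ iya].
have [i +] := integrable_cauchy u0 (cauchy_process_distributed cX u0) 0 iya.
under eq_Rintegral do rewrite add0r.
move=> le; split.
  have := integrable_normr i; apply: eq_integrable => // w _ /=.
  by rewrite add0r.
apply: (le_trans le); rewrite -/(l1_moment a) invfM -mulrA (mulrC u^-1) ler_piMl//.
  by rewrite mulr_ge0// invr_ge0 ltW.
by rewrite invf_le1// pi_gt0.
Qed.

(** Condition on X_u: the expectation of b(X_(u+h)) is, by
    expect_cauchy_approx, the integral of b over pi h, up to an error linear
    in |X_u|. That error is integrated against |a(X_u)|, and the density of
    X_u is at most 1/(pi u), whence the factor 1/u. *)
Lemma correlation_approx (a b : R -> R) (u h : R) : 0 < u -> 0 < h ->
  moment_bounded a -> moment_bounded b ->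
  `|\int[P]_w (a (X u w) * b (X (u + h) w)) -
    (pi * h)^-1 * (\int[mu]_y b y) * \int[P]_w a (X u w)| <=
  (l1_norm b * l1_moment a + l1_moment b * l1_norm a) / (u * h ^+ 2).
Proof.
move=> u0 h0 Ha Hb; have [ba ia iya] := Ha; have [bb ib iyb] := Hb.
pose F (z : R * R) := a z.1 * b z.2.
have bF : bdd_measurable F.
  apply: bdd_measurableM.
    exact: (bdd_measurable_comp ba measurable_fst).
  exact: (bdd_measurable_comp bb measurable_snd).
have := expect_two_times cX (ltW u0) h0 bF; rewrite /F /= => ->.
set corr_bound := _ + _ * l1_norm a.
set c := \int[mu]_y b y.
have tr w : \int[P]_v (a (X u w) * b (X u w + (X (u + h) v - X u v))) =
    a (X u w) * transition P X h b (X u w).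
  rewrite expectZ ?(expect_increment cX _ (ltW u0) h0)//.
  apply: (bdd_measurable_comp bb); apply: measurable_funD => //.
  by apply: measurable_funB; apply: (cauchy_process_measurable cX);
    rewrite ?addr_ge0// ltW.
under eq_Rintegral do rewrite tr.
have bt : bdd_measurable (fun w => transition P X h b (X u w)).
  apply: bX (ltW u0) _; exact: (bdd_measurable_transition cX (ltW h0) bb).
have baX := bX (ltW u0) ba.
rewrite -expectZ// -expectB; [|exact: bdd_measurableM|exact: bdd_measurableZ].
have bd : bdd_measurable (fun w => a (X u w) * transition P X h b (X u w) -
    (pi * h)^-1 * c * a (X u w)).
  by apply: bdd_measurableB; [exact: bdd_measurableM|exact: bdd_measurableZ].
apply: (le_trans (le_norm_expect P bd)).
have [imX wnX] := expect_moment_le u0 Ha.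
have inX : P.-integrable setT (EFin \o (fun w => `|a (X u w)|)).
  by apply: bdd_measurable_integrable; exact: bdd_measurable_norm.
pose G w := (2 * pi * h ^+ 2)^-1 *
  (l1_norm b * `|X u w * a (X u w)| + l1_moment b * `|a (X u w)|).
have iG1 := integrable_mulr (l1_norm b) imX.
have iG2 := integrable_mulr (l1_moment b) inX.
have iG : P.-integrable setT (EFin \o G).
  by apply: integrable_mulr; exact: integrable_addr.
have K0 : 0 < 2 * pi * h ^+ 2 :> R by rewrite !mulr_gt0 ?pi_gt0// exprn_gt0.
apply: (@le_trans _ _ (\int[P]_w G w)).
  apply: le_Rintegral => //.
    by apply: bdd_measurable_integrable; exact: bdd_measurable_norm.
  move=> w _; rewrite (mulrC (a _)) -mulrBl normrM.
  have := expect_cauchy_approx h0 (cauchy_process_distributed cX h0) (X u w) bb ib iyb.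
  rewrite -/c => le.
  apply: (le_trans (ler_wpM2r (normr_ge0 (a (X u w))) le)).
  rewrite /G -[leLHS]mulrA ler_wpM2l ?invr_ge0 ?(ltW K0)// normrM -/(l1_norm b) -/(l1_moment b).
  by rewrite mulrDl mulrAC (mulrC _ (l1_norm b)).
rewrite RintegralZl//; last exact: integrable_addr.
rewrite RintegralD// !RintegralZl//.
have le2 : l1_norm b * (\int[P]_w `|X u w * a (X u w)|) + l1_moment b * \int[P]_w `|a (X u w)|
    <= corr_bound / u.
  rewrite /corr_bound mulrDl -!mulrA lerD// ler_wpM2l//.
  exact: expect_norm_le.
have cb0 : 0 <= corr_bound / u.
  by rewrite divr_ge0 ?(ltW u0)// addr_ge0// mulr_ge0.
have i0 : 0 <= (2 * pi * h ^+ 2)^-1 :> R by rewrite invr_ge0 ltW.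
apply: (le_trans (ler_wpM2l i0 le2)).
rewrite (_ : corr_bound / (u * h ^+ 2) = h ^- 2 * (corr_bound / u));
  last by rewrite invfM mulrA mulrC.
rewrite ler_wpM2r//.
rewrite lef_pV2 ?posrE ?exprn_gt0//.
rewrite ler_peMl ?exprn_ge0 ?(ltW h0)//.
by have := pi_ge1; move: (pi : R) => p; lra.
Qed.

(** Replacing the delay v - u by j - u costs another O(1/(u (j - u)^2)). The
    approximation then no longer depends on the position of v in [j, j + 1],
    so that it can be compared between a time integral over this interval
    and a value at its end. *)
Lemma correlation_approx_left (a b : R -> R) (u v j : R) :
  0 < u -> u + 1 <= j -> j <= v <= j + 1 ->
  moment_bounded a -> moment_bounded b ->
  `|\int[P]_w (a (X u w) * b (X v w)) -
    (\int[mu]_y b y) * ((pi * (j - u))^-1 * \int[P]_w a (X u w))| <=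
  correlation_cst a b / (u * (j - u) ^+ 2).
Proof.
move=> u0 uj /andP[jv vj] Ha Hb.
have ju : 1 <= j - u by rewrite lerBrDl.
have ju0 : 0 < j - u by rewrite (lt_le_trans _ ju).
have h0 : 0 < v - u by rewrite (lt_le_trans ju0)// lerD2r.
have cap := correlation_approx u0 h0 Ha Hb; rewrite subrKC in cap.
set E := \int[P]_w (_ * _) in cap *; set c := \int[mu]_y b y in cap *.
set A := \int[P]_w a _ in cap *; set corr_bound := _ + _ * l1_norm a in cap *.
have jvu : j - u <= v - u by rewrite lerD2r.
have cap2 : `|E - (pi * (v - u))^-1 * c * A| <= corr_bound / (u * (j - u) ^+ 2).
  apply: (le_trans cap); rewrite ler_wpM2l//.
    by rewrite addr_ge0// mulr_ge0.
  rewrite lef_pV2 ?posrE ?mulr_gt0 ?exprn_gt0// ler_wpM2l ?(ltW u0)//.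
  by rewrite lerXn2r ?nnegrE ?(ltW ju0) ?(ltW h0).
have A_le : `|A| <= l1_norm a / u.
  apply: le_trans (expect_norm_le u0 Ha).
  by apply: le_norm_expect; apply: bX (ltW u0) _; case: Ha.
have diff : `|(pi * (v - u))^-1 - (pi * (j - u))^-1| <= (j - u) ^- 2.
  rewrite distrC ger0_norm; last first.
    rewrite subr_ge0 lef_pV2 ?posrE ?mulr_gt0 ?pi_gt0//.
    by rewrite ler_wpM2l// pi_ge0.
  have -> : (pi * (j - u))^-1 - (pi * (v - u))^-1 =
      (v - j) / (pi * ((j - u) * (v - u))) :> R.
    move: (pi : R) (pi_gt0 R) => p p0; field.
    by rewrite !gt_eqF.
  rewrite ler_pdivrMr ?mulr_gt0 ?pi_gt0// mulrCA.
  have le1 : (j - u) ^- 2 * ((j - u) * (v - u)) >= 1.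
    rewrite mulrC ler_pdivlMr ?exprn_gt0// mul1r expr2 ler_wpM2l//.
    exact: ltW.
  have vj1 : v - j <= 1 by rewrite lerBlDl.
  by rewrite (le_trans vj1)// (le_trans le1)// ler_peMl// (le_trans _ le1).
have -> : E - c * ((pi * (j - u))^-1 * A) =
   (E - (pi * (v - u))^-1 * c * A) +
   ((pi * (v - u))^-1 - (pi * (j - u))^-1) * (c * A) by ring.
apply: (le_trans (ler_normD _ _)); rewrite /correlation_cst [leRHS]mulrDl lerD// normrM.
rewrite (le_trans (ler_pM (normr_ge0 _) (normr_ge0 _) diff (lexx _)))//.
rewrite normrM -[leRHS]mulrA [leLHS]mulrCA ler_wpM2l//.
rewrite (_ : l1_norm a / (u * (j - u) ^+ 2) = (j - u) ^- 2 * (l1_norm a / u));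
  last by rewrite invfM mulrA mulrC.
by rewrite ler_wpM2l// invr_ge0 exprn_ge0// ltW.
Qed.

End correlations.

(** * Second moment of the time integral recentred by the visits *)

(** A bound for sums of variables whose correlations decay like 1/(i (j -
    i)^2): the sum over j is bounded by a constant over i, and the sum over
    i is a harmonic sum. Neighbouring indices, for which no decay is
    available, contribute terms of order 1/i too. *)
Section second_moment_sum.
Context d (T : measurableType d) (R : realType) (P : probability T R).
Variables (eta : nat -> T -> R) (A : R).
Hypothesis beta : forall i, bdd_measurable (eta i).
Hypothesis near_diag : forall i j,
  `|\int[P]_w (eta i w * eta j w)| <= A / i.+1%:R.
Hypothesis off_diag : forall i k,
  `|\int[P]_w (eta i w * eta (i + k.+2)%N w)| <= A / (i.+1%:R * k.+1%:R ^+ 2).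

Let A0 : 0 <= A.
Proof. by have := near_diag 0 0; rewrite divr1; apply: le_trans. Qed.

Let tail m n w := \sum_(j < n) eta (m + j)%N w.

Let btail m n : bdd_measurable (tail m n).
Proof. exact: bdd_measurable_sum. Qed.

Let cross_le m n : \int[P]_w (eta m w * tail m.+1 n w) <= 3 * A / m.+1%:R.
Proof.
have m0 : 0 < m.+1%:R :> R by rewrite ltr0n.
rewrite /tail; under eq_Rintegral do rewrite mulr_sumr.
rewrite expect_sum; last by move=> i; exact: bdd_measurableM.
case: n => [|n].
  by rewrite big_ord0 divr_ge0 ?mulr_ge0.
rewrite big_ord_recl.
(* The next neighbour is bounded by the diagonal estimate; for the others
   use 1 + 1/4 + 1/9 + ... <= 2. *)
have -> : 3 * A / m.+1%:R = A / m.+1%:R + A / m.+1%:R * 2 by ring.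
apply: lerD; first by rewrite (le_trans (ler_norm _)).
rewrite (le_trans _ (ler_wpM2l _ (sum_inv_sqr_le R n))) ?divr_ge0//.
rewrite mulr_sumr; apply: ler_sum => k _.
rewrite (le_trans (ler_norm _))//.
have := off_diag m k; rewrite invfM mulrA.
by rewrite (_ : (m + k.+2)%N = (m.+1 + lift ord0 k)%N)// lift0; lia.
Qed.

Lemma second_moment_sum_le n :
  \int[P]_w (\sum_(j < n) eta j w) ^+ 2 <= 7 * A * harmonic_sum R n.
Proof.
(* Induction on the length with an arbitrary first index m: the square of
   eta m + tail gives A/(m+1) for the diagonal and 2 * 3 A/(m+1) for the
   cross term, hence the constant 7. *)
suff key m : \int[P]_w (tail m n w) ^+ 2 <=
    7 * A * \sum_(j < n) (m + j).+1%:R^-1 by exact: (key 0%N).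
elim: n m => [|n IH] m.
  rewrite /tail big_ord0 mulr0; under eq_Rintegral do rewrite big_ord0 expr0n.
  by rewrite expect_cst.
have tS w : tail m n.+1 w = eta m w + tail m.+1 n w.
  rewrite /tail big_ord_recl addn0; congr (_ + _).
  by apply: eq_bigr => j _; rewrite lift0 addnS addSn.
under eq_Rintegral do rewrite tS sqrrD.
have b1 : bdd_measurable (fun w => eta m w ^+ 2).
  by under eq_fun do rewrite expr2; exact: bdd_measurableM.
have b2 : bdd_measurable (fun w => eta m w * tail m.+1 n w).
  exact: bdd_measurableM.
have b22 : bdd_measurable (fun w => eta m w * tail m.+1 n w *+ 2).
  by under eq_fun do rewrite -mulr_natl; exact: bdd_measurableZ.
have b3 : bdd_measurable (fun w => tail m.+1 n w ^+ 2).
  by under eq_fun do rewrite expr2; exact: bdd_measurableM.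
rewrite expectD//; last exact: bdd_measurableD.
rewrite expectD// big_ord_recl addn0 mulrDr; apply: lerD; last first.
  apply: (le_trans (IH m.+1)); rewrite ler_wpM2l ?mulr_ge0//.
  by apply: ler_sum => j _; rewrite lift0 addnS addSn.
have e1 : \int[P]_w eta m w ^+ 2 <= A / m.+1%:R.
  under eq_Rintegral do rewrite expr2.
  by rewrite (le_trans (ler_norm _)).
have e2 : \int[P]_w (eta m w * tail m.+1 n w *+ 2) <= 2 * (3 * A / m.+1%:R).
  under eq_Rintegral do rewrite -mulr_natl.
  by rewrite expectZ// ler_wpM2l//; exact: cross_le.
rewrite (le_trans (lerD e1 e2))//.
by rewrite (_ : A / _ + _ = 7 * A / m.+1%:R)//; ring.
Qed.

End second_moment_sum.

Section occupation_difference.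
Context d (T : measurableType d) (R : realType) (P : probability T R).
Notation mu := (@lebesgue_measure R).
Variable X : R -> T -> R.
Hypothesis cX : cauchy_process P X.
Variable f : R -> R.
Hypothesis Hf : moment_bounded f.

Let bf : bdd_measurable f. Proof. by case: Hf. Qed.
Let mX t : 0 <= t -> measurable_fun setT (X t).
Proof. by move=> ?; exact: (cauchy_process_measurable cX). Qed.
Let rcX := cauchy_process_right_continuous cX.
Let c : R := \int[mu]_y f y.
Let one : R -> R := unit_indic.
Let Hone : moment_bounded one.
Proof.
have := moment_bounded_unit_indic_mul (bdd_measurable_cst R (1:R)).
by rewrite (_ : (fun y => _) = one)//; apply/funext => y; rewrite mulr1.
Qed.
Let bone : bdd_measurable one. Proof. by case: Hone. Qed.

Let bX (a : R -> R) u : 0 <= u -> bdd_measurable a -> bdd_measurable (fun w => a (X u w)).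
Proof. by move=> u0 ba; apply: (bdd_measurable_comp ba); exact: mX. Qed.

(** The time integral of f over [j, j + 1] recentred by its counterpart c
    I(X_(j+1)): the two functions f and c I have the same integral, hence
    the same leading correlations with the past. *)
Definition block (j : nat) (w : T) : R :=
  \int[mu]_(s in `[j%:R, j%:R + 1]) f (X s w) - c * one (X (j%:R + 1) w).

Let bint j : bdd_measurable (fun w => \int[mu]_(s in `[j%:R, j%:R + 1]) f (X s w)).
Proof. exact: (bdd_measurable_time_integral mX rcX _ bf). Qed.

Let j1_ge0 j : 0 <= j%:R + 1 :> R. Proof. by rewrite addr_ge0. Qed.

Lemma bdd_measurable_block j : bdd_measurable (block j).
Proof.
apply: bdd_measurableB => //; apply: bdd_measurableZ; exact: bX.
Qed.

Let expect_mul_block (U : T -> R) j : bdd_measurable U ->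
  \int[P]_w (U w * block j w) =
  \int[mu]_(s in `[j%:R, j%:R + 1]) \int[P]_w (U w * f (X s w)) -
  c * \int[P]_w (U w * one (X (j%:R + 1) w)).
Proof.
move=> bU; have bo := bX (j1_ge0 j) bone.
rewrite /block -(expect_time_integral mX rcX _ bf)//.
rewrite -expectZ; last exact: bdd_measurableM.
rewrite -expectB; last 2 first.
- exact: bdd_measurableM.
- by apply: bdd_measurableZ; exact: bdd_measurableM.
by apply: eq_Rintegral => w _; ring.
Qed.

Let integrable_expect_mul (h : R -> R) (U : T -> R) j :
  bdd_measurable h -> bdd_measurable U ->
  mu.-integrable `[j%:R, j%:R + 1]
    (EFin \o (fun s => \int[P]_w (U w * h (X s w)))).
Proof.
move=> bh bU; have [B B0 UB] := bdd_measurable_bound bU.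
have [M M0 hM] := bdd_measurable_bound bh.
pose F (z : R * T) := U z.2 * h (X (Num.max z.1 0) z.2).
have mF : measurable_fun setT F.
  apply: measurable_funM; first exact: (measurableT_comp (proj1 bU) measurable_snd).
  apply: (measurableT_comp (proj1 bh)).
  have sw : measurable_fun setT (fun z : R * T => (z.2, z.1)) by exact: measurable_swap.
  exact: (measurableT_comp (measurable_joint mX rcX) sw).
have bF : bdd_measurable F.
  by split => //; exists (B * M) => z; rewrite normrM ler_pM.
have mI := bdd_measurable_Rintegral_snd P bF.
have : mu.-integrable `[j%:R, j%:R + 1] (EFin \o (fun s => \int[P]_w F (s, w))).
  have [K K0 FK] := bdd_measurable_bound mI.
  apply: (le_integrable _ _ _ (integrable_itv_cst j%:R (j%:R + 1) K)) => //.
  - by apply/measurable_EFinP/measurable_funTS; case: mI.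
  - by move=> s _ /=; rewrite lee_fin (le_trans (FK s))// ler_norm.
apply: eq_integrable; first exact: measurable_itv.
move=> s; rewrite inE /= in_itv/= => /andP[js _] /=.
by rewrite /F /= max_l// (le_trans _ js).
Qed.

Let block_cst (a : R -> R) : R :=
  correlation_cst a f + `|c| * correlation_cst a one.

(** The common value theta c is the leading term of both parts of the block,
    and it cancels. *)
Let expect_block_le (a : R -> R) (u : R) j : 0 < u -> u + 1 <= j%:R ->
  moment_bounded a ->
  `|\int[P]_w (a (X u w) * block j w)| <= block_cst a / (u * (j%:R - u) ^+ 2).
Proof.
move=> u0 uj Ha; have [ba _ _] := Ha.
have bU := bX (ltW u0) ba; rewrite expect_mul_block//.
set theta := (pi * (j%:R - u))^-1 * \int[P]_w a (X u w).
have h1 : `|\int[mu]_(s in `[j%:R, j%:R + 1]) \int[P]_w (a (X u w) * f (X s w)) -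
    c * theta| <= correlation_cst a f / (u * (j%:R - u) ^+ 2).
  apply: Rintegral_itv1_dist; first exact: integrable_expect_mul.
  by move=> s js; exact: (correlation_approx_left cX).
have h2 : `|\int[P]_w (a (X u w) * one (X (j%:R + 1) w)) - theta| <=
    correlation_cst a one / (u * (j%:R - u) ^+ 2).
  have := @correlation_approx_left _ _ _ _ _ cX a one u (j%:R + 1) j%:R u0 uj _ Ha Hone.
  by rewrite Rintegral_unit_indic mul1r; apply; rewrite lerDl ler01 lexx.
set V := \int[mu]_(s in _) _ in h1 *; set W := \int[P]_w _ in h2 *.
have -> : V - c * W = (V - c * theta) - c * (W - theta) by ring.
rewrite (le_trans (ler_normB _ _))// /block_cst mulrDl lerD// normrM -mulrA.
by rewrite ler_wpM2l.
Qed.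

Let K2 : R := block_cst f + `|c| * block_cst one.

(** The estimate of expect_block_le is applied to the later block, and
    averaged over the earlier one. *)
Let block_off_diag i k :
  `|\int[P]_w (block i.+1 w * block (i.+1 + k.+2)%N w)| <=
  K2 / (i.+1%:R * k.+1%:R ^+ 2).
Proof.
set j := (i.+1 + k.+2)%N.
have i0 : 0 < i.+1%:R :> R by rewrite ltr0n.
have k0 : 0 < k.+1%:R :> R by rewrite ltr0n.
have jE : j%:R = i.+1%:R + k.+1%:R + 1 :> R.
  by rewrite /j addnS -addn1 !natrD.
under eq_Rintegral do rewrite mulrC.
have bj := bdd_measurable_block j.
rewrite expect_mul_block//.
have bcst (a : R -> R) : 0 <= block_cst a.
  have n0 (b : R -> R) : 0 <= l1_norm b by exact: Rintegral_ge0.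
  have m0 (b : R -> R) : 0 <= l1_moment b by exact: Rintegral_ge0.
  by rewrite /block_cst /correlation_cst !(addr_ge0, mulr_ge0).
have bound (a : R -> R) (s : R) : moment_bounded a -> i.+1%:R <= s <= i.+1%:R + 1 ->
    `|\int[P]_w (block j w * a (X s w))| <= block_cst a / (i.+1%:R * k.+1%:R ^+ 2).
  move=> Ha /andP[les si]; have s0 : 0 < s by exact: lt_le_trans les.
  (* The earlier block ends at i + 2 and the later one starts at i + k + 3. *)
  have js : k.+1%:R <= j%:R - s by rewrite jE; lra.
  have sj : s + 1 <= j%:R.
    by rewrite -lerBrDl (le_trans _ js)// ler1n.
  under eq_Rintegral do rewrite mulrC.
  apply: (le_trans (expect_block_le s0 sj Ha)).
  have js0 : 0 < j%:R - s by exact: lt_le_trans js.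
  rewrite ler_wpM2l ?bcst// lef_pV2 ?posrE ?(mulr_gt0, exprn_gt0)//.
  rewrite ler_pM ?(ltW i0) ?exprn_ge0 ?(ltW k0)// lerXn2r ?nnegrE ?(ltW k0)//.
  by rewrite (le_trans _ js) ?ltW.
have h1 : `|\int[mu]_(s in `[i.+1%:R, i.+1%:R + 1])
    \int[P]_w (block j w * f (X s w)) - 0| <=
    block_cst f / (i.+1%:R * k.+1%:R ^+ 2).
  apply: Rintegral_itv1_dist; first exact: integrable_expect_mul.
  by move=> s sij; rewrite subr0; exact: bound.
have h2 : `|\int[P]_w (block j w * one (X (i.+1%:R + 1) w))| <=
    block_cst one / (i.+1%:R * k.+1%:R ^+ 2).
  by apply: bound => //; rewrite lerDl ler01 lexx.
rewrite subr0 in h1.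
rewrite (le_trans (ler_normB _ _))// /K2 mulrDl lerD// normrM -mulrA.
by rewrite ler_wpM2l.
Qed.

Let block_bound : exists2 B : R, 0 <= B & forall j w, `|block j w| <= B.
Proof.
have [M M0 fM] := bdd_measurable_bound bf.
exists (M + `|c|); first by rewrite addr_ge0.
move=> j w; rewrite (le_trans (ler_normB _ _))// lerD//.
  rewrite -[X in `|X|]subr0; apply: Rintegral_itv1_dist.
    exact: (integrable_time mX rcX _ bf).
  by move=> s _; rewrite subr0.
by rewrite normrM ler_piMr// ger0_norm ?unit_indic_ge0 ?unit_indic_le1.
Qed.

Let K3 : R := l1_norm f + `|c| * l1_norm one.

(** The density of X_s is at most 1/(pi s). Together with the boundedness of
    the blocks this gives the bound on the diagonal. *)
Let expect_norm_block i : \int[P]_w `|block i.+1 w| <= K3 / i.+1%:R.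
Proof.
have i0 : 0 < i.+1%:R :> R by rewrite ltr0n.
have bnf := bdd_measurable_norm bf.
have binf := bdd_measurable_time_integral mX rcX (i.+1%:R + 1) bnf (ltW i0).
have bo := bX (j1_ge0 i.+1) bone.
have bno := bdd_measurable_norm bo.
apply: (@le_trans _ _ (\int[P]_w (\int[mu]_(s in `[i.+1%:R, i.+1%:R + 1]) `|f (X s w)| +
    `|c| * `|one (X (i.+1%:R + 1) w)|))).
  apply: le_expect.
  - by apply: bdd_measurable_norm; exact: bdd_measurable_block.
  - by apply: bdd_measurableD => //; exact: bdd_measurableZ.
  - move=> w; rewrite (le_trans (ler_normB _ _))// normrM lerD//.
    have mD : measurable (`[i.+1%:R, i.+1%:R + 1]%classic : set (measurableTypeR R)).
      exact: measurable_itv.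
    apply: (le_normr_Rintegral mD); exact: (integrable_time mX rcX _ bf).
rewrite expectD//; last exact: bdd_measurableZ.
rewrite expectZ// /K3 mulrDl lerD//.
  have := expect_time_integral mX rcX (i.+1%:R + 1) bnf (ltW i0) P
    (bdd_measurable_cst T (1:R)).
  under eq_Rintegral do rewrite mul1r.
  move=> ->.
  have H s : i.+1%:R <= s <= i.+1%:R + 1 ->
      `|\int[P]_w (1 * `|f (X s w)|) - 0| <= l1_norm f / i.+1%:R.
    move=> /andP[les _]; have s0 := lt_le_trans i0 les.
    rewrite subr0 ger0_norm; last by apply: Rintegral_ge0 => w _; rewrite mul1r.
    under eq_Rintegral do rewrite mul1r.
    apply: (le_trans (expect_norm_le cX s0 Hf)).
    by rewrite ler_wpM2l ?lef_pV2 ?posrE//; exact: Rintegral_ge0.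
  rewrite -[leLHS]subr0 (le_trans (ler_norm _))//.
  have b1 := bdd_measurable_cst T (1:R).
  exact: (Rintegral_itv1_dist (integrable_expect_mul i.+1 bnf b1) H).
rewrite -mulrA ler_wpM2l//.
have j0 : 0 < i.+1%:R + 1 :> R by rewrite addr_gt0.
apply: (le_trans (expect_norm_le cX j0 Hone)).
by rewrite ler_wpM2l ?lef_pV2 ?posrE ?lerDl//; exact: Rintegral_ge0.
Qed.

Lemma second_moment_blocks : exists A : R, forall n,
  \int[P]_w (\sum_(j < n) block j.+1 w) ^+ 2 <= A * harmonic_sum R n.
Proof.
have [B B0 blockB] := block_bound.
pose A := Num.max K2 (B * K3).
exists (7 * A); apply: (@second_moment_sum_le _ _ _ P (fun j => block j.+1) A).
- by move=> i; exact: bdd_measurable_block.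
- move=> i j; have bi := bdd_measurable_block i.+1.
  have bj := bdd_measurable_block j.+1.
  apply: (le_trans (le_norm_expect P (bdd_measurableM bi bj))).
  apply: (@le_trans _ _ (\int[P]_w (B * `|block i.+1 w|))).
    apply: le_expect.
    + by apply: bdd_measurable_norm; exact: bdd_measurableM.
    + by apply: bdd_measurableZ; exact: bdd_measurable_norm.
    + by move=> w; rewrite normrM mulrC ler_wpM2r.
  rewrite expectZ; last exact: bdd_measurable_norm.
  apply: (le_trans (ler_wpM2l B0 (expect_norm_block i))).
  by rewrite mulrA ler_wpM2r ?invr_ge0// le_max lexx orbT.
- move=> i k; apply: (le_trans (block_off_diag i k)).
  by rewrite ler_wpM2r ?invr_ge0 ?mulr_ge0 ?exprn_ge0// le_max lexx.
Qed.

Let time_integralS N w :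
  \int[mu]_(s in `[0, N.+1%:R]) f (X s w) =
  \int[mu]_(s in `[0, N%:R]) f (X s w) +
  \int[mu]_(s in `[N%:R, N%:R + 1]) f (X s w).
Proof.
have i := integrable_time mX rcX (N.+1%:R) bf (lexx 0) w.
have := Rintegral_itvB (x := N%:R) i.
rewrite !bnd_simp ler0n ler_nat leqnSn => /(_ isT isT) h.
have e : \int[mu]_(s in `]N%:R, N.+1%:R]) f (X s w) =
    \int[mu]_(s in `[N%:R, N%:R + 1]) f (X s w).
  rewrite Rintegral_itv_obnd_cbnd ?natr1//.
  apply: integrableS i => //; [exact: measurable_itv..|].
  by apply: subset_itvr; rewrite bnd_simp.
by rewrite -e -h addrC subrK.
Qed.

Lemma time_integral_blocks N w :
  \int[mu]_(s in `[0, N%:R]) f (X s w) =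
  c * occupation X N w + \sum_(j < N) block j w.
Proof.
elim: N => [|N IH].
  by rewrite set_itv1 Rintegral_set1 /occupation !big_ord0 mulr0 addr0.
rewrite time_integralS IH /occupation !big_ord_recr /= /block -/one.
have -> : N.+1%:R = N%:R + 1 :> R by rewrite natr1.
by ring.
Qed.

End occupation_difference.

(** * The visits at integer times determine the time integral *)

Section occupation_difference_limit.
Context d (T : measurableType d) (R : realType) (P : probability T R).
Notation mu := (@lebesgue_measure R).
Variable X : R -> T -> R.
Hypothesis cX : cauchy_process P X.
Variable f : R -> R.
Hypothesis Hf : moment_bounded f.
Variable t : R.
Hypothesis t0 : 0 < t.

Let mX s : 0 <= s -> measurable_fun setT (X s).
Proof. by move=> ?; exact: (cauchy_process_measurable cX). Qed.
Let rcX := cauchy_process_right_continuous cX.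
Let bf : bdd_measurable f. Proof. by case: Hf. Qed.
Let c : R := \int[mu]_y f y.
Let y_ (n : nat) : R := expR (n%:R * t).
Let N_ (n : nat) : nat := Num.truncn (y_ n).

Let y_ge1 n : 1 <= y_ n.
Proof. by rewrite -expR0 ler_expR mulr_ge0// ltW. Qed.

Let diff n w : R :=
  \int[mu]_(s in `[0, y_ n]) f (X s w) - c * occupation X (N_ n) w.

Let sum_blocks n w : R := \sum_(j < (N_ n).-1) block X f j.+1 w.

Let bsum n : bdd_measurable (sum_blocks n).
Proof. by apply: bdd_measurable_sum => j; exact: (bdd_measurable_block cX Hf). Qed.

Let bdiff n : bdd_measurable (diff n).
Proof.
apply: bdd_measurableB.
  exact: (bdd_measurable_time_integral mX rcX _ bf).
by apply: bdd_measurableZ; exact: (bdd_measurable_occupation cX).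
Qed.

(** Two pieces are left out by sum_blocks and are bounded: the time after
    the last integer, and the block over [0, 1], near whose left end the
    bounds in 1/s are void. *)
Let remainder : exists2 B : R, 0 <= B &
  forall n w, `|diff n w - sum_blocks n w| <= B.
Proof.
have [M M0 fM] := bdd_measurable_bound bf.
have itv_le p q w : 0 <= p -> q <= p + 1 ->
    `|\int[mu]_(s in `[p, q]) f (X s w)| <= M.
  move=> p0 qp.
  have mD : measurable (`[p, q]%classic : set (measurableTypeR R)).
    exact: measurable_itv.
  have i := integrable_time mX rcX q bf p0 w.
  apply: (le_trans (le_normr_Rintegral mD i)).
  apply: (@le_trans _ _ (\int[mu]_(s in `[p, q]) M)).
    apply: (le_Rintegral mD) => //; last exact: integrable_itv_cst.
    have := integrable_abse i; exact: eq_integrable.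
  rewrite Rintegral_cst//= lebesgue_measure_itv/= lte_fin.
  case: ltP => [pq|_] /=; last by rewrite mulr0.
  by rewrite ler_piMr// lerBlDl.
exists (M + (M + `|c|)); first by rewrite !addr_ge0.
move=> n w; rewrite /diff /sum_blocks.
have y0 := ltW (lt_le_trans ltr01 (y_ge1 n)).
have /andP[Ny yN] := truncn_itv y0; rewrite -/(N_ n) in Ny yN.
have N0 : (0 < N_ n)%N by rewrite truncn_gt0.
have split_y : \int[mu]_(s in `[0, y_ n]) f (X s w) =
    \int[mu]_(s in `[0, (N_ n)%:R]) f (X s w) +
    \int[mu]_(s in `[(N_ n)%:R, y_ n]) f (X s w).
  have i := integrable_time mX rcX (y_ n) bf (lexx 0) w.
  have := Rintegral_itvB (x := (N_ n)%:R) i.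
  rewrite !bnd_simp ler0n Ny => /(_ isT isT) h.
  rewrite -(Rintegral_itv_obnd_cbnd (r := (N_ n)%:R)); last first.
    apply: integrableS i => //; [exact: measurable_itv..|].
    by apply: subset_itvr; rewrite bnd_simp.
  by rewrite -h addrC subrK.
have sumE : \sum_(j < N_ n) block X f j w =
    block X f 0 w + \sum_(j < (N_ n).-1) block X f j.+1 w.
  by case: (N_ n) N0 => // m _; rewrite big_ord_recl.
rewrite split_y (time_integral_blocks cX Hf) sumE.
rewrite (_ : _ - _ - _ = \int[mu]_(s in `[(N_ n)%:R, y_ n]) f (X s w) + block X f 0 w);
  last by rewrite /c; ring.
rewrite (le_trans (ler_normD _ _))// lerD//.
  by apply: itv_le => //; rewrite natr1 ltW.
rewrite /block (le_trans (ler_normB _ _))// lerD//.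
  by apply: itv_le; rewrite ?lerr.
by rewrite normrM ler_piMr// ger0_norm ?unit_indic_ge0 ?unit_indic_le1.
Qed.

(** The second moment is O(log N) = O(n), with N of order exp(n t), and it
    is divided by n^2. *)
Lemma occupation_difference_cvg :
  \int[P]_w (n%:R^-1 * \int[mu]_(s in `[0, expR (n%:R * t)]) f (X s w) -
    c * (n%:R^-1 * occupation X (Num.truncn (expR (n%:R * t))) w)) ^+ 2
  @[n --> \oo] --> 0.
Proof.
have [B B0 remB] := remainder.
have [A sumA] := second_moment_blocks cX Hf.
have invn_cvg : n%:R^-1 @[n --> \oo] --> (0 : R).
  have := @cvg_harmonic R; rewrite -(@cvg_shiftS _ (fun n => n%:R^-1 : R)).
  exact.
pose bound n : R := n%:R^-1 * n%:R^-1 * (2 * (B ^+ 2 + `|A|)) +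
  n%:R^-1 * (2 * (`|A| * t)).
have bound_cvg : bound n @[n --> \oo] --> 0.
  rewrite -[X in _ --> X]addr0; apply: cvgD.
    rewrite -(mul0r (2 * (B ^+ 2 + `|A|))); apply: cvgMr_tmp.
    by rewrite -[X in _ --> X](mulr0 0); exact: cvgM.
  by rewrite -(mul0r (2 * (`|A| * t))); exact: cvgMr_tmp.
apply: (@squeeze_cvgr _ _ _ _ (fun=> 0) bound) => //; last exact: cvg_cst.
apply: nearW => n; rewrite Rintegral_ge0 => [/=|w _]; last exact: sqr_ge0.
have eqd w : n%:R^-1 * \int[mu]_(s in `[0, expR (n%:R * t)]) f (X s w) -
    c * (n%:R^-1 * occupation X (Num.truncn (expR (n%:R * t))) w) =
    n%:R^-1 * diff n w by rewrite /diff /N_ /y_; ring.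
under eq_Rintegral do rewrite eqd exprMn.
have bd2 : bdd_measurable (fun w => diff n w ^+ 2).
  by under eq_fun do rewrite expr2; exact: bdd_measurableM.
have bs2 : bdd_measurable (fun w => sum_blocks n w ^+ 2).
  by under eq_fun do rewrite expr2; exact: bdd_measurableM.
have bB : bdd_measurable (fun _ : T => B ^+ 2) by exact: bdd_measurable_cst.
have le1 : \int[P]_w (diff n w ^+ 2) <=
    2 * (B ^+ 2 + \int[P]_w (sum_blocks n w ^+ 2)).
  rewrite -{1}(expect_cst P (B ^+ 2)) -expectD// -expectZ; last exact: bdd_measurableD.
  apply: le_expect => //; first by apply: bdd_measurableZ; exact: bdd_measurableD.
  move=> w; have := remB n w; move: (diff n w) (sum_blocks n w) => D S DS.
  have : (D - S) ^+ 2 <= B ^+ 2.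
    by rewrite -(real_normK (num_real (D - S))) lerXn2r// nnegrE.
  (* D^2 <= 2 (D - S)^2 + 2 S^2. *)
  have := sqr_ge0 (D - S - S); rewrite !expr2 => h1 h2; nra.
have le2 : \int[P]_w (sum_blocks n w ^+ 2) <= `|A| * (1 + n%:R * t).
  apply: (le_trans (sumA _)).
  apply: (@le_trans _ _ (`|A| * harmonic_sum R (N_ n).-1)).
    by rewrite ler_wpM2r ?harmonic_sum_ge0// ler_norm.
  rewrite ler_wpM2l// (le_trans (le_harmonic_sum R (leq_pred _)))//.
  by have /andP[] := harmonic_sum_truncn (mulr_ge0 (ler0n R n) (ltW t0)).
have in0 : 0 <= n%:R ^- 2 :> R by rewrite invr_ge0 exprn_ge0.
rewrite expectZ// exprVn (le_trans (ler_wpM2l in0 le1))//.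
have le3 : 2 * (B ^+ 2 + \int[P]_w (sum_blocks n w ^+ 2)) <=
    2 * (B ^+ 2 + `|A| * (1 + n%:R * t)).
  by rewrite ler_wpM2l// lerD2l.
rewrite (le_trans (ler_wpM2l in0 le3))// /bound -exprVn expr2.
case: n {eqd bd2 bs2 le1 le2 in0 le3} => [|n].
  by rewrite invr0 !mul0r addr0.
have n0 : n.+1%:R != 0 :> R by rewrite pnatr_eq0.
rewrite le_eqVlt; apply/orP; left; apply/eqP.
by move: (n.+1%:R : R) n0 => x x0; field.
Qed.

End occupation_difference_limit.

(** * Uniform approximation by Bernstein polynomials *)

Lemma continuous_uniform_on_segment (R : realType) (g : R -> R) (K e : R) :
  continuous g -> 0 < e ->
  exists2 dl : R, 0 < dl &
    forall x y, `|x| <= K -> `|x - y| < dl -> `|g x - g y| < e.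
Proof.
move=> cg e0.
pose Q (dl x : R) := forall y, `|x - y| < dl -> `|g x - g y| < e.
have cpt : compact (`[- K, K]%classic : set R) by exact: segment_compact.
have nc := (compact_near_coveringP (`[- K, K]%classic : set R)).1 cpt.
have : \forall dl \near 0^'+, forall x, `[- K, K]%classic x -> Q dl x.
  apply: nc => x _.
  have e20 : 0 < e / 2 by rewrite divr_gt0.
  have /cvgrPdist_lt /(_ _ e20) := cg x.
  move=> /nbhs_ballP[r /= r0 hr].
  have r2 : 0 < r / 2 by rewrite divr_gt0.
  exists (ball x (r / 2), [set dl : R | dl < r / 2]) => /=.
    split; first by apply: nbhsx_ballx.
    by apply: nbhs_right_lt.
  move=> [x' dl] /= [xx' dlr] y x'y.
  rewrite /ball /= in hr xx'.
  have xr : `|x - x'| < r by rewrite (lt_trans xx')// gtr_pMr// invf_lt1// ltr1n.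
  have yr : `|x - y| < r.
    rewrite (_ : x - y = (x - x') + (x' - y)); last by ring.
    by rewrite (le_lt_trans (ler_normD _ _))// [ltRHS](splitr r) ltrD// (lt_trans x'y).
  have h1 := hr _ xr; have h2 := hr _ yr.
  rewrite (_ : g x' - g y = (g x - g y) - (g x - g x')); last by ring.
  by rewrite (le_lt_trans (ler_normB _ _))// [ltRHS](splitr e) ltrD.
move=> H; near ((0 : R)^'+) => dl.
have Hdl : forall x, `[- K, K]%classic x -> Q dl x by near: dl.
exists dl; first by near: dl; exact: nbhs_right_gt.
move=> x y xK; apply: Hdl.
by rewrite /= in_itv /= -ler_norml.
Unshelve. all: by end_near. Qed.

Section bernstein.
Context (R : realType).
Implicit Types (h : nat -> R) (x : R).

(** The expectation of h(B) for B binomial with parameters n and x, computed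
    by conditioning on the first trial. The recursive form makes linearity,
    positivity and second moments immediate inductions. *)
Fixpoint bernstein (n : nat) (h : nat -> R) (x : R) : R :=
  if n is m.+1 then
    x * bernstein m (fun j => h j.+1) x + (1 - x) * bernstein m h x
  else h 0%N.

Lemma bernstein_lin n (a b : R) h1 h2 x :
  bernstein n (fun j => a * h1 j + b * h2 j) x =
  a * bernstein n h1 x + b * bernstein n h2 x.
Proof.
elim: n h1 h2 => [//|n IH] h1 h2 /=.
by rewrite (IH (fun j => h1 j.+1) (fun j => h2 j.+1)) IH; ring.
Qed.

Lemma bernstein_cst n (a : R) x : bernstein n (fun=> a) x = a.
Proof. by elim: n => [//|n IH] /=; rewrite IH; ring. Qed.

Lemma le_bernstein n h1 h2 x : 0 <= x <= 1 -> (forall j, h1 j <= h2 j) ->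
  bernstein n h1 x <= bernstein n h2 x.
Proof.
move=> /andP[x0 x1]; elim: n h1 h2 => [|n IH] h1 h2 h12 /=; first exact: h12.
apply: lerD; apply: ler_wpM2l => //; rewrite ?subr_ge0//; exact: IH.
Qed.

(** Variance plus squared bias; the shift a is there for the induction,
    which replaces it by a + 1. *)
Lemma bernstein_sqr n (a x : R) :
  bernstein n (fun j => (j%:R + a) ^+ 2) x =
  n%:R * (x * (1 - x)) + (n%:R * x + a) ^+ 2.
Proof.
elim: n a => [|n IH] a /=; first by rewrite !mul0r !add0r.
have -> : (fun j => (j.+1%:R + a) ^+ 2) = (fun j => (j%:R + (1 + a)) ^+ 2) :> (nat -> R).
  by apply/funext => j; rewrite -natr1 addrA.
by rewrite !IH -natr1; ring.
Qed.

(** Bernstein's proof of the Weierstrass theorem: by Chebyshev's inequality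
    B/n is close to x uniformly in x. *)
Lemma bernstein_approx (phi : R -> R) (M e : R) : continuous phi -> 0 < e ->
  (forall x, `|phi x| <= M) ->
  exists n, forall x, 0 <= x <= 1 ->
    `|phi x - bernstein n (fun j => phi (j%:R / n%:R)) x| <= e.
Proof.
move=> cphi e0 phiM.
have M0 : 0 <= M by exact: le_trans (phiM 0).
have e20 : 0 < e / 2 by rewrite divr_gt0.
have [dl dl0 unif] := continuous_uniform_on_segment 1 cphi e20.
pose D := 2 * M / dl ^+ 2.
have D0 : 0 <= D by rewrite divr_ge0 ?sqr_ge0// mulr_ge0.
pose n := (Num.truncn (D / (e / 2))).+1.
have n0 : 0 < n%:R :> R by rewrite ltr0n.
exists n => x x01; have /andP[x0 x1] := x01.
(* Close points are handled by uniform continuity; for distant ones the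
   quadratic term exceeds the trivial bound 2 M. *)
have close y : `|phi x - phi y| <= e / 2 + D * (y - x) ^+ 2.
  have [lt|ge] := ltP `|x - y| dl.
    rewrite (le_trans (ltW (unif x y _ lt)))//; first by rewrite ger0_norm.
    by rewrite lerDl mulr_ge0// sqr_ge0.
  apply: (@le_trans _ _ (D * (y - x) ^+ 2)); last by rewrite lerDr ltW.
  apply: (@le_trans _ _ (2 * M)).
    rewrite (le_trans (ler_normB _ _))//.
    by rewrite (_ : 2 * M = M + M) ?lerD//; ring.
  rewrite /D mulrAC ler_pdivlMr ?exprn_gt0// ler_wpM2l ?mulr_ge0//.
  by rewrite -(real_normK (num_real (y - x))) distrC lerXn2r// nnegrE ltW.
have bE : bernstein n (fun j => e / 2 * 1 + (D / n%:R ^+ 2) *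
     (j%:R + - (n%:R * x)) ^+ 2) x = e / 2 + D * (x * (1 - x)) / n%:R.
  rewrite bernstein_lin bernstein_cst bernstein_sqr.
  move: (n%:R : R) n0 => N N0; field.
  by rewrite gt_eqF.
have small : D * (x * (1 - x)) / n%:R <= e / 2.
  rewrite ler_pdivrMr//.
  have h1 : D / (e / 2) <= n%:R.
    have /andP[_ /ltW//] := truncn_itv (divr_ge0 D0 (ltW e20)).
  rewrite ler_pdivrMr// in h1; rewrite mulrC in h1.
  apply: le_trans h1; rewrite ler_piMr//.
  rewrite mulr_ile1 ?subr_ge0//; lra.
have jE j : (j%:R / n%:R - x) ^+ 2 = (j%:R + - (n%:R * x)) ^+ 2 / n%:R ^+ 2.
  by move: (n%:R : R) n0 => N N0; field; rewrite gt_eqF.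
have sE j : D / n%:R ^+ 2 * (j%:R + - (n%:R * x)) ^+ 2 =
    D * ((j%:R + - (n%:R * x)) ^+ 2 / n%:R ^+ 2) by ring.
have up : bernstein n (fun j => phi (j%:R / n%:R)) x <= phi x + e.
  apply: (@le_trans _ _ (bernstein n (fun j => 1 * phi x + 1 *
    (e / 2 * 1 + (D / n%:R ^+ 2) * (j%:R + - (n%:R * x)) ^+ 2)) x)).
    apply: le_bernstein => // j; have := close (j%:R / n%:R).
    rewrite distrC ler_norml jE => /andP[_]; rewrite lerBlDl !mul1r mulr1 => le.
    by rewrite sE.
  rewrite (bernstein_lin n 1 1 (fun=> phi x)) bE bernstein_cst !mul1r lerD2l.
  by rewrite [leRHS](splitr e) lerD2l.
have lo : phi x - e <= bernstein n (fun j => phi (j%:R / n%:R)) x.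
  apply: (@le_trans _ _ (bernstein n (fun j => 1 * phi x + (-1) *
    (e / 2 * 1 + (D / n%:R ^+ 2) * (j%:R + - (n%:R * x)) ^+ 2)) x)).
    rewrite (bernstein_lin n 1 (-1) (fun=> phi x)) bE bernstein_cst mul1r mulN1r.
    by rewrite lerD2l lerN2 [leRHS](splitr e) lerD2l.
  apply: le_bernstein => // j; have := close (j%:R / n%:R).
  rewrite ler_norml jE => /andP[_]; rewrite lerBlDl mul1r mulN1r mulr1 lerBlDr => le.
  by rewrite sE.
by rewrite ler_norml; apply/andP; split; lra.
Qed.

End bernstein.

(** * From Laplace transforms at integers to convergence in law *)

(** The bookkeeping of the final estimate: a is the perturbed expectation, b
    and f are the expectations of the untruncated function before and in the
    limit, c and d those of the truncated one. *)
Lemma lt_of_gaps (R : realFieldType) (e a b c d f x y z : R) : 0 < e ->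
  `|f - d| <= x -> `|b - c| <= y -> `|a - b| <= e / 16 + (2 * y + z) ->
  `|d - c| < e / 16 -> x <= e / 16 -> y <= 2 * (e / 16) -> z <= e / 16 ->
  `|f - a| < e.
Proof.
move=> e0; rewrite !ler_norml !ltr_norml.
move=> /andP[? ?] /andP[? ?] /andP[? ?] /andP[? ?] ? ? ?.
by apply/andP; split; lra.
Qed.

(** Convergence of the cutoffs bounds the tails for all large n. *)
Lemma one_sub_le_double (R : realFieldType) (e a b : R) :
  `|a - b| < e -> 1 - a < e -> 1 - b <= 2 * e.
Proof. by rewrite ltr_norml => /andP[? ?] ?; lra. Qed.

Section laplace_to_law.
Context d (T : measurableType d) (R : realType) (P : probability T R).
Context d' (T' : measurableType d') (P' : probability T' R).
Variables (V : nat -> T -> R) (W : T' -> R).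
Hypothesis mV : forall n, measurable_fun setT (V n).
Hypothesis mW : measurable_fun setT W.
Hypothesis V0 : forall n w, 0 <= V n w.
Hypothesis W0 : forall w, 0 <= W w.
Hypothesis VW : forall k : nat,
  \int[P]_w expR (- (k%:R * V n w)) @[n --> \oo] -->
  \int[P']_w expR (- (k%:R * W w)).

Let expV n w := expR (- V n w).
Let expW w := expR (- W w).

Let exp01 (v : R) : 0 <= v -> 0 <= expR (- v) <= 1.
Proof. by move=> v0; rewrite expR_ge0 -expR0 ler_expR oppr_le0. Qed.

Let bexpV n : bdd_measurable (expV n).
Proof.
split.
  apply: (measurableT_comp (@measurable_expR R)); exact: measurable_funN.
by exists 1 => w; have /andP[? ?] := exp01 (V0 n w); rewrite ger0_norm.
Qed.

Let bexpW : bdd_measurable expW.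
Proof.
split.
  apply: (measurableT_comp (@measurable_expR R)); exact: measurable_funN.
by exists 1 => w; have /andP[? ?] := exp01 (W0 w); rewrite ger0_norm.
Qed.

Let expV_pow (k : nat) n w : expR (- (k%:R * V n w)) = expV n w ^+ k.
Proof. by rewrite /expV -expRM_natl mulrN. Qed.

Let expW_pow (k : nat) w : expR (- (k%:R * W w)) = expW w ^+ k.
Proof. by rewrite /expW -expRM_natl mulrN. Qed.

Let bpow d0 (S : measurableType d0) (h : S -> R) k : bdd_measurable h ->
  bdd_measurable (fun w => h w ^+ k).
Proof.
move=> bh; elim: k => [|k IH].
  by under eq_fun do rewrite expr0; exact: bdd_measurable_cst.
by under eq_fun do rewrite exprS; exact: bdd_measurableM.
Qed.

Let bbern d0 (S : measurableType d0) (h : S -> R) m u : bdd_measurable h ->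
  bdd_measurable (fun w => bernstein m u (h w)).
Proof.
move=> bh; elim: m u => [|m IH] u /=; first exact: bdd_measurable_cst.
apply: bdd_measurableD; apply: bdd_measurableM => //.
by apply: bdd_measurableB => //; exact: bdd_measurable_cst.
Qed.

(** The hypothesis gives all moments of exp(-V n); by linearity it gives the
    expectations of polynomials, here Bernstein sums. The extra power k is
    there for the induction on m, which multiplies by the variable. *)
Let bernstein_cvg m u k :
  \int[P]_w (expV n w ^+ k * bernstein m u (expV n w)) @[n --> \oo] -->
  \int[P']_w (expW w ^+ k * bernstein m u (expW w)).
Proof.
elim: m u k => [|m IH] u k /=.
  rewrite RintegralZr//; last first.
    by apply: bdd_measurable_integrable; exact: bpow.
  have -> : (fun n => \int[P]_w (expV n w ^+ k * u 0%N)) =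
      (fun n => \int[P]_w expR (- (k%:R * V n w)) * u 0%N).
    apply/funext => n; rewrite RintegralZr//; last first.
      by apply: bdd_measurable_integrable; exact: bpow.
    by congr (_ * _); apply: eq_Rintegral => w _; rewrite expV_pow.
  under eq_Rintegral do rewrite -expW_pow.
  exact: cvgMr_tmp.
have expand (S : Type) (x : S -> R) w :
    x w ^+ k * (x w * bernstein m (fun j => u j.+1) (x w) +
      (1 - x w) * bernstein m u (x w)) =
    x w ^+ k.+1 * bernstein m (fun j => u j.+1) (x w) +
    (x w ^+ k * bernstein m u (x w) - x w ^+ k.+1 * bernstein m u (x w)).
  by rewrite exprS; ring.
have termV n j v : bdd_measurable (fun w => expV n w ^+ j * bernstein m v (expV n w)).
  by apply: bdd_measurableM; [exact: bpow|exact: bbern].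
have termW j v : bdd_measurable (fun w => expW w ^+ j * bernstein m v (expW w)).
  by apply: bdd_measurableM; [exact: bpow|exact: bbern].
under eq_Rintegral do rewrite expand.
rewrite expectD//; last exact: bdd_measurableB.
rewrite expectB//.
have -> : (fun n => \int[P]_w (expV n w ^+ k *
     (expV n w * bernstein m (fun j => u j.+1) (expV n w) +
      (1 - expV n w) * bernstein m u (expV n w)))) =
   (fun n => \int[P]_w (expV n w ^+ k.+1 * bernstein m (fun j => u j.+1) (expV n w)) +
     (\int[P]_w (expV n w ^+ k * bernstein m u (expV n w)) -
      \int[P]_w (expV n w ^+ k.+1 * bernstein m u (expV n w)))).
  apply/funext => n; under eq_Rintegral do rewrite expand.
  by rewrite expectD ?expectB//; exact: bdd_measurableB.
by apply: cvgD => //; apply: cvgB.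
Qed.

Let continuous_exp_cvg (phi : R -> R) (M : R) : continuous phi ->
  (forall x, `|phi x| <= M) ->
  \int[P]_w phi (expV n w) @[n --> \oo] --> \int[P']_w phi (expW w).
Proof.
move=> cphi phiM.
have bphi : bdd_measurable phi.
  by split; [exact: continuous_measurable_fun|exists M].
apply/cvgrPdist_lt => e e0.
have e4 : 0 < e / 4 by rewrite divr_gt0.
have [m mE] := bernstein_approx cphi e4 phiM.
set u := fun j : nat => _ in mE.
have close d0 (S : measurableType d0) (Q : probability S R) (x : S -> R) :
    bdd_measurable x -> (forall w, 0 <= x w <= 1) ->
    `|\int[Q]_w phi (x w) - \int[Q]_w bernstein m u (x w)| <= e / 4.
  move=> bx x01; have [mx _] := bx.
  have bpx : bdd_measurable (fun w => phi (x w)) by exact: bdd_measurable_comp bphi mx.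
  rewrite -expectB//; last exact: bbern.
  apply: norm_expect_le; first by apply: bdd_measurableB => //; exact: bbern.
  by move=> w; exact: mE.
have cvb := @bernstein_cvg m u 0%N.
have /cvgrPdist_lt /(_ _ e4) := cvb.
apply: filterS => n.
under eq_Rintegral do rewrite expr0 mul1r.
under [X in _ - X]eq_Rintegral do rewrite expr0 mul1r.
have cV := close _ _ P (expV n) (bexpV n) (fun w => exp01 (V0 n w)).
have cW := close _ _ P' expW bexpW (fun w => exp01 (W0 w)).
move: cV cW; rewrite !ler_norml !ltr_norml => /andP[? ?] /andP[? ?] /andP[? ?].
apply/andP; split; lra.
Qed.

(** A continuous function of v that vanishes for large v is a continuous
    function of exp(-v), the value at 0 included. *)
Let compact_support_cvg (psi : R -> R) (M K : R) : continuous psi ->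
  (forall x, `|psi x| <= M) -> (forall x, K <= x -> psi x = 0) ->
  \int[P]_w psi (V n w) @[n --> \oo] --> \int[P']_w psi (W w).
Proof.
move=> cpsi psiM psi0.
(* The argument of the logarithm is kept above exp(-K), below which the
   function is 0 anyway. *)
pose phi x := psi (- ln (Num.max x (expR (- K)))).
have phiE v : phi (expR (- v)) = psi v.
  rewrite /phi; have [le|lt] := leP K v.
    by rewrite max_r ?ler_expR ?lerN2// expRK opprK !psi0.
  by rewrite max_l ?expRK ?opprK// ler_expR lerN2 ltW.
have cphi : continuous phi.
  move=> x.
  have m0 : 0 < Num.max x (expR (- K)) by rewrite lt_max expR_gt0 orbT.
  have c1 : Num.max y (expR (- K)) @[y --> x] --> Num.max x (expR (- K)).
    apply: (@continuous_max _ _ (fun y : R => y) (fun=> expR (- K)) x).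
      exact: cvg_id.
    exact: cvg_cst.
  have c2 := cvg_comp _ _ c1 (@continuous_ln _ _ m0).
  have c3 : - ln (Num.max y (expR (- K))) @[y --> x] --> - ln (Num.max x (expR (- K))).
    exact: cvgN.
  exact: (cvg_comp _ _ c3 (cpsi _)).
have := continuous_exp_cvg cphi (fun x => psiM _).
rewrite /expV /expW; under eq_Rintegral do rewrite phiE.
have -> // : (fun n => \int[P]_w phi (expR (- V n w))) =
  (fun n => \int[P]_w psi (V n w)).
by apply/funext => n; under eq_Rintegral do rewrite phiE.
Qed.

(** Equal to 1 up to K, to 0 from K + 1 on, and affine in between. *)
Let cutoff (K v : R) : R := Num.max 0 (Num.min 1 (K + 1 - v)).

Let cutoff01 K v : 0 <= cutoff K v <= 1.
Proof. by rewrite /cutoff le_max lexx ge_max ge_min lexx ler01. Qed.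

Let cutoff1 K v : v <= K -> cutoff K v = 1.
Proof.
move=> vK; have h : 1 <= K + 1 - v by rewrite addrAC lerDr subr_ge0.
by rewrite /cutoff min_l// max_r.
Qed.

Let cutoff0 K v : K + 1 <= v -> cutoff K v = 0.
Proof.
move=> vK; have h : K + 1 - v <= 0 by rewrite subr_le0.
by rewrite /cutoff min_r ?max_l// (le_trans h).
Qed.

Let continuous_cutoff K : continuous (cutoff K).
Proof.
move=> v; apply: (@continuous_max _ _ (fun=> 0)
  (fun v : R => Num.min 1 (K + 1 - v)) v); first exact: cvg_cst.
apply: (@continuous_min _ _ (fun=> 1) (fun v : R => K + 1 - v) v).
  exact: cvg_cst.
by apply: cvgB; [exact: cvg_cst|exact: cvg_id].
Qed.

(** The limit W is finite everywhere, so its tails vanish; no mass of V n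
    escapes to infinity because the cutoff itself has compact support. *)
Let tail_cvg : \int[P']_w (1 - cutoff K%:R (W w)) @[K --> \oo] --> 0.
Proof.
rewrite -[X in _ --> X](expect_cst P' 0).
apply: (@expect_cvg _ _ _ _ _ _ 1).
- move=> K; apply: measurable_funB => //.
  apply: (measurableT_comp _ mW); apply: continuous_measurable_fun.
  exact: continuous_cutoff.
- move=> K w; have /andP[? ?] := cutoff01 K%:R (W w).
  by rewrite ger0_norm ?subr_ge0// gerBl.
- move=> w; have : (cst 0 : nat -> R) @ \oo --> (0 : R) by exact: cvg_cst.
  apply: cvg_trans; apply: near_eq_cvg; near=> K.
  rewrite /= cutoff1 ?subrr//; near: K; exact: nbhs_infty_ger.
Unshelve. all: by end_near. Qed.

(** A truncation reduces g(c V) to a function of V with compact support, the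
    truncated mass being controlled by the limit. For Y in place of c V, use
    uniform continuity of g on the truncated range, and Chebyshev's
    inequality for the event that Y is far from c V. *)
Lemma law_limit (Y : nat -> T -> R) (c : R) (g : R -> R) (M : R) :
  (forall n, measurable_fun setT (Y n)) ->
  (forall n, bdd_measurable (fun w => Y n w - c * V n w)) ->
  \int[P]_w (Y n w - c * V n w) ^+ 2 @[n --> \oo] --> 0 ->
  continuous g -> (forall x, `|g x| <= M) ->
  \int[P]_w g (Y n w) @[n --> \oo] --> \int[P']_w g (c * W w).
Proof.
move=> mY bD D0 cg gM.
have M0 : 0 <= M by exact: le_trans (gM 0).
have mg : measurable_fun setT g by exact: continuous_measurable_fun.
have bg : bdd_measurable g by split => //; exists M.
have bcut K : bdd_measurable (cutoff K).
  split; first by apply: continuous_measurable_fun; exact: continuous_cutoff.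
  by exists 1 => v; have /andP[? ?] := cutoff01 K v; rewrite ger0_norm.
apply/cvgrPdist_lt => e e0.
pose e1 := e / (16 * (M + 1)).
have M1 : 0 < M + 1 by rewrite ltr_wpDl.
have e10 : 0 < e1 by rewrite divr_gt0// mulr_gt0.
have e40 : 0 < e / 16 by rewrite divr_gt0.
have Me1 : M * e1 <= e / 16.
  rewrite (_ : M * e1 = e / 16 * (M / (M + 1))); last first.
    by rewrite /e1; field; rewrite gt_eqF.
  by rewrite ler_piMr ?(ltW e40)// ler_pdivrMr// mul1r lerDl.
have [K KW] : exists K : nat, \int[P']_w (1 - cutoff K%:R (W w)) < e1.
  have /cvgrPdist_lt /(_ _ e10) := tail_cvg.
  case=> K _ /(_ K (leqnn K)) h; exists K.
  by move: h; rewrite /= sub0r normrN; apply: le_lt_trans; exact: ler_norm.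
pose psi v := g (c * v) * cutoff K%:R v.
have cpsi : continuous psi.
  move=> v; apply: cvgM; last exact: continuous_cutoff.
  have k1 : c * y @[y --> v] --> c * v by exact: mulrl_continuous.
  exact: (cvg_comp _ _ k1 (cg (c * v))).
have psiM v : `|psi v| <= M.
  have /andP[? ?] := cutoff01 K%:R v.
  by rewrite normrM -[leRHS]mulr1 ler_pM// ger0_norm.
have psi0 v : K%:R + 1 <= v -> psi v = 0 by move=> h; rewrite /psi cutoff0// mulr0.
have psi_cvg := compact_support_cvg cpsi psiM psi0.
have ccut : continuous (cutoff K%:R) by exact: continuous_cutoff.
have cutM v : `|cutoff K%:R v| <= 1.
  by have /andP[? ?] := cutoff01 K%:R v; rewrite ger0_norm.
have cut_cvg := compact_support_cvg ccut cutM (fun v h => cutoff0 h).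
have [dl dl0 unif] := continuous_uniform_on_segment (`|c| * (K%:R + 1)) cg e40.
pose D := 2 * M / dl ^+ 2.
have DP : 0 <= D by rewrite divr_ge0 ?sqr_ge0// mulr_ge0.
have pos1 : 0 < e / 16 / (D + 1) by rewrite divr_gt0// ltr_wpDl.
have /cvgrPdist_lt /(_ _ e40) E1 := psi_cvg.
have /cvgrPdist_lt /(_ _ e10) E2 := cut_cvg.
have /cvgrPdist_lt /(_ _ pos1) E3 := D0.
near=> n.
have e1n : `|\int[P']_w psi (W w) - \int[P]_w psi (V n w)| < e / 16.
  by near: n; exact: E1.
have e2n : `|\int[P']_w cutoff K%:R (W w) - \int[P]_w cutoff K%:R (V n w)| < e1.
  by near: n; exact: E2.
have e3n : `|0 - \int[P]_w (Y n w - c * V n w) ^+ 2| < e / 16 / (D + 1).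
  by near: n; exact: E3.
have bgY : bdd_measurable (fun w => g (Y n w)) by exact: bdd_measurable_comp bg (mY n).
have mcV : measurable_fun setT (fun w => c * V n w) by exact: measurableT_comp.
have mcW : measurable_fun setT (fun w => c * W w) by exact: measurableT_comp.
have bgV : bdd_measurable (fun w => g (c * V n w)) by exact: bdd_measurable_comp bg mcV.
have bgW : bdd_measurable (fun w => g (c * W w)) by exact: bdd_measurable_comp bg mcW.
have bcV : bdd_measurable (fun w => cutoff K%:R (V n w)).
  exact: bdd_measurable_comp (bcut _) (mV n).
have bcW : bdd_measurable (fun w => cutoff K%:R (W w)).
  exact: bdd_measurable_comp (bcut _) mW.
have b1V : bdd_measurable (fun w => 1 - cutoff K%:R (V n w)).
  by apply: bdd_measurableB => //; exact: bdd_measurable_cst.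
have b1W : bdd_measurable (fun w => 1 - cutoff K%:R (W w)).
  by apply: bdd_measurableB => //; exact: bdd_measurable_cst.
have bD2 : bdd_measurable (fun w => (Y n w - c * V n w) ^+ 2).
  by under eq_fun do rewrite expr2; exact: bdd_measurableM.
have bpV : bdd_measurable (fun w => psi (V n w)) by exact: bdd_measurableM.
have bpW : bdd_measurable (fun w => psi (W w)) by exact: bdd_measurableM.
have tW : \int[P']_w (1 - cutoff K%:R (W w)) = 1 - \int[P']_w cutoff K%:R (W w).
  by rewrite expectB ?expect_cst//; exact: bdd_measurable_cst.
have tV : \int[P]_w (1 - cutoff K%:R (V n w)) = 1 - \int[P]_w cutoff K%:R (V n w).
  by rewrite expectB ?expect_cst//; exact: bdd_measurable_cst.
have gap v : `|g (c * v) - psi v| <= M * (1 - cutoff K%:R v).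
  have /andP[? ?] := cutoff01 K%:R v.
  rewrite /psi -{1}[g _]mulr1 -mulrBr normrM [`|1 - _|]ger0_norm ?subr_ge0//.
  by rewrite ler_wpM2r ?subr_ge0.
have dW : `|\int[P']_w g (c * W w) - \int[P']_w psi (W w)| <=
    M * \int[P']_w (1 - cutoff K%:R (W w)).
  rewrite -expectB// -expectZ//.
  apply: (le_trans (le_norm_expect P' (bdd_measurableB bgW bpW))).
  by apply: le_expect => //; [apply: bdd_measurable_norm; exact: bdd_measurableB|
    exact: bdd_measurableZ].
have dV : `|\int[P]_w g (c * V n w) - \int[P]_w psi (V n w)| <=
    M * \int[P]_w (1 - cutoff K%:R (V n w)).
  rewrite -expectB// -expectZ//.
  apply: (le_trans (le_norm_expect P (bdd_measurableB bgV bpV))).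
  by apply: le_expect => //; [apply: bdd_measurable_norm; exact: bdd_measurableB|
    exact: bdd_measurableZ].
(* Either V is beyond the truncation, or Y is close to c V, or Y is far from
   c V: each term on the right covers one case. *)
have pt w : `|g (Y n w) - g (c * V n w)| <=
    e / 16 + (2 * M * (1 - cutoff K%:R (V n w)) + D * (Y n w - c * V n w) ^+ 2).
  have /andP[q0 q1] := cutoff01 K%:R (V n w).
  have q2 : 0 <= 1 - cutoff K%:R (V n w) by rewrite subr_ge0.
  have two : `|g (Y n w) - g (c * V n w)| <= 2 * M.
    by rewrite (le_trans (ler_normB _ _))// mulr_natl mulr2n lerD.
  have nn1 : 0 <= 2 * M * (1 - cutoff K%:R (V n w)) by rewrite !mulr_ge0.
  have nn2 : 0 <= D * (Y n w - c * V n w) ^+ 2 by rewrite mulr_ge0// sqr_ge0.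
  have [le|gt] := leP (V n w) (K%:R + 1); last first.
    have far : 2 * M <= 2 * M * (1 - cutoff K%:R (V n w)).
      by rewrite cutoff0 ?subr0 ?mulr1// ltW.
    rewrite (le_trans two)// (le_trans far)// addrCA lerDl addr_ge0//.
    exact: ltW.
  have [lt|ge] := ltP `|c * V n w - Y n w| dl.
    have := unif (c * V n w) (Y n w) _ lt.
    rewrite normrM (ger0_norm (V0 n w)) ler_wpM2l// => /(_ isT).
    by rewrite distrC => /ltW/le_trans; apply; rewrite lerDl addr_ge0.
  have far : 2 * M <= D * (Y n w - c * V n w) ^+ 2.
    rewrite /D mulrAC ler_pdivlMr ?exprn_gt0// ler_wpM2l ?mulr_ge0//.
    by rewrite -(real_normK (num_real (Y n w - _))) distrC lerXn2r// nnegrE ltW.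
  by rewrite (le_trans two)// (le_trans far)// addrA lerDr addr_ge0// ltW.
have dY : `|\int[P]_w g (Y n w) - \int[P]_w g (c * V n w)| <=
    e / 16 + (2 * M * \int[P]_w (1 - cutoff K%:R (V n w)) +
    D * \int[P]_w (Y n w - c * V n w) ^+ 2).
  have bZ1 := bdd_measurableZ (2 * M) b1V.
  have bZ2 := bdd_measurableZ D bD2.
  have be := bdd_measurable_cst T (e / 16).
  rewrite -(expect_cst P (e / 16)) -!expectZ// -expectD// -expectD//; last first.
    exact: bdd_measurableD.
  rewrite -expectB//.
  apply: (le_trans (le_norm_expect P (bdd_measurableB bgY bgV))).
  apply: le_expect => //; first by apply: bdd_measurable_norm; exact: bdd_measurableB.
  by apply: bdd_measurableD => //; exact: bdd_measurableD.
have Dle : D * \int[P]_w (Y n w - c * V n w) ^+ 2 <= e / 16.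
  have I0 : 0 <= \int[P]_w (Y n w - c * V n w) ^+ 2.
    by apply: Rintegral_ge0 => w _; exact: sqr_ge0.
  move: e3n; rewrite sub0r normrN ger0_norm// ltr_pdivlMr ?ltr_wpDl// => h.
  apply: le_trans (ltW h); rewrite mulrC ler_wpM2l//.
  by rewrite lerDl.
have MtV : M * \int[P]_w (1 - cutoff K%:R (V n w)) <= 2 * (e / 16).
  apply: (@le_trans _ _ (M * (2 * e1))); last by rewrite mulrCA ler_wpM2l.
  rewrite ler_wpM2l// tV; rewrite tW in KW.
  exact: one_sub_le_double e2n KW.
have MtW : M * \int[P']_w (1 - cutoff K%:R (W w)) <= e / 16.
  by apply: le_trans Me1; rewrite ler_wpM2l// ltW.
by rewrite -mulrA in dY; exact: (lt_of_gaps e0 dW dV dY e1n MtW MtV Dle).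
Unshelve. all: by end_near. Qed.

End laplace_to_law.

(** * Symmetric 1-stable processes and the exponential limit *)

Section normalized_process.
Context d (T : measurableType d) (R : realType) (P : probability T R).
Variable X : R -> T -> R.
Hypothesis hX : symmetric_1stable P X.

(** The process minus its starting value has the same increments and starts
    from 0 everywhere; it differs from X on a single null set, the same for
    all times. *)
Definition recentred (s : R) (w : T) : R := X s w - X 0 w.

Let levyX : levy_process P X. Proof. by case: hX. Qed.

Lemma recentred_ae : {ae P, forall w, forall s, recentred s w = X s w}.
Proof.
have := levy_start levyX; apply: filterS => w X0 s.
by rewrite /recentred X0 subr0.
Qed.

Let mX s : 0 <= s -> measurable_fun setT (X s).
Proof. exact: (levy_measurable levyX). Qed.

Let mrec s : 0 <= s -> measurable_fun setT (recentred s).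
Proof. by move=> s0; apply: measurable_funB; exact: mX. Qed.

Lemma eq_expect_ae (g h : T -> R) : bdd_measurable g -> bdd_measurable h ->
  {ae P, forall w, g w = h w} -> \int[P]_w g w = \int[P]_w h w.
Proof.
move=> [mg _] [mh _] gh; rewrite /Rintegral; congr fine.
apply: ae_eq_integral => //; [exact/measurable_EFinP..|].
by apply: filterS gh => w -> _.
Qed.

Let bcos (Y : T -> R) x : measurable_fun setT Y ->
  bdd_measurable (fun w => cos (x * Y w)).
Proof.
move=> mY; split; last by exists 1 => w; exact: cos_max.
apply: (measurableT_comp (continuous_measurable_fun (@continuous_cos R))).
exact: measurableT_comp.
Qed.

Let bsin (Y : T -> R) x : measurable_fun setT Y ->
  bdd_measurable (fun w => sin (x * Y w)).
Proof.
move=> mY; split; last by exists 1 => w; exact: sin_max.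
apply: (measurableT_comp (continuous_measurable_fun (@continuous_sin R))).
exact: measurableT_comp.
Qed.

Let recentred_cos s x : 0 <= s -> 0 <= x ->
  \int[P]_w cos (x * recentred s w) = expR (- (s * x)).
Proof.
move=> s0 x0; have [_ /(_ s x s0)] := hX.
move=> /(congr1 (@complex.Re R)) /=; rewrite unlock ger0_norm// => <-.
apply: eq_expect_ae; [exact/bcos/mrec|exact/bcos/mX|].
by apply: filterS recentred_ae => w ->.
Qed.

Let recentred_sin s x : 0 <= s -> 0 <= x ->
  \int[P]_w sin (x * recentred s w) = 0.
Proof.
move=> s0 x0; have [_ /(_ s x s0)] := hX.
move=> /(congr1 (@complex.Im R)) /=; rewrite unlock => <-.
apply: eq_expect_ae; [exact/bsin/mrec|exact/bsin/mX|].
by apply: filterS recentred_ae => w ->.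
Qed.

Lemma cauchy_process_recentred : cauchy_process P recentred.
Proof.
have incE s u w : recentred s w - recentred u w = X s w - X u w.
  by rewrite /recentred; ring.
split => //.
- move=> w s s0; have [rc _] := levy_cadlag levyX w.
  by apply: cvgB; [exact: rc|exact: cvg_cst].
- by move=> w; rewrite /recentred subrr.
- move=> s h s0 h0; split.
    by apply: measurable_funB; apply: mrec => //; rewrite addr_ge0// ltW.
  move=> a b ab.
  have := cauchy_law_itv h0 (mrec (ltW h0))
    (fun x => @recentred_cos h x (ltW h0)) (fun x => @recentred_sin h x (ltW h0)) ab.
  move=> <-.
  have := levy_stationary levyX s0 (ltW h0) (measurable_itv `]a, b]).
  rewrite (_ : X (s + h) \- X s = (fun w => recentred (s + h) w - recentred s w)) => [->//|].
  by apply/funext => w; rewrite incE.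
- move=> n u u0 uS.
  rewrite (_ : (fun (i : 'I_n) w => recentred (u i.+1) w - recentred (u i) w) =
    (fun i : 'I_n => X (u i.+1) \- X (u i))).
    by apply: (levy_independent levyX) => // i _; exact: uS.
  by apply/funext => i; apply/funext => w; rewrite incE.
Qed.

End normalized_process.

Lemma bounded_fun_bound (T : Type) (R : realType) (h : T -> R) :
  bounded_fun h -> exists M, forall x, `|h x| <= M.
Proof.
move=> /pinfty_ex_gt0[M _ hM]; exists M => x; exact: hM.
Qed.

(** Inside [-1, 1] the function is bounded, and outside |f(x)| <= |x f(x)|. *)
Lemma moment_boundedP (R : realType) (f : R -> R) :
  measurable_fun setT f -> bounded_fun f ->
  (\int[@lebesgue_measure R]_x (`|x * f x|)%:E < +oo)%E -> moment_bounded f.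
Proof.
move=> mf /bounded_fun_bound[M fM] hfi.
have bf : bdd_measurable f by split => //; exists M.
have M0 : 0 <= M by exact: le_trans (fM 0).
have ixf : (@lebesgue_measure R).-integrable setT (EFin \o (fun y => y * f y)).
  apply/integrableP; split => //; apply/measurable_EFinP.
  exact: measurable_funM.
have iI : (@lebesgue_measure R).-integrable setT
    (EFin \o (fun y => \1_(`[- 1, 1]%classic : set R) y * M)).
  apply: integrable_indic_mul; first exact: measurable_itv.
  exact: integrable_itv_cst.
split => //.
apply: le_integrable (integrable_addr iI (integrable_normr ixf)) => //.
- exact/measurable_EFinP.
- move=> y _ /=; rewrite lee_fin [leRHS]ger0_norm; last first.
    by rewrite addr_ge0// mulr_ge0.
  rewrite indicE; case: (boolP (y \in _)) => [_|] /=.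
    by rewrite mul1r (le_trans (fM y))// lerDl.
  rewrite notin_setE /= in_itv/= -ler_norml => /negP; rewrite -ltNge => y1.
  by rewrite mul0r add0r normrM ler_peMl// ltW.
Qed.

Section exponential_laplace.
Context d (T : measurableType d) (R : realType) (P : probability T R).
Notation mu := (@lebesgue_measure R).
Variables (Z : {RV P >-> R}) (t : R).
Hypothesis t0 : 0 < t.
Hypothesis hZ : exponential_with_mean Z t.

Let mZ : measurable_fun setT Z. Proof. exact: measurable_funPT. Qed.

Lemma exponential_ge0_ae : {ae P, forall w, 0 <= Z w}.
Proof.
exists (Z @^-1` `]-oo, 0[); split.
- by rewrite -[X in measurable X]setTI; apply: mZ => //; exact: measurable_itv.
- have := hZ (measurable_itv `]-oo, 0[); rewrite /distribution /pushforward => ->.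
  rewrite /exponential_prob; apply: integral0_eq => x.
  by rewrite /= in_itv/= => x0; rewrite lt0_exponential_pdf.
- by move=> w /= /negP; rewrite -ltNge in_itv.
Qed.

Lemma laplace_exponential (k : R) : 0 <= k ->
  \int[P]_w expR (- (k * Num.max (Z w) 0)) = (1 + k * t)^-1.
Proof.
move=> k0; have r0 : 0 < t^-1 by rewrite invr_gt0.
have e0 : 0 < t^-1 + k by rewrite ltr_pwDl.
have mh : measurable_fun [set: R] (fun z : R => expR (- (k * Num.max z 0))).
  apply: (measurableT_comp (@measurable_expR R)); apply: measurable_funN.
  by apply: measurable_funM => //; exact: measurable_maxr.
have := ge0_integral_density mZ (measurable_exponential_pdf t^-1)
  (exponential_pdf_ge0 (ltW r0)) hZ mh (fun z => expR_ge0 _).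
rewrite /Rintegral => ->; rewrite -/(Rintegral _ _ _).
transitivity (\int[mu]_z (\1_(`[0, +oo[%classic : set R) z *
    (t^-1 * expR (- (t^-1 + k) * z)))).
  apply: eq_Rintegral => z _; rewrite indicE.
  case: (boolP (z \in _)) => [|] /=.
    rewrite inE /= in_itv/= andbT => z0.
    rewrite mul1r exponential_pdfE// max_l// mulrCA -expRD.
    by congr (_ * expR _); ring.
  rewrite notin_setE /= in_itv/= andbT => /negP; rewrite -ltNge => z0.
  by rewrite lt0_exponential_pdf// mulr0 mul0r.
rewrite Rintegral_indic_mul RintegralZl//; last exact: integrable_expR_itvy.
rewrite Rintegral_expR_itvy//; field.
by rewrite !gt_eqF//= ltr_pwDl// mulr_ge0// ltW.
Qed.

End exponential_laplace.

Unset Implicit Arguments.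

Theorem theorem1p1 (R : realType)
    (d : measure_display) (T : measurableType d) (P : probability T R)
    (X : R -> T -> R) (hX : symmetric_1stable P X)
    (f : R -> R) (hfm : measurable_fun [set: R] f) (hfb : bounded_fun f)
    (hfi : (\int[@lebesgue_measure R]_x (`|x * f x|)%:E < +oo)%E)
    (t : R) (ht : 0 < t)
    (d' : measure_display) (T' : measurableType d') (P' : probability T' R)
    (Z : {RV P' >-> R}) (hZ : exponential_with_mean Z t) :
  cvg_in_law P
    (fun (n : nat) (w : T) =>
       n%:R^-1 *
       \int[@lebesgue_measure R]_(s in `[0, expR (n%:R * t)]) f (X s w))
    P'
    (fun w : T' => (pi^-1 * \int[@lebesgue_measure R]_x f x) * Z w).
Proof.
have Hf := moment_boundedP hfm hfb hfi.
have [bf _ _] := Hf.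
have [levyX _] := hX.
have cX := cauchy_process_recentred hX.
set c := \int[@lebesgue_measure R]_x f x.
have mY (X' : R -> T -> R) n :
    (forall s, 0 <= s -> measurable_fun setT (X' s)) ->
    (forall w s, 0 <= s -> X' r w @[r --> s^'+] --> X' s w) ->
    bdd_measurable (fun w => n%:R^-1 *
      \int[@lebesgue_measure R]_(s in `[0, expR (n%:R * t)]) f (X' s w)).
  move=> mX' rcX'; apply: bdd_measurableZ.
  exact: (bdd_measurable_time_integral mX' rcX' _ bf).
have mYX n := mY X n (levy_measurable levyX) (fun w s s0 => proj1 (levy_cadlag levyX w) s s0).
have mYrec n := mY (recentred X) n (cauchy_process_measurable cX)
  (cauchy_process_right_continuous cX).
have mZ : measurable_fun setT Z by exact: measurable_funPT.
split.
- by move=> n; case: (mYX n).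
- exact: measurable_funM.
move=> g cg /bounded_fun_bound[M gM].
have bg : bdd_measurable g by split; [exact: continuous_measurable_fun|exists M].
pose V n w : R := n%:R^-1 * occupation (recentred X) (Num.truncn (expR (n%:R * t))) w.
(* Z is nonnegative only almost surely, whereas the Laplace criterion is
   stated for nonnegative functions. *)
pose W w : R := pi^-1 * Num.max (Z w) 0.
have bV n : bdd_measurable (V n).
  by apply: bdd_measurableZ; exact: (bdd_measurable_occupation cX).
have mW : measurable_fun setT W.
  by apply: measurable_funM => //; exact: measurable_maxr.
have lim := @law_limit _ _ _ P _ _ P' V W (fun n => proj1 (bV n)) mW _ _ _
  (fun n w => n%:R^-1 *
    \int[@lebesgue_measure R]_(s in `[0, expR (n%:R * t)]) f (recentred X s w))
  c g M (fun n => proj1 (mYrec n)) _ _ cg gM.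
have {lim} lim : \int[P]_w g (n%:R^-1 *
    \int[@lebesgue_measure R]_(s in `[0, expR (n%:R * t)]) f (recentred X s w))
    @[n --> \oo] --> \int[P']_w g (c * W w).
  apply: lim.
  - by move=> n w; rewrite mulr_ge0 ?invr_ge0// occupation_ge0.
  - by move=> w; rewrite mulr_ge0 ?invr_ge0 ?pi_ge0// le_max lexx orbT.
  - move=> k; rewrite /W; under eq_Rintegral do rewrite mulrA.
    rewrite (laplace_exponential ht hZ); last by rewrite mulr_ge0// invr_ge0 pi_ge0.
    rewrite -mulrA (mulrC pi^-1).
    exact: (laplace_occupation_cvg cX).
  - by move=> n; apply: bdd_measurableB => //; exact: bdd_measurableZ.
  - exact: (occupation_difference_cvg cX Hf ht).
pose Y n w : R := n%:R^-1 *
  \int[@lebesgue_measure R]_(s in `[0, expR (n%:R * t)]) f (X s w).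
have expectY n : 'E_P[g \o Y n]%E =
    (\int[P]_w g (n%:R^-1 *
    \int[@lebesgue_measure R]_(s in `[0, expR (n%:R * t)]) f (recentred X s w)))%:E.
  have bgX := bdd_measurable_comp bg (proj1 (mYX n)).
  have bgr := bdd_measurable_comp bg (proj1 (mYrec n)).
  rewrite (expectationE P bgX); congr (_%:E); apply: eq_expect_ae => //.
  apply: filterS (recentred_ae hX) => w rE /=; congr (g (_ * _)).
  by apply: eq_Rintegral => s _; rewrite rE.
pose Y' w : R := (pi^-1 * c) * Z w.
have mcZ : measurable_fun setT Y' by exact: measurable_funM.
have bgZ := bdd_measurable_comp bg mcZ.
have mcW : measurable_fun setT (fun w => c * W w) by exact: measurable_funM.
have bgW := bdd_measurable_comp bg mcW.
have expectY' : 'E_P'[g \o Y']%E = (\int[P']_w g (c * W w))%:E.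
  rewrite (expectationE P' bgZ); congr (_%:E); apply: eq_expect_ae => //.
  apply: filterS (exponential_ge0_ae hZ) => w Z0 /=; congr g.
  by rewrite /Y' /W max_l// mulrCA mulrA.
rewrite expectY'; under eq_cvg do rewrite expectY.
by apply: cvg_EFin => //; exact: nearW.
Qed.
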